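(* Let $d\ge 1$ and let $K:\mathbb{R}_*^d\times\mathbb{R}_*^d\to[0,\infty)$ be continuous and symmetric, $K(x,y)=K(y,x)$. Suppose that there are $c_2\in(0,\infty)$, $\beta\in\mathbb{R}$ and $\gamma=(\gamma_1,\gamma_2),\lambda=(\lambda_1,\lambda_2)\in\mathbb{R}^2$ with $-\lambda_j\le\gamma_j+\lambda_j$ and $\gamma_j+\lambda_j<1$ for $j=1,2$, such that for all $x,y\in\mathbb{R}_*^d$ with $|y|\le|x|$, $$K(x,y)\le c_2\begin{cases}|x|^{-\beta}|y|^{-\beta}, & |x|,|y|\le1,\\ |x|^{\gamma_1+\lambda_1}|y|^{-\lambda_1}, & |x|\ge1,\ |y|\le1,\\ |x|^{\gamma_2+\lambda_2}|y|^{-\lambda_2}, & |x|,|y|\ge1.\end{cases}$$ Suppose that $f_0\in\mathcal{M}_+(\mathbb{R}_*^d)$ satisfies, for some $r>0$, $$\int_{\mathbb{R}_*^d}\left(|x|^{\min(-\beta,-\lambda_1)-r}+|x|\right)f_0(dx)<\infty.$$ Then there exists a weak solution $f:[0,\infty)\to\mathcal{M}_+(\mathbb{R}_*^d)$ to the multicomponent Smoluchowski coagulation equation with kernel $K$ and with initial data $f(\cdot,0)=f_0$.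
   Context: $\mathbb{R}_*^d=[0,\infty)^d\setminus\{0\}$ and $|x|=\sum_{j=1}^d|x_j|$. $\mathcal{M}_+(\mathbb{R}_*^d)$ is the set of positive Radon measures on $\mathbb{R}_*^d$; $\mathcal{M}_b(\mathbb{R}_*^d)$ is the space of signed bounded Radon measures, identified with the dual of $C_0(\mathbb{R}_*^d)$, the sup-norm closure of $C_c(\mathbb{R}_*^d)$. For a continuous $\omega\ge0$ and a measure $\mu$, $\omega\mu$ is the weighted measure $\omega(x)\mu(dx)$; $(\omega f)(\cdot,t)=\omega f(\cdot,t)$. For vectors, $a\le b$ means componentwise inequality. Weight: $\omega(x)=|x|^{\min(-\beta,-\lambda_1)}$ if $|x|\le1$, and $\omega(x)=|x|^{\max(\gamma_1+\lambda_1,\gamma_2+\lambda_2)}$ if $|x|>1$. Test functions: $C^1([0,\infty);C_c(\mathbb{R}_*^d))$ denotes the set of functions $\varphi:\mathbb{R}_*^d\times[0,\infty)\to\mathbb{R}$ such that for each fixed $x\in\mathbb{R}_*^d$ the function $\varphi(x,\cdot)$ is continuously differentiable, and $\varphi(\cdot,t)\in C_c(\mathbb{R}_*^d)$ for all $t\in[0,\infty)$. Weak solution: Let $f_0\in\mathcal{M}_+(\mathbb{R}_*^d)$ with $\int|x|f_0(dx)+\int\omega(x)f_0(dx)<\infty$. A map $f:[0,\infty)\to\mathcal{M}_+(\mathbb{R}_*^d)$ is a weak solution with initial data $f_0$ if: (a) $f(\cdot,0)=f_0$; (b) $\omega f\in C([0,\infty);\mathcal{M}_b(\mathbb{R}_*^d))$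 with $\mathcal{M}_b(\mathbb{R}_*^d)$ endowed with the weak*-topology; (c) $\sup_{s\in[0,t]}\int_{\mathbb{R}_*^d}\omega(x)f(dx,s)<\infty$ for all $t\ge0$; (d) $\int_{\mathbb{R}_*^d}x f(dx,t)\le\int_{\mathbb{R}_*^d}x f_0(dx)$ (componentwise) for all $t\ge0$; (e) for all $t\ge0$ and all $\varphi\in C^1([0,\infty);C_c(\mathbb{R}_*^d))$, $$\int\varphi(x,t)f(dx,t)-\int\varphi(x,0)f_0(dx)=\int_0^t\int f(dx,s)\partial_s\varphi(x,s)\,ds+\frac12\int_0^t\iint K(x,y)f(dx,s)f(dy,s)\left[\varphi(x+y,s)-\varphi(x,s)-\varphi(y,s)\right]ds,$$ all integrals being over $\mathbb{R}_*^d$.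
   Formalization: Test functions in C^1([0,∞);C_c) are additionally required, on each bounded time interval, to have supports in one common compact subset of R_*^d and bounded time derivative; with only the slicewise conditions the integrals in (e) may be undefined and the claim fails. *)

(* Defs.v *)
From mathcomp Require Import all_boot all_order all_algebra.
From mathcomp Require Import all_classical all_reals all_analysis.

Set Implicit Arguments.
Unset Strict Implicit.
Unset Printing Implicit Defensive.

Import Order.TTheory GRing.Theory Num.Theory.
Import numFieldNormedType.Exports.

Local Open Scope classical_set_scope.
Local Open Scope ring_scope.

Definition norm1 (R : realType) (d : nat) (x : 'rV[R]_d) : R :=
  \sum_(j < d) `|x ord0 j|.

Definition Rstar (R : realType) (d : nat) : set 'rV[R]_d :=
  [set x | (forall j, 0 <= x ord0 j) /\ x <> 0].

Definition borelRV (R : realType) (d : nat) :=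
  g_sigma_algebraType (@open ('rV[R]_d)).

(* A Borel measure on Rstar is encoded as a Borel measure on R^d for which the
   complement of Rstar is null; it may have infinite mass near the origin.
   As Rstar is locally compact and second countable, Radon means finite on the
   compact subsets of Rstar (which exclude neighbourhoods of the origin). *)
Definition radon_pos (R : realType) (d : nat)
    (mu : {measure set (borelRV R d) -> \bar R}) : Prop :=
  mu (~` @Rstar R d) = 0%E /\
  forall C : set 'rV[R]_d, compact C -> C `<=` @Rstar R d -> (mu C < +oo)%E.

(* C_c(Rstar); functions are defined on R^d, but only their values on Rstar
   matter. *)
Definition Cc (R : realType) (d : nat) : set ('rV[R]_d -> R) :=
  [set psi | {within @Rstar R d, continuous psi} /\
    exists C : set 'rV[R]_d, [/\ compact C, C `<=` @Rstar R d &
      forall x, Rstar x -> ~ C x -> psi x = 0]].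

Definition C0 (R : realType) (d : nat) : set ('rV[R]_d -> R) :=
  [set psi | forall e : R, 0 < e -> exists2 chi, @Cc R d chi &
    forall x, Rstar x -> `|psi x - chi x| <= e].

Definition omega (R : realType) (d : nat) (beta : R) (gamma lambda : R * R)
    (x : 'rV[R]_d) : R :=
  if norm1 x <= 1 then norm1 x `^ Num.min (- beta) (- lambda.1)
  else norm1 x `^ Num.max (gamma.1 + lambda.1) (gamma.2 + lambda.2).

(* g is continuously differentiable on [0, +oo[ with derivative dg, the
   derivative at 0 being one-sided. *)
Definition C1_halfline (R : realType) (g dg : R -> R) : Prop :=
  {within `[0, +oo[, continuous dg} /\
  forall t : R, 0 <= t ->
    (h^-1 * (g (t + h) - g t)) @[h --> within [set h | 0 <= t + h] 0^']
      --> dg t.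

(* C^1([0, +oo[; C_c(Rstar)), with dphi the time derivative of phi.
   The first two clauses are the slicewise conditions.  Alone they do not make
   the integrals of the weak formulation converge (supports may escape to 0 or
   to infinity, and the derivative may blow up, as t approaches a given time);
   the last one makes the supports and the bound on the time derivative uniform
   over bounded time intervals, as for C^1 maps with values in C_c(Rstar). *)
Definition test_function (R : realType) (d : nat)
    (phi dphi : 'rV[R]_d -> R -> R) : Prop :=
  [/\ forall x, Rstar x -> C1_halfline (phi x) (dphi x),
      forall t, 0 <= t -> @Cc R d (phi ^~ t) &
      forall T, 0 <= T ->
        exists (C : set 'rV[R]_d) (M : R),
          [/\ compact C, C `<=` @Rstar R d,
              forall x t, Rstar x -> ~ C x -> 0 <= t <= T -> phi x t = 0 &
              forall x t, Rstar x -> 0 <= t <= T -> `|dphi x t| <= M]].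

Local Open Scope ereal_scope.

Definition admissible_data (R : realType) (d : nat) (beta : R)
    (gamma lambda : R * R) (f0 : {measure set (borelRV R d) -> \bar R}) : Prop :=
  [/\ radon_pos f0,
      \int[f0]_(x in @Rstar R d) (norm1 x)%:E < +oo &
      \int[f0]_(x in @Rstar R d) (omega beta gamma lambda x)%:E < +oo].

(* [omega f] is a map from [0, +oo[ to bounded measures, continuous for the
   weak-* topology of the dual of C_0(Rstar). *)
Definition weighted_weakstar_continuous (R : realType) (d : nat)
    (w : 'rV[R]_d -> R)
    (f : R -> {measure set (borelRV R d) -> \bar R}) : Prop :=
  (forall t : R, (0 <= t)%R -> \int[f t]_(x in @Rstar R d) (w x)%:E < +oo) /\
  forall psi, @C0 R d psi ->
    {within `[0%R, +oo[%classic, continuous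
      (fun t : R => \int[f t]_(x in @Rstar R d) (psi x * w x)%:E)}.

Definition weak_formulation (R : realType) (d : nat)
    (K : 'rV[R]_d -> 'rV[R]_d -> R)
    (f0 : {measure set (borelRV R d) -> \bar R})
    (f : R -> {measure set (borelRV R d) -> \bar R}) : Prop :=
  forall (t : R) (phi dphi : 'rV[R]_d -> R -> R),
    (0 <= t)%R -> test_function phi dphi ->
    \int[f t]_(x in @Rstar R d) (phi x t)%:E
      - \int[f0]_(x in @Rstar R d) (phi x 0%R)%:E
    = \int[lebesgue_measure]_(s in `[0%R, t])
        \int[f s]_(x in @Rstar R d) (dphi x s)%:E
      + (2^-1)%:E * \int[lebesgue_measure]_(s in `[0%R, t])
        \int[f s]_(x in @Rstar R d) \int[f s]_(y in @Rstar R d)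
          (K x y * (phi (x + y) s - phi x s - phi y s))%:E.

(* Only the values of f on [0, +oo[ matter. *)
Definition is_weak_solution (R : realType) (d : nat)
    (K : 'rV[R]_d -> 'rV[R]_d -> R) (beta : R) (gamma lambda : R * R)
    (f0 : {measure set (borelRV R d) -> \bar R})
    (f : R -> {measure set (borelRV R d) -> \bar R}) : Prop :=
  admissible_data beta gamma lambda f0 /\
  (forall t : R, (0 <= t)%R -> radon_pos (f t)) /\
  [/\ forall A : set (borelRV R d), measurable A -> f 0%R A = f0 A,
      weighted_weakstar_continuous (omega beta gamma lambda) f,
      forall t : R, (0 <= t)%R ->
        ereal_sup [set \int[f s]_(x in @Rstar R d)
          (omega beta gamma lambda x)%:E | s in `[0%R, t]] < +oo,
      forall t : R, (0 <= t)%R -> forall j : 'I_d,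
        \int[f t]_(x in @Rstar R d) (x ord0 j)%:E
          <= \int[f0]_(x in @Rstar R d) (x ord0 j)%:E &
      weak_formulation K f0 f].

Local Close Scope ereal_scope.

(* The three cases overlap where |x| = 1 or |y| = 1; for continuous K the bounds
   of the adjacent cases both hold there. *)
Definition kernel_bound (R : realType) (d : nat) (c2 beta : R)
    (gamma lambda : R * R) (K : 'rV[R]_d -> 'rV[R]_d -> R) : Prop :=
  forall x y, Rstar x -> Rstar y -> norm1 y <= norm1 x ->
  [/\ norm1 x <= 1 -> norm1 y <= 1 ->
        K x y <= c2 * (norm1 x `^ (- beta) * norm1 y `^ (- beta)),
      1 <= norm1 x -> norm1 y <= 1 ->
        K x y <= c2 * (norm1 x `^ (gamma.1 + lambda.1)
                       * norm1 y `^ (- lambda.1)) &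
      1 <= norm1 x -> 1 <= norm1 y ->
        K x y <= c2 * (norm1 x `^ (gamma.2 + lambda.2)
                       * norm1 y `^ (- lambda.2))].

(* Main.v *)
Require Import Defs.
From HB Require Import structures.
From mathcomp Require Import all_boot all_order all_algebra.
From mathcomp Require Import all_classical all_reals all_analysis.
From mathcomp Require Import measurable_realfun ring lra.

(** The a priori bounds. Put [w = omega] and [W = |x| ^ (min (- beta) (-
    lambda_1) - r) + |x|]. The kernel satisfies [K x y <= c2 * w x * w y], and
    as all the exponents in [W] are at most 1, the function [W] is
    subadditive, so coagulation does not increase the moment of order [W].
    Moreover [w <= W], and the quotient [q = w / W] tends to 0 both at the
    origin (because of [r > 0]) and at infinity (because the exponents
    [gamma_j + lambda_j] are less than 1): the sets [e <= q] are compact.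
    Hence a bound on the moment of order [W] makes the measures [w f] bounded
    and uniformly tight, while the coagulation rate is the double integral of
    the bounded continuous function [K x y / (w x * w y) * gain phi x y]
    against [w f]. All limits may therefore be taken in the weak topology of
    tight measures, in which such double integrals are continuous
    ([double_cvg]).

    The approximation. The initial measure is replaced by finitely many point
    masses, the collisions of particles in [q < e] are suppressed, and the
    equation is solved by an explicit Euler scheme with a step so small that
    the masses stay nonnegative. The step acts on finite lists of masses, and
    the moment of order [W] does not increase along it ([state_coag_step]).
    The integrals of a test function against [w f] at time [t] form a bounded
    family, which converges along an ultrafilter on the discretizations
    ([limit_functional]), for all times at once. The limit at each time is a
    tight positive functional, and it is Lipschitz in time on compactly
    supported functions, because the rates are bounded. Close to a time [t]
    the rates of the discretizations are close to the rate of the limit at [t]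
    ([near_time_rate]), which yields the right derivative of the limit
    ([limit_functional_right_derivative]).

    The solution. By the Daniell-Stone theorem ([daniell_stone]) a tight
    functional is integration against a measure; dividing by [w] gives the
    measure [f t] ([tight_represents]). The integral of [phi t] against [f t]
    is a Lipschitz function of time whose difference quotients converge from
    the right at every point, by the product rule, to the sum of the integral
    of the time derivative and of the coagulation rate. A Lipschitz function
    with this property is the integral of its right derivative
    ([integral_everywhere_derivative]), and this is the weak formulation
    ([test_weak_formulation]). Coordinates are additive, hence conserved by
    the discretization, and the limit can only lose mass
    ([represents_moment_le]); this is why the mass bound is an inequality. *)

Set Implicit Arguments.
Unset Strict Implicit.
Unset Printing Implicit Defensive.
Import Order.TTheory GRing.Theory Num.Theory.
Import numFieldNormedType.Exports.
Local Open Scope classical_set_scope.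
Local Open Scope ring_scope.

(** * The Daniell-Stone theorem *)

Section daniell_stone.
Context (R : realType) (T : pointedType) (E : set T).
Variables (L : set (T -> R)) (I : (T -> R) -> R).
Hypothesis L_0 : L (fun=> 0).
Hypothesis L_lin : forall a f g, L f -> L g -> L (fun x => a * f x + g x).
Hypothesis L_pos : forall f, L f -> L (fun x => Num.max (f x) 0).
Hypothesis L_min1 : forall f, L f -> L (fun x => Num.min (f x) 1).
Hypothesis I_lin : forall a f g, L f -> L g ->
  I (fun x => a * f x + g x) = a * I f + I g.
Hypothesis I_ge0 : forall f, L f -> (forall x, E x -> 0 <= f x) -> 0 <= I f.
Hypothesis I_cvg0 : forall f : nat -> T -> R, (forall n, L (f n)) ->
  (forall n x, E x -> 0 <= f n.+1 x <= f n x) ->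
  (forall x, E x -> f n x @[n --> \oo] --> 0) -> I (f n) @[n --> \oo] --> 0.

Let L_Z a f : L f -> L (fun x => a * f x).
Proof.
move=> Lf; rewrite (_ : (fun x => _) = (fun x => a * f x + 0)).
  exact: L_lin.
by apply/funext => x; rewrite addr0.
Qed.

Let L_D f g : L f -> L g -> L (fun x => f x + g x).
Proof.
move=> Lf Lg; rewrite (_ : (fun x => _) = (fun x => 1 * f x + g x)).
  exact: L_lin.
by apply/funext => x; rewrite mul1r.
Qed.

Let L_B f g : L f -> L g -> L (fun x => f x - g x).
Proof.
move=> Lf Lg; rewrite (_ : (fun x => _) = (fun x => -1 * g x + f x)).
  exact: L_lin.
by apply/funext => x; rewrite mulN1r addrC.
Qed.

Let L_min f g : L f -> L g -> L (fun x => Num.min (f x) (g x)).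
Proof.
move=> Lf Lg.
rewrite (_ : (fun x => _) = (fun x => f x - Num.max (f x - g x) 0)).
  by apply: L_B => //; apply: L_pos; exact: L_B.
by apply/funext => x; rewrite minr_to_max -[in RHS](subrr (g x)) -addr_maxl opprD opprK; lra.
Qed.

Let I_0 : I (fun=> 0) = 0.
Proof.
have := I_lin (-1) L_0 L_0.
by rewrite (_ : (fun x : T => _) = fun=> 0); [lra|apply/funext => x; rewrite mulr0 addr0].
Qed.

Let I_Z a f : L f -> I (fun x => a * f x) = a * I f.
Proof.
move=> Lf; have := I_lin a Lf L_0; rewrite I_0 addr0 => <-.
by congr I; apply/funext => x; rewrite addr0.
Qed.

Let I_D f g : L f -> L g -> I (fun x => f x + g x) = I f + I g.
Proof.
move=> Lf Lg; have := I_lin 1 Lf Lg; rewrite mul1r => <-.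
by congr I; apply/funext => x; rewrite mul1r.
Qed.

Let I_B f g : L f -> L g -> I (fun x => f x - g x) = I f - I g.
Proof.
move=> Lf Lg; have := I_lin (-1) Lg Lf; rewrite mulN1r addrC => <-.
by congr I; apply/funext => x; rewrite mulN1r addrC.
Qed.

Let I_le f g : L f -> L g -> (forall x, E x -> f x <= g x) -> I f <= I g.
Proof.
move=> Lf Lg fg; rewrite -subr_ge0 -I_B//; apply: I_ge0; first exact: L_B.
by move=> x Ex; rewrite subr_ge0 fg.
Qed.

(** An admissible cover of [A] is an increasing sequence from the lattice
    rather than a series: countable subadditivity then needs no reindexing, and
    truncating a cover by [min _ k] or [max (_ - k) 0] gives a cover again. *)
Definition daniell_cover (A : set T) (v : R) (g : nat -> T -> R) : Prop :=
  [/\ forall n, L (g n), forall n x, E x -> 0 <= g n x <= g n.+1 x,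
      forall n, I (g n) <= v &
      forall x, E x -> A x -> forall c, c < 1 -> exists n, c < g n x].

Definition daniell_outer (A : set T) : \bar R :=
  ereal_inf [set v%:E | v in [set v | exists g, daniell_cover A v g]].

Local Notation mu := daniell_outer.

Lemma daniell_cover_mono A v g : daniell_cover A v g ->
  forall m n x, (m <= n)%N -> E x -> g m x <= g n x.
Proof.
move=> [_ g_incr _ _] m n x + Ex; elim: n => [|n IH].
  by rewrite leqn0 => /eqP ->.
rewrite leq_eqVlt => /orP[/eqP -> //|]; rewrite ltnS => /IH/le_trans; apply.
by have /andP[] := g_incr n x Ex.
Qed.

Lemma daniell_cover_ge0 A v g : daniell_cover A v g -> 0 <= v.
Proof.
move=> [Lg g_incr gv _]; apply: le_trans (gv 0); apply: I_ge0 => // x Ex.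
by have /andP[] := g_incr 0 x Ex.
Qed.

Lemma daniell_outer_le A v g : daniell_cover A v g -> (mu A <= v%:E)%E.
Proof. by move=> gA; apply: ereal_inf_lbound; exists v => //; exists g. Qed.

Lemma daniell_outer_adherent A (e : R) : 0 < e -> (mu A < +oo)%E ->
  exists v g, daniell_cover A v g /\ (v%:E <= mu A + e%:E)%E.
Proof.
move=> e0 muA.
have muA0 : (0 <= mu A)%E.
  apply: le_ereal_inf_tmp => _ [v [g gA] <-].
  by rewrite lee_fin (daniell_cover_ge0 gA).
have : mu A \is a fin_num by rewrite ge0_fin_numE.
move=> /(lb_ereal_inf_adherent e0)[_ [v [g gA] <-]] /ltW vA.
by exists v, g.
Qed.

Let mu_set0 : mu set0 = 0%E.
Proof.
apply/eqP; rewrite eq_le; apply/andP; split.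
  apply: (@daniell_outer_le _ _ (fun _ _ => 0)); split => //.
  - by move=> ? ? _; rewrite lexx.
  - by move=> _ /=; rewrite I_0.
apply: le_ereal_inf_tmp => _ [v [g gA] <-].
by rewrite lee_fin (daniell_cover_ge0 gA).
Qed.

Let mu_ge0 A : (0 <= mu A)%E.
Proof.
apply: le_ereal_inf_tmp => _ [v [g gA] <-].
by rewrite lee_fin (daniell_cover_ge0 gA).
Qed.

Let mu_le : {homo mu : A B / A `<=` B >-> (A <= B)%E}.
Proof.
move=> A B AB; apply: ereal_inf_le_tmp => _ [v [g [? ? ? gB]] <-].
exists v => //; exists g; split => // x Ex /AB; exact: gB.
Qed.

Let mu_sigma_subadditive : sigma_subadditive mu.
Proof.
move=> A; have [[i Ai]|] := pselect (exists i, mu (A i) = +oo%E).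
  by rewrite (eseries_pinfty _ _ Ai) ?leey// => n _; rewrite -ltNye (lt_le_trans _ (mu_ge0 _)).
rewrite -forallNE => Afin.
apply/lee_addgt0Pr => e e0.
have [->|] := eqVneq (\sum_(i <oo) mu (A i))%E +oo%E; first by rewrite leey.
move=> sumfin.
apply: le_trans (epsilon_trick _ _ (ltW e0)); last first.
  by move=> n; exact: mu_ge0.
have P n : exists vg : R * (nat -> T -> R), daniell_cover (A n) vg.1 vg.2 /\
    (vg.1%:E <= mu (A n) + (e / (2 ^ n.+1)%:R)%:E)%E.
  have en : 0 < e / (2 ^ n.+1)%:R :> R by rewrite divr_gt0// ltr0n expn_gt0.
  have [|v [g gA]] := daniell_outer_adherent en (A := A n).
    by rewrite ltey; apply/eqP/Afin.
  by exists (v, g).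
have /choice[vg vgP] := P.
set S := (X in (_ <= X)%E).
have vS n : ((\sum_(i < n) (vg i).1)%:E <= S)%E.
  rewrite -sumEFin; apply: (@le_trans _ _ (\sum_(i < n)
     (mu (A i) + (e / (2 ^ i.+1)%:R)%:E))%E).
    by apply: lee_sum => i _; exact: (vgP i).2.
  rewrite -(big_mkord xpredT (fun i => mu (A i) + (e / (2 ^ i.+1)%:R)%:E)%E).
  apply: nneseries_lim_ge => i _ _; apply: adde_ge0; first exact: mu_ge0.
  by rewrite lee_fin divr_ge0// ltW.
have [->|Sfin] := eqVneq S +oo%E; first by rewrite leey.
have S0 : (0 <= S)%E by have := vS 0; rewrite big_ord0.
have Sfn : S \is a fin_num by rewrite ge0_fin_numE// ltey.
rewrite -(fineK Sfn).
apply: (@daniell_outer_le _ _ (fun n x => \sum_(i < n) (vg i).2 n x)).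
have L_sum (g : nat -> T -> R) n : (forall i, L (g i)) ->
    L (fun x => \sum_(i < n) g i x).
  move=> Lg; elim: n => [|n IH].
    by rewrite (_ : (fun x => _) = fun=> 0)//; apply/funext => x; rewrite big_ord0.
  rewrite (_ : (fun x => _) = fun x => \sum_(i < n) g i x + g n x).
    exact: L_D.
  by apply/funext => x; rewrite big_ord_recr.
have I_sum (g : nat -> T -> R) n : (forall i, L (g i)) ->
    I (fun x => \sum_(i < n) g i x) = \sum_(i < n) I (g i).
  move=> Lg; elim: n => [|n IH].
    by rewrite big_ord0 (_ : (fun x => _) = fun=> 0)//; apply/funext => x; rewrite big_ord0.
  rewrite big_ord_recr/= -IH -I_D//; last exact: L_sum.
  by congr I; apply/funext => x; rewrite big_ord_recr.
split.
- move=> n; apply: (L_sum (fun i => (vg i).2 n)) => i.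
  by have [[]] := vgP i.
- move=> n x Ex; apply/andP; split.
    apply: sumr_ge0 => i _; have [[_ + _ _]] := vgP i.
    by move=> /(_ n x Ex)/andP[].
  rewrite big_ord_recr/=; apply: (@le_trans _ _ (\sum_(i < n) (vg i).2 n.+1 x)).
    apply: ler_sum => i _; have [[_ + _ _]] := vgP i.
    by move=> /(_ n x Ex)/andP[].
  rewrite lerDl; have [[_ + _ _]] := vgP n.
  by move=> /(_ n.+1 x Ex)/andP[].
- move=> n; rewrite (I_sum (fun i => (vg i).2 n)).
    rewrite -lee_fin fineK//; apply: le_trans (vS n).
    rewrite lee_fin; apply: ler_sum => i _; have [[_ _ + _]] := vgP i.
    exact.
  by move=> i; have [[]] := vgP i.
- move=> x Ex [i _ Aix] c c1.
  have [[_ incr _ /(_ x Ex Aix c c1)[n cn]] _] := vgP i.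
  exists (maxn n i.+1).
  have igt : (i < maxn n i.+1)%N by rewrite leq_max ltnS leqnn orbT.
  rewrite (bigD1 (Ordinal igt))//=; apply: lt_le_trans cn _.
  apply: (@le_trans _ _ ((vg i).2 (maxn n i.+1) x)).
    exact: (daniell_cover_mono (vgP i).1 (leq_maxl _ _)).
  rewrite lerDl; apply: sumr_ge0 => j _; have [[_ + _ _]] := vgP j.
  by move=> /(_ (maxn n i.+1) x Ex)/andP[].
Qed.

HB.instance Definition _ := isOuterMeasure.Build R T mu
  mu_set0 mu_ge0 mu_le mu_sigma_subadditive.

(** A function of the lattice below the indicator of [A] is below every cover up
    to a remainder that decreases to zero, and [I] is continuous there. *)
Lemma daniell_outer_ge A f : L f -> (forall x, E x -> A x -> f x <= 1) ->
  (forall x, E x -> ~ A x -> f x <= 0) -> ((I f)%:E <= mu A)%E.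
Proof.
move=> Lf f1 f0; apply: le_ereal_inf_tmp => _ [v [g gA] <-]; rewrite lee_fin.
have [Lg incr gv gcov] := gA.
pose r n x := Num.max (f x - g n x) 0.
have Lr n : L (r n) by apply: L_pos; exact: L_B.
have r_cvg : I (r n) @[n --> \oo] --> 0.
  apply: I_cvg0 => //.
    move=> n x Ex; rewrite /r le_max lexx orbT/=.
    rewrite ge_max !le_max lexx !orbT andbT.
    by have /andP[_] := incr n x Ex; rewrite lerD2l lerN2 => ->.
  move=> x Ex; apply/cvgrPdist_lt => e e0.
  have [Ax|nAx] := pselect (A x); last first.
    near=> n; rewrite sub0r normrN ger0_norm ?le_max ?lexx ?orbT//.
    rewrite gt_max e0 andbT; apply: le_lt_trans e0.
    have /andP[g0 _] := incr n x Ex.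
    by have := f0 x Ex nAx; lra.
  have [|n0 gn0] := gcov x Ex Ax (1 - e); first by lra.
  exists n0 => // n /= n0n.
  rewrite sub0r normrN ger0_norm ?le_max ?lexx ?orbT//.
  rewrite gt_max e0 andbT.
  have := daniell_cover_mono gA n0n Ex.
  by have := f1 x Ex Ax; lra.
have : (I f - v <= 0 :> R).
  have -> : 0 = lim (I (r n) @[n --> \oo]) by rewrite (cvg_lim _ r_cvg).
  apply: limr_ge; first by apply/cvg_ex; exists 0.
  near=> n; rewrite lerBlDl.
  apply: (@le_trans _ _ (I (g n) + I (r n))); last by rewrite lerD2r.
  rewrite -I_D//; apply: I_le => //; first exact: L_D.
  by move=> x Ex; rewrite -lerBlDl le_max lexx.
by rewrite subr_le0.
Unshelve. all: by end_near. Qed.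

(** With the truncations [k n] of [f] increasing to the indicator of [B], the
    sequences [min (g n) (k n)] and [max (g n - k m) 0] cover the two parts of a
    set covered by [g]; their values add up to at most that of [g] as soon as
    [m] almost achieves the supremum of the first ones. *)
Lemma daniell_caratheodory B f : L f -> (forall x, E x -> B x <-> 0 < f x) ->
  mu.-caratheodory B.
Proof.
move=> Lf Bf; apply: le_caratheodory_measurable => X.
rewrite -[leRHS]/(mu X) -[leLHS]/(mu _ + mu _)%E.
have [->|] := eqVneq (mu X) +oo%E; first by rewrite leey.
rewrite -ltey => muX; apply/lee_addgt0Pr => e e0.
have e20 : 0 < e / 2 by lra.
have [v [g [gX vX]]] := daniell_outer_adherent e20 muX.
have [Lg incr gv gcov] := gX.
pose h n x := Num.min (g n x) 1.
pose k n x := Num.min (n%:R * Num.max (f x) 0) 1.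
have Lh n : L (h n) by exact: L_min1.
have Lk n : L (k n) by apply: L_min1; apply: L_Z; exact: L_pos.
have h_ge0 n x : E x -> 0 <= h n x.
  by move=> Ex; rewrite le_min ler01 andbT; have /andP[] := incr n x Ex.
have h_incr n x : E x -> h n x <= h n.+1 x.
  move=> Ex; rewrite le_min !ge_min lexx orbT andbT.
  by have /andP[_ ->] := incr n x Ex.
have k_ge0 n x : 0 <= k n x.
  by rewrite le_min ler01 andbT mulr_ge0// le_max lexx orbT.
have k_incr n x : k n x <= k n.+1 x.
  rewrite le_min !ge_min lexx orbT andbT ler_wpM2r ?ler_nat//.
  by rewrite le_max lexx orbT.
have k_0 n x : E x -> ~ B x -> k n x = 0.
  move=> Ex nBx; rewrite /k (_ : Num.max _ _ = 0) ?mulr0 ?min_l//.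
  by apply/max_idPr; rewrite leNgt; apply/negP => /(Bf x Ex).2.
have k_1 x : E x -> B x -> \forall n \near \oo, k n x = 1.
  move=> Ex /(Bf x Ex) fx; near=> n; apply/min_idPr.
  rewrite (max_l (ltW fx)) -ler_pdivrMr// div1r.
  by near: n; exact: nbhs_infty_ger.
have hv n : I (h n) <= v.
  by apply: le_trans (gv n); apply: I_le => // x Ex; rewrite ge_min lexx.
have hcov x : E x -> X x -> forall c, c < 1 -> \forall n \near \oo, c < h n x.
  move=> Ex Xx c c1; have [n0 cn0] := gcov x Ex Xx c c1.
  exists n0 => // n /= n0n; rewrite lt_min c1 andbT.
  by apply: lt_le_trans cn0 _; exact: daniell_cover_mono gX _ _ _ n0n Ex.
pose hk n x := Num.min (h n x) (k n x).
have Lhk n : L (hk n) by exact: L_min.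
pose S := range (fun n => I (hk n)).
have S_sup : has_sup S.
  split; first by exists (I (hk 0)); exists 0.
  exists v => _ [n _ <-]; apply: le_trans (hv n).
  by apply: I_le => // x Ex; rewrite ge_min lexx.
have [_ [m _ <-] Sm] := sup_adherent e20 S_sup.
have cov1 : daniell_cover (X `&` B) (sup S) hk.
  split => //.
  - move=> n x Ex; rewrite le_min h_ge0// k_ge0/=.
    rewrite /hk le_min; apply/andP; split; rewrite ge_min ?h_incr//.
    by rewrite k_incr orbT.
  - by move=> n; apply: (ub_le_sup S_sup.2); exists n.
  - move=> x Ex [Xx Bx] c c1.
    have [n _ /(_ _ (leqnn n)) [ch kn]] : \forall n \near \oo, c < h n x /\ k n x = 1.
      by near=> n; split; near: n; [exact: hcov|exact: k_1].
    by exists n; rewrite /hk lt_min ch kn.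
have cov2 : daniell_cover (X `&` ~` B) (v - I (hk m))
    (fun n x => Num.max (h (n + m)%N x - k m x) 0).
  have L2 n : L (fun x => Num.max (h (n + m)%N x - k m x) 0).
    by apply: L_pos; exact: L_B.
  split => //.
  - move=> n x Ex; rewrite le_max lexx orbT/= ge_max !le_max lexx orbT andbT.
    by rewrite lerD2r h_incr.
  - move=> n; apply: (@le_trans _ _ (I (fun x => h (n + m)%N x - hk m x))).
      apply: I_le => //; first exact: L_B.
      move=> x Ex; rewrite ge_max; apply/andP; split.
        by rewrite lerD2l lerN2 ge_min lexx orbT.
      rewrite subr_ge0 ge_min; apply/orP; left.
      elim: n => // n IH; rewrite addSn; apply: le_trans IH _.
      exact: h_incr.
    by rewrite I_B// lerD2r.
  - move=> x Ex [Xx nBx] c c1.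
    have [n0 _ cn0] := hcov x Ex Xx c c1; exists n0.
    by rewrite lt_max k_0// subr0 cn0//= leq_addr.
apply: (@le_trans _ _ ((sup S)%:E + (v - I (hk m))%:E)%E).
  by apply: leeD; [exact: daniell_outer_le cov1|exact: daniell_outer_le cov2].
apply: (@le_trans _ _ (v%:E + (e / 2)%:E)%E).
  by rewrite -!EFinD lee_fin; lra.
apply: (@le_trans _ _ (mu X + (e / 2)%:E + (e / 2)%:E)%E); first exact: leeD2r.
by rewrite -addeA -EFinD (_ : e / 2 + e / 2 = e)//; lra.
Unshelve. all: by end_near. Qed.

Variable G : set (set T).
Local Notation S := (g_sigma_algebraType G).
Hypothesis G_L : forall A, G A ->
  exists2 f, L f & forall x, E x -> A x <-> 0 < f x.
Hypothesis mE : measurable (E : set S).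
Hypothesis mL : forall f, L f -> measurable_fun (E : set S) f.

Let cara := caratheodory_type mu.

Let measurable_id : measurable_fun [set: cara] (id : cara -> S).
Proof.
apply: (@measurability _ _ cara S setT id G) => // _ [A GA <-].
rewrite setTI; have [f Lf Af] := G_L GA.
exact: daniell_caratheodory Lf Af.
Qed.

Definition daniell_measure : set S -> \bar R := mu.

Let nu_sigma_additive : semi_sigma_additive daniell_measure.
Proof.
have mS A : measurable (A : set S) -> measurable (A : set cara).
  by move=> mA; rewrite -(setTI A); exact: measurable_id.
move=> F mF tF mUF.
have := @caratheodory_measure_sigma_additive R T
  (mu : {outer_measure set T -> \bar R}) F.
by apply => //; [move=> n; apply: mS; exact: mF|exact: mS].
Qed.

HB.instance Definition _ := isMeasure.Build _ S R daniell_measure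
  mu_set0 mu_ge0 nu_sigma_additive.

Local Notation nu := daniell_measure.

(** The part of [f] between the heights [k * c] and [(k + 1) * c]; up to the
    factor [c] it lies between the indicators of two consecutive level sets. *)
Let layer (c : R) (f : T -> R) k x : R := Num.min (Num.max (f x - k%:R * c) 0) c.

Let sum_layer (c : R) f n x : 0 <= c ->
  \sum_(k < n) layer c f k x = Num.min (Num.max (f x) 0) (n%:R * c).
Proof.
move=> c0; elim: n => [|n IH].
  by rewrite big_ord0 mul0r min_r// le_max lexx orbT.
rewrite big_ord_recr/= IH /layer -natr1 mulrDl mul1r.
have := mulr_ge0 (ler0n R n) c0; set y := _ * c.
by rewrite /Num.min/Num.max; do ?case: ifPn; lra.
Qed.

Let L_layer (c : R) f k : 0 < c -> L f -> L (layer c f k).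
Proof.
move=> c0 Lf.
have L_minc a g : 0 < a -> L g -> L (fun x => Num.min (g x) a).
  move=> a0 Lg; rewrite (_ : (fun x => _) = fun x => a * Num.min (a^-1 * g x) 1).
    by apply/L_Z/L_min1/L_Z.
  by apply/funext => x; rewrite minr_pMr ?ltW// mulr1 mulrA divff ?gt_eqF// mul1r.
apply: (L_minc) => //; case: k => [|k].
  by under eq_fun do rewrite mul0r subr0; exact: L_pos.
have kc : 0 < k.+1%:R * c by rewrite mulr_gt0.
rewrite (_ : (fun x => _) = fun x => f x - Num.min (f x) (k.+1%:R * c)).
  by apply: L_B => //; exact: L_minc.
by apply/funext => x; rewrite /Num.min/Num.max; do ?case: ifPn; lra.
Qed.

Let layer_ge0 (c : R) f k x : 0 <= c -> 0 <= layer c f k x.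
Proof. by move=> c0; rewrite le_min c0 andbT le_max lexx orbT. Qed.

Let level (c : R) (f : T -> R) k := [set x | E x /\ k%:R * c < f x].

Let measurable_level c f k : L f -> measurable (level c f k : set S).
Proof.
move=> Lf; have := mL Lf mE (measurable_itv `]k%:R * c, +oo[).
by congr (measurable _); apply/seteqP; split => x /=; rewrite in_itv/= andbT.
Qed.

Let measurable_L f : L f -> measurable_fun (E : set S) (EFin \o f).
Proof. by move=> Lf; apply/measurable_EFinP; exact: mL. Qed.

Let integral_layer_le c f k : 0 < c -> L f ->
  (\int[nu]_(x in E) (layer c f k.+1 x)%:E <= (I (layer c f k))%:E)%E.
Proof.
move=> c0 Lf; have c0' := ltW c0.
have mlev := measurable_level c k.+1 Lf.
apply: (@le_trans _ _ (c%:E * nu (level c f k.+1))%E).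
  have -> : (c%:E * nu (level c f k.+1) =
      \int[nu]_(x in E) (c * \1_(level c f k.+1 : set S) x)%:E)%E.
    rewrite (@integralZl_indic _ S R nu E mE (fun=> level c f k.+1))//.
      by rewrite integral_indic// setIidl// => x [].
    by move=> cn; have := lt_trans c0 cn; rewrite ltxx.
  apply: ge0_le_integral => //.
  - by move=> x Ex; rewrite lee_fin layer_ge0.
  - by apply: measurable_L; exact: L_layer.
  - by apply/measurable_EFinP/measurable_funM => //; exact: measurable_indic.
  - move=> x Ex; rewrite lee_fin indicE; have [/set_mem [_ lx]|nlx] := boolP (x \in _).
      by rewrite mulr1 ge_min lexx orbT.
    rewrite mulr0 ge_min ge_max lexx andbT subr_le0; apply/orP; left; rewrite leNgt.
    apply/negP => lx; case/negP: nlx; rewrite inE; split => //.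
have -> : I (layer c f k) = c * (c^-1 * I (layer c f k)).
  by rewrite mulrA divff ?gt_eqF// mul1r.
rewrite EFinM lee_pmul2l// -I_Z; last exact: L_layer.
apply: (@daniell_outer_le _ _ (fun _ x => c^-1 * layer c f k x)); split => //.
- by move=> _; apply/L_Z/L_layer.
- by move=> n x Ex; rewrite lexx mulr_ge0 ?invr_ge0// layer_ge0.
- move=> x Ex [_ lx] a a1; exists 0; apply: lt_le_trans a1 _.
  rewrite mulrC ler_pdivlMr// mul1r le_min lexx andbT le_max.
  by apply/orP; left; move: lx; rewrite -natr1 mulrDl mul1r; lra.
Qed.

Let le_integral_layer c f k : 0 < c -> L f ->
  ((I (layer c f k.+1))%:E <= \int[nu]_(x in E) (layer c f k x)%:E)%E.
Proof.
move=> c0 Lf; have c0' := ltW c0.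
have mlev := measurable_level c k.+1 Lf.
apply: (@le_trans _ _ (c%:E * nu (level c f k.+1))%E).
  have -> : I (layer c f k.+1) = c * (c^-1 * I (layer c f k.+1)).
    by rewrite mulrA divff ?gt_eqF// mul1r.
  rewrite EFinM lee_pmul2l// -I_Z; last exact: L_layer.
  apply: daniell_outer_ge; first by apply/L_Z/L_layer.
    by move=> x _ _; rewrite mulrC ler_pdivrMr// mul1r ge_min lexx orbT.
  move=> x Ex nlx; rewrite mulr_ge0_le0 ?invr_ge0//.
  rewrite ge_min ge_max lexx andbT subr_le0; apply/orP; left; rewrite leNgt.
  by apply/negP => lx; apply: nlx.
have -> : (c%:E * nu (level c f k.+1) =
    \int[nu]_(x in E) (c * \1_(level c f k.+1 : set S) x)%:E)%E.
  rewrite (@integralZl_indic _ S R nu E mE (fun=> level c f k.+1))//.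
    by rewrite integral_indic// setIidl// => x [].
  by move=> cn; have := lt_trans c0 cn; rewrite ltxx.
apply: ge0_le_integral => //.
- by move=> x Ex; rewrite lee_fin mulr_ge0.
- by apply/measurable_EFinP/measurable_funM => //; exact: measurable_indic.
- by apply: measurable_L; exact: L_layer.
- move=> x Ex; rewrite lee_fin indicE; have [/set_mem [_ lx]|nlx] := boolP (x \in _).
    rewrite mulr1 le_min lexx andbT le_max; apply/orP; left.
    by move: lx; rewrite -natr1 mulrDl mul1r; lra.
  by rewrite mulr0 layer_ge0.
Qed.

(** Slicing at height [1 / n.+1], with [n.+1 ^ 2] slices, approximates a
    nonnegative [f] from below. *)
Let slices n (f : T -> R) x : R := \sum_(k < n.+1 ^ 2) layer n.+1%:R^-1 f k.+1 x.

Let slicesE n f x : slices n f x = Num.min (Num.max (f x - n.+1%:R^-1) 0) n.+1%:R.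
Proof.
rewrite /slices; have c0 : 0 <= n.+1%:R^-1 :> R by rewrite invr_ge0.
transitivity (\sum_(k < n.+1 ^ 2) layer n.+1%:R^-1 (fun x => f x - n.+1%:R^-1) k x).
  by apply: eq_bigr => k _; rewrite /layer -natr1 mulrDl mul1r opprD addrA addrAC.
by rewrite sum_layer// natrX expr2 -mulrA divff ?mulr1// pnatr_eq0.
Qed.

Let L_sum (g : nat -> T -> R) n : (forall i, L (g i)) ->
  L (fun x => \sum_(i < n) g i x).
Proof.
move=> Lg; elim: n => [|n IH].
  by rewrite (_ : (fun x => _) = fun=> 0)//; apply/funext => x; rewrite big_ord0.
rewrite (_ : (fun x => _) = fun x => \sum_(i < n) g i x + g n x).
  exact: L_D.
by apply/funext => x; rewrite big_ord_recr.
Qed.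

Let I_sum (g : nat -> T -> R) n : (forall i, L (g i)) ->
  I (fun x => \sum_(i < n) g i x) = \sum_(i < n) I (g i).
Proof.
move=> Lg; elim: n => [|n IH].
  by rewrite big_ord0 (_ : (fun x => _) = fun=> 0)//; apply/funext => x; rewrite big_ord0.
rewrite big_ord_recr/= -IH -I_D//; last exact: L_sum.
by congr I; apply/funext => x; rewrite big_ord_recr.
Qed.

Let L_slices n f : L f -> L (slices n f).
Proof. by move=> Lf; apply: (L_sum (g := fun k => layer _ f k.+1)) => k; apply: L_layer. Qed.

Let slices_ge0 n f x : 0 <= slices n f x.
Proof. by apply: sumr_ge0 => k _; apply: layer_ge0; rewrite invr_ge0. Qed.

Let slices_le n f x : 0 <= f x -> slices n f x <= f x.
Proof.
move=> fx; rewrite slicesE ge_min ge_max fx andbT lerBlDr lerDl invr_ge0.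
by rewrite ler0n.
Qed.

Let slices_incr f x m n : (m <= n)%N -> slices m f x <= slices n f x.
Proof.
move=> mn; rewrite !slicesE le_min ge_min ge_max !le_max lexx !orbT !andbT.
rewrite ge_min ler_nat ltnS mn orbT andbT.
by rewrite lerD2l lerN2 lef_pV2 ?posrE// ler_nat ltnS mn.
Qed.

Let slices_cvg f x : 0 <= f x -> slices n f x @[n --> \oo] --> f x.
Proof.
move=> fx; apply/cvgrPdist_lt => e e0; near=> n.
rewrite ger0_norm ?subr_ge0 ?slices_le// ltrBlDr -ltrBlDl.
have ne : n.+1%:R^-1 < e by near: n; exact: (near_infty_natSinv_lt (PosNum e0)).
rewrite slicesE lt_min lt_max; apply/andP; split.
  by apply/orP; left; rewrite ltrD2l ltrN2.
apply: (@lt_le_trans _ _ (f x)); first by rewrite ltrBlDr ltrDl.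
apply: (@le_trans _ _ n%:R); last by rewrite ler_nat.
by near: n; exact: nbhs_infty_ger.
Unshelve. all: by end_near. Qed.

(** A lattice function is the limit of sums of its thin slices. A slice lies
    between two indicators of level sets, whose measures are compared with [I]
    by the outer measure; shifting the slices by one yields an upper and a
    lower bound that meet in the limit, because [I] is continuous along
    decreasing sequences. *)
Theorem daniell_stone : exists m : {measure set S -> \bar R},
  m (~` E) = 0%E /\
  forall f, L f -> (\int[m]_(x in E) (f x)%:E = (I f)%:E)%E.
Proof.
exists nu; split.
  apply/eqP; rewrite eq_le measure_ge0 andbT.
  apply: (@daniell_outer_le _ _ (fun _ _ => 0)); split => //.
  - by move=> ? ? _; rewrite lexx.
  - by move=> _ /=; rewrite I_0.
suff pos f : L f -> (forall x, E x -> 0 <= f x) ->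
    (\int[nu]_(x in E) (f x)%:E = (I f)%:E)%E.
  move=> f Lf.
  have Lf' := L_pos (L_Z (-1) Lf).
  rewrite integralE.
  rewrite (_ : (fun x => _)^\+%E = EFin \o (fun x => Num.max (f x) 0)); last first.
    by apply/funext => x; rewrite funeposE/= EFin_max.
  rewrite (_ : (fun x => _)^\-%E = EFin \o (fun x => Num.max (-1 * f x) 0)); last first.
    by apply/funext => x; rewrite funenegE/= mulN1r EFin_max.
  rewrite !pos//.
  - rewrite -EFinB -I_B//; last exact: L_pos.
    congr (I _)%:E; apply/funext => x; rewrite /Num.max; do ?case: ifPn; lra.
  - by move=> x _; rewrite le_max lexx orbT.
  - exact: L_pos.
  - by move=> x _; rewrite le_max lexx orbT.
move=> Lf f0.
have c_gt0 n : 0 < n.+1%:R^-1 :> R by rewrite invr_gt0.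
have mlayer n k : measurable_fun (E : set S) (EFin \o layer n.+1%:R^-1 f k).
  by apply: measurable_L; exact: L_layer.
have layer0 n k x : E x -> (0 <= (layer n.+1%:R^-1 f k x)%:E)%E.
  by move=> _; rewrite lee_fin layer_ge0// ltW.
have sum_le n x : E x -> \sum_(k < n.+1 ^ 2) layer n.+1%:R^-1 f k x <= f x.
  move=> Ex; rewrite sum_layer; last exact: ltW.
  by rewrite ge_min ge_max lexx f0.
apply/eqP; rewrite eq_le; apply/andP; split; last first.
  have Ir : I (fun x => f x - slices n f x) @[n --> \oo] --> 0.
    apply: I_cvg0.
    - by move=> n; apply: L_B => //; exact: L_slices.
    - move=> n x Ex; rewrite subr_ge0 slices_le ?f0//=.
      by rewrite lerD2l lerN2 slices_incr.
    - move=> x Ex; rewrite -(subrr (f x)); apply: cvgB; first exact: cvg_cst.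
      exact/slices_cvg/f0.
  have Is : (I (slices n f))%:E @[n --> \oo] --> (I f)%:E.
    apply: cvg_EFin; first exact: nearW.
    rewrite (_ : _ \o _ = fun n => I f - I (fun x => f x - slices n f x)).
      by rewrite -[X in _ --> X]subr0; apply: cvgB => //; exact: cvg_cst.
    apply/funext => n /=; rewrite I_B//; last exact: L_slices.
    by rewrite opprB addrC subrK.
  rewrite -(cvg_lim _ Is)//; apply: lime_le; first by apply/cvg_ex; exists (I f)%:E.
  apply: nearW => n.
  rewrite /slices (I_sum (g := fun k => layer n.+1%:R^-1 f k.+1)); last first.
    by move=> k; exact: L_layer.
  rewrite -sumEFin; apply: (@le_trans _ _ (\sum_(k < n.+1 ^ 2)
      \int[nu]_(x in E) (layer n.+1%:R^-1 f k x)%:E)%E).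
    by apply: lee_sum => k _; exact: le_integral_layer.
  rewrite -(ge0_integral_sum _ _ (fun k : 'I__ => mlayer n k))//; last first.
    by move=> k; exact: layer0.
  apply: ge0_le_integral => //.
  - by move=> x Ex; apply: sume_ge0 => k _; exact: layer0.
  - by apply: emeasurable_sum => k; exact: mlayer.
  - exact: measurable_L.
  - by move=> x Ex; rewrite sumEFin lee_fin sum_le.
have := @cvg_monotone_convergence _ S R nu E mE
  (fun n => EFin \o slices n f).
have -> : (\int[nu]_(x in E) limn ((fun n => EFin \o slices n f)^~ x) =
    \int[nu]_(x in E) (f x)%:E)%E.
  apply: eq_integral => x /set_mem Ex; apply: cvg_lim => //.
  by apply: cvg_EFin; [exact: nearW|exact/slices_cvg/f0].
have mslices n : measurable_fun (E : set S) (EFin \o slices n f).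
  by apply: measurable_L; exact: L_slices.
move=> /(_ mslices) cvgI.
have {}cvgI := cvgI (fun n x _ => slices_ge0 n f x)
  (fun x _ m n mn => slices_incr f x mn).
rewrite -(cvg_lim _ cvgI)//; apply: lime_le; first by apply/cvg_ex; eexists; exact: cvgI.
apply: nearW => n; rewrite /slices.
under eq_integral do rewrite /= -sumEFin.
rewrite (ge0_integral_sum _ _ (fun k : 'I__ => mlayer n k.+1))//; last first.
  by move=> k; exact: layer0.
apply: (@le_trans _ _ (\sum_(k < n.+1 ^ 2) (I (layer n.+1%:R^-1 f k))%:E)%E).
  by apply: lee_sum => k _; exact: integral_layer_le.
rewrite sumEFin lee_fin -(I_sum (g := fun k => layer n.+1%:R^-1 f k)); last first.
  by move=> k; exact: L_layer.
apply: I_le => //; last exact: sum_le.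
by apply: (L_sum (g := fun k => layer n.+1%:R^-1 f k)) => k; exact: L_layer.
Qed.

End daniell_stone.

(** * Continuous functions on a subspace *)

Section bounded_continuous.
Context {R : realType} {T : topologicalType}.
Implicit Types (E : set T) (f g h : T -> R).

Lemma within_continuousP E f : {within E, continuous f} <->
  forall x, E x -> f y @[y --> within E (nbhs x)] --> f x.
Proof. exact: subspace_continuousP. Qed.

Lemma within_continuous_near E f x e : {within E, continuous f} -> E x ->
  0 < e -> \forall y \near x, E y -> `|f x - f y| < e.
Proof.
move=> /within_continuousP fc Ex e0.
by have /cvgrPdist_lt/(_ e e0) := fc x Ex; rewrite near_withinE.
Qed.

Lemma within_continuousD E f g : {within E, continuous f} ->
  {within E, continuous g} -> {within E, continuous (fun x => f x + g x)}.
Proof.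
move=> /within_continuousP fc /within_continuousP gc; apply/within_continuousP.
by move=> x Ex; apply: cvgD; [exact: fc|exact: gc].
Qed.

Lemma within_continuousM E f g : {within E, continuous f} ->
  {within E, continuous g} -> {within E, continuous (fun x => f x * g x)}.
Proof.
move=> /within_continuousP fc /within_continuousP gc; apply/within_continuousP.
by move=> x Ex; apply: cvgM; [exact: fc|exact: gc].
Qed.

Lemma within_continuousV E f : {within E, continuous f} ->
  (forall x, E x -> f x != 0) -> {within E, continuous (fun x => (f x)^-1)}.
Proof.
move=> /within_continuousP fc f0; apply/within_continuousP.
by move=> x Ex; apply: cvgV; [exact: f0|exact: fc].
Qed.

Lemma within_continuous_norm E f : {within E, continuous f} ->
  {within E, continuous (fun x => `|f x|)}.
Proof.
move=> /within_continuousP fc; apply/within_continuousP.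
by move=> x Ex; apply: cvg_norm; exact: fc.
Qed.

Lemma within_continuous_cst E (a : R) : {within E, continuous (fun=> a : R)}.
Proof. by apply/within_continuousP => x Ex; exact: cvg_cst. Qed.

Lemma within_continuous_eq E f g : (forall x, E x -> f x = g x) ->
  {within E, continuous f} -> {within E, continuous g}.
Proof.
move=> fg /within_continuousP fc; apply/within_continuousP => x Ex.
apply/cvgrPdist_lt => e e0; rewrite near_withinE.
have /cvgrPdist_lt/(_ e e0) := fc x Ex; rewrite near_withinE.
by apply: filterS => y yP Ey; rewrite -!fg//; exact: yP.
Qed.

(** The bounded continuous functions on the subspace [E], encoded as functions
    on the whole space. *)
Definition Cb E : set (T -> R) :=
  [set h | {within E, continuous h} /\ exists M, forall x, E x -> `|h x| <= M].

Lemma CbP E h : Cb E h ->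
  exists M, 0 < M /\ forall x, E x -> `|h x| <= M.
Proof.
move=> [_ [M hM]]; exists (`|M| + 1); split; first by rewrite ltr_wpDl.
by move=> x /hM/le_trans; apply; rewrite (le_trans (ler_norm _))// lerDl.
Qed.

Lemma Cb_cst E a : Cb E (fun=> a).
Proof. by split; [exact: within_continuous_cst|exists `|a|]. Qed.

Lemma Cb_eq E f g : (forall x, E x -> f x = g x) -> Cb E f -> Cb E g.
Proof.
move=> fg [fc [M fM]]; split; first exact: within_continuous_eq fc.
by exists M => x Ex; rewrite -fg// fM.
Qed.

Lemma CbD E f g : Cb E f -> Cb E g -> Cb E (fun x => f x + g x).
Proof.
move=> [fc [M fM]] [gc [N gN]]; split; first exact: within_continuousD.
by exists (M + N) => x Ex; apply: le_trans (ler_normD _ _) _; rewrite lerD ?fM ?gN.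
Qed.

Lemma CbM E f g : Cb E f -> Cb E g -> Cb E (fun x => f x * g x).
Proof.
move=> [fc [M fM]] [gc [N gN]]; split; first exact: within_continuousM.
by exists (M * N) => x Ex; rewrite normrM ler_pM ?fM ?gN.
Qed.

Lemma CbZ E a f : Cb E f -> Cb E (fun x => a * f x).
Proof. by move=> Cf; apply: CbM => //; exact: Cb_cst. Qed.

Lemma CbN E f : Cb E f -> Cb E (fun x => - f x).
Proof. by move=> /(CbZ (-1)); apply: Cb_eq => x _; rewrite mulN1r. Qed.

Lemma CbB E f g : Cb E f -> Cb E g -> Cb E (fun x => f x - g x).
Proof. by move=> Cf /CbN; exact: CbD. Qed.

Lemma Cb_norm E f : Cb E f -> Cb E (fun x => `|f x|).
Proof.
move=> [fc [M fM]]; split; first exact: within_continuous_norm.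
by exists M => x Ex; rewrite normr_id fM.
Qed.

Lemma Cb_max E f g : Cb E f -> Cb E g -> Cb E (fun x => Num.max (f x) (g x)).
Proof.
move=> Cf Cg.
apply: (@Cb_eq _ (fun x => 2^-1 * (f x + g x + `|f x - g x|))).
  by move=> x _; rewrite maxr_absE mulrC.
apply/CbZ/CbD; first exact: CbD.
by apply/Cb_norm/CbB.
Qed.

Lemma within_continuous_minl E f (a : R) : {within E, continuous f} ->
  {within E, continuous (fun x => Num.min a (f x))}.
Proof.
move=> fc; apply: (@within_continuous_eq _ (fun x => (a + f x - `|a - f x|) * 2^-1)).
  by move=> x _; rewrite minr_absE.
have fN : {within E, continuous (fun x => a - f x)}.
  apply: within_continuousD; first exact: within_continuous_cst.
  apply: (@within_continuous_eq _ (fun x => -1 * f x)) => [x _|].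
    by rewrite mulN1r.
  by apply: within_continuousM => //; exact: within_continuous_cst.
apply: within_continuousM; last exact: within_continuous_cst.
apply: within_continuousD.
  by apply: within_continuousD => //; exact: within_continuous_cst.
apply: (@within_continuous_eq _ (fun x => -1 * `|a - f x|)) => [x _|].
  by rewrite mulN1r.
apply: within_continuousM; first exact: within_continuous_cst.
exact: within_continuous_norm.
Qed.

End bounded_continuous.

(** * Tight functionals *)

Section tight_functional.
Context {R : realType} {T : topologicalType} (E : set T) (q : T -> R).
Hypothesis q_cont : {within E, continuous q}.
Hypothesis q_compact : forall e, 0 < e -> compact [set x | E x /\ e <= q x].

(** Integration against a measure on [E] of mass at most [M] for which moreover
    the mass of [q < e] is at most [e * M]. *)
Record tight (M : R) (Lam : (T -> R) -> R) : Prop := {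
  tight_lin : forall a f g, Cb E f -> Cb E g ->
    Lam (fun x => a * f x + g x) = a * Lam f + Lam g ;
  tight_ge0 : forall f, Cb E f -> (forall x, E x -> 0 <= f x) -> 0 <= Lam f ;
  tight_mass : Lam (fun=> 1) <= M ;
  tight_escape : forall e f, 0 < e -> Cb E f ->
    (forall x, E x -> 0 <= f x <= 1) ->
    (forall x, E x -> e <= q x -> f x = 0) -> Lam f <= e * M }.

(** A continuous cutoff to the part of [E] near infinity, that is, where [q] is
    small. *)
Definition escape (e : R) x : R := Num.min 1 (Num.max 0 (2 - (2 / e) * q x)).

Lemma escape_itv e x : 0 <= escape e x <= 1.
Proof. by rewrite le_min ler01 le_max lexx ge_min lexx. Qed.

Lemma escape_eq0 e x : 0 < e -> e <= q x -> escape e x = 0.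
Proof.
move=> e0 eq; rewrite /escape max_l ?min_r// subr_le0 mulrAC ler_pdivlMr//.
by rewrite ler_pM2l.
Qed.

Lemma escape_eq1 e x : 0 < e -> q x <= e / 2 -> escape e x = 1.
Proof.
move=> e0 qe; rewrite /escape min_l// le_max; apply/orP; right.
suff : 2 / e * q x <= 1 by lra.
by rewrite mulrAC ler_pdivrMr// mul1r; lra.
Qed.

Lemma within_continuous_escape e : {within E, continuous (escape e)}.
Proof.
apply: within_continuous_minl.
have -> : (fun x => Num.max 0 (2 - 2 / e * q x)) =
    (fun x => - Num.min 0 (- 2 + 2 / e * q x)).
  by apply/funext => x; rewrite oppr_min oppr0 opprD opprK.
apply: (@within_continuous_eq _ _ _ (fun x => -1 * Num.min 0 (- 2 + 2 / e * q x))).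
  by move=> x _; rewrite mulN1r.
apply: within_continuousM; first exact: within_continuous_cst.
apply: within_continuous_minl; apply: within_continuousD; first exact: within_continuous_cst.
by apply: within_continuousM => //; exact: within_continuous_cst.
Qed.

Lemma Cb_escape e : Cb E (escape e).
Proof.
split; first exact: within_continuous_escape.
by exists 1 => x _; have /andP[? ?] := escape_itv e x; rewrite ger0_norm.
Qed.

Section theory.
Context (M : R) (Lam : (T -> R) -> R).
Hypothesis tLam : tight M Lam.

Lemma tight0 : Lam (fun=> 0) = 0.
Proof.
have := tight_lin tLam (-1) (Cb_cst E 0) (Cb_cst E 0).
rewrite (_ : (fun x => _) = fun=> 0); first lra.
by apply/funext => x; rewrite mulr0 addr0.
Qed.

Lemma tightZ a f : Cb E f -> Lam (fun x => a * f x) = a * Lam f.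
Proof.
move=> Cf; have := tight_lin tLam a Cf (Cb_cst E 0); rewrite tight0 addr0 => <-.
by congr Lam; apply/funext => x; rewrite addr0.
Qed.

Lemma tightD f g : Cb E f -> Cb E g -> Lam (fun x => f x + g x) = Lam f + Lam g.
Proof.
move=> Cf Cg; have := tight_lin tLam 1 Cf Cg; rewrite mul1r => <-.
by congr Lam; apply/funext => x; rewrite mul1r.
Qed.

Lemma tightN f : Cb E f -> Lam (fun x => - f x) = - Lam f.
Proof.
move=> Cf; rewrite -mulN1r -tightZ//.
by congr Lam; apply/funext => x; rewrite mulN1r.
Qed.

Lemma tightB f g : Cb E f -> Cb E g -> Lam (fun x => f x - g x) = Lam f - Lam g.
Proof. by move=> Cf Cg; rewrite tightD ?tightN//; exact: CbN. Qed.

Lemma tight_le f g : Cb E f -> Cb E g -> (forall x, E x -> f x <= g x) ->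
  Lam f <= Lam g.
Proof.
move=> Cf Cg fg; rewrite -subr_ge0 -tightB//; apply: (tight_ge0 tLam).
  exact: CbB.
by move=> x Ex; rewrite subr_ge0 fg.
Qed.

Lemma tight_eq f g : Cb E f -> (forall x, E x -> f x = g x) -> Lam f = Lam g.
Proof.
move=> Cf fg; have Cg := Cb_eq fg Cf.
by apply/eqP; rewrite eq_le !tight_le// => x Ex; rewrite fg.
Qed.

Lemma tight_norm_le f g : Cb E f -> Cb E g -> (forall x, E x -> `|f x| <= g x) ->
  `|Lam f| <= Lam g.
Proof.
move=> Cf Cg fg; rewrite ler_norml -tightN//.
by rewrite !tight_le//; try exact: CbN; move=> x /fg; rewrite ler_norml => /andP[].
Qed.

Lemma tight_mass_ge0 : 0 <= M.
Proof.
apply: le_trans (tight_mass tLam).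
by apply: (tight_ge0 tLam) => //; exact: Cb_cst.
Qed.

(** Near infinity the bound [N] is multiplied by [escape], whose integral is at
    most [e * M]. *)
Lemma tight_small a e N f : 0 < e -> 0 <= a -> 0 <= N -> Cb E f ->
  (forall x, E x -> e / 2 <= q x -> `|f x| <= a) ->
  (forall x, E x -> `|f x| <= N) -> `|Lam f| <= (a + N * e) * M.
Proof.
move=> e0 a0 N0 Cf fa fN.
have Cg : Cb E (fun x => N * escape e x + a * 1).
  by apply: CbD; apply: CbZ; [exact: Cb_escape|exact: Cb_cst].
apply: (@le_trans _ _ (Lam (fun x => N * escape e x + a * 1))).
  apply: tight_norm_le => // x Ex; have /andP[z0 _] := escape_itv e x.
  have [qe|/ltW qe] := leP (e / 2) (q x).
    by rewrite (le_trans (fa x Ex qe))// mulr1 lerDr mulr_ge0.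
  by rewrite escape_eq1// !mulr1 (le_trans (fN x Ex))// lerDl.
have Ce : Cb E (escape e) by exact: Cb_escape.
have C1 : Cb E (fun=> 1 : R) by exact: Cb_cst.
rewrite tightD; [|exact: CbZ|exact: CbZ].
rewrite !tightZ// mulrDl addrC lerD//.
  by rewrite ler_wpM2l// (tight_mass tLam).
rewrite -mulrA ler_wpM2l// (tight_escape tLam)//.
  by move=> x _; exact: escape_itv.
by move=> x _; exact: escape_eq0.
Qed.

(** Dini: decreasing continuous functions converge uniformly on the compacts
    [e / 2 <= q]. *)
Lemma tight_daniell (f : nat -> T -> R) : (forall n, Cb E (f n)) ->
  (forall n x, E x -> 0 <= f n.+1 x <= f n x) ->
  (forall x, E x -> f n x @[n --> \oo] --> 0) -> Lam (f n) @[n --> \oo] --> 0.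
Proof.
move=> Cf f_decr f_cvg; have [N [N0 fN]] := CbP (Cf 0).
have f_mono m n x : E x -> (m <= n)%N -> f n x <= f m x.
  move=> Ex; elim: n => [|n IH]; first by rewrite leqn0 => /eqP ->.
  rewrite leq_eqVlt => /orP[/eqP -> //|]; rewrite ltnS => /IH; apply: le_trans.
  by have /andP[] := f_decr n x Ex.
have f_ge0 n x : E x -> 0 <= f n x.
  by move=> Ex; have /andP[+ /(le_trans _)] := f_decr n x Ex; move=> f0; apply.
have f_le n x : E x -> `|f n x| <= N.
  move=> Ex; apply: le_trans (fN x Ex); rewrite !ger0_norm ?f_ge0//.
  exact: f_mono.
have M0 := tight_mass_ge0.
apply/cvgrPdist_le => eps eps0.
pose D := (1 + N) * (M + 1).
have D0 : 0 < D by apply: mulr_gt0; lra.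
pose a := eps / D; have a0 : 0 < a by rewrite divr_gt0.
have a20 : 0 < a / 2 by rewrite divr_gt0.
have /compact_near_coveringP/near_covering_withinP := q_compact a20.
move=> /(_ nat \oo (fun n x => f n x <= a)) near_le.
have {}near_le : \forall n \near \oo, [set x | E x /\ a / 2 <= q x] `<=` (fun x => f n x <= a).
  apply: near_le => x [Ex _].
  have /cvgrPdist_lt/(_ _ a20)[n0 _ fn0] := f_cvg x Ex.
  have := fn0 n0 (leqnn _); rewrite sub0r normrN => fn0x.
  have := within_continuous_near (Cf n0).1 Ex a20 => near_x.
  exists ([set y | E y -> `|f n0 x - f n0 y| < a / 2], [set n | (n0 <= n)%N]).
    by split => //; exact: nbhs_infty_ge.
  move=> [y n] [/= fy n0n] [Ey _]; apply: (@le_trans _ _ (f n0 y)).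
    exact: f_mono.
  rewrite ger0_norm ?f_ge0// in fn0x.
  by have := fy Ey; rewrite ltr_norml; lra.
near=> n; rewrite sub0r normrN.
have small : `|Lam (f n)| <= (a + N * a) * M.
  apply: tight_small => //; try exact: ltW.
    move=> x Ex qx; rewrite ger0_norm ?f_ge0//.
    by have : [set x | E x /\ a / 2 <= q x] `<=` (fun x => f n x <= a);
      [near: n; exact: near_le|apply].
  exact: f_le.
apply: le_trans small _.
rewrite (_ : a + N * a = a * (1 + N)); last by ring.
apply: (@le_trans _ _ (a * D)).
  rewrite -mulrA ler_wpM2l//; first exact: ltW.
  by rewrite ler_wpM2l//; lra.
by rewrite /a mulrAC -mulrA divff ?mulr1// gt_eqF.
Unshelve. all: by end_near. Qed.

End theory.
End tight_functional.

(** * Representation of tight functionals by measures *)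

Section open_sets.
Context {R : realType} {V : normedModType R}.

(** Distance to the complement, truncated at [1]: a continuous function that is
    positive exactly on the open set [A]. *)
Definition depth (A : set V) (x : V) : R :=
  sup [set e : R | 0 <= e <= 1 /\ forall y, `|x - y| < e -> A y].

Lemma depth_has_sup (A : set V) (x : V) :
  has_sup [set e : R | 0 <= e <= 1 /\ forall y, `|x - y| < e -> A y].
Proof.
split; last by exists 1 => e [/andP[]].
exists 0; split; first by rewrite lexx ler01.
by move=> y; rewrite ltNge normr_ge0.
Qed.

Lemma depth_ge (A : set V) (x : V) (e : R) : 0 <= e <= 1 ->
  (forall y, `|x - y| < e -> A y) -> e <= depth A x.
Proof. by move=> e01 eA; apply: (ub_le_sup (depth_has_sup A x).2). Qed.

Lemma depth_itv (A : set V) x : 0 <= depth A x <= 1.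
Proof.
apply/andP; split.
  by apply: depth_ge; [rewrite lexx ler01|move=> y; rewrite ltNge normr_ge0].
by apply: ge_sup => [|e [/andP[]]//]; exact: (depth_has_sup A x).1.
Qed.

Lemma depth_lip (A : set V) x y : depth A x <= depth A y + `|x - y|.
Proof.
apply: ge_sup => [|e [/andP[e0 e1] eA]]; first exact: (depth_has_sup A x).1.
have [ed|de] := leP e `|x - y|.
  by rewrite (le_trans ed)// lerDr; have /andP[] := depth_itv A y.
rewrite -lerBlDr; apply: depth_ge.
  by rewrite subr_ge0 (ltW de)/= lerBlDr (le_trans e1)// lerDl.
move=> z yz; apply: eA; apply: le_lt_trans (ler_distD y _ _) _.
by rewrite addrC -ltrBrDr.
Qed.

Lemma continuous_depth (A : set V) : continuous (depth A).
Proof.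
move=> x; apply/cvgrPdist_lt => e e0.
near=> y; have xy : `|x - y| < e.
  by near: y; exact: cvgr_dist_lt.
apply: le_lt_trans xy; rewrite ler_norml.
have := depth_lip A x y; have := depth_lip A y x; rewrite (distrC y x); lra.
Unshelve. all: by end_near. Qed.

Lemma depth_gt0 (A : set V) x : open A -> A x <-> 0 < depth A x.
Proof.
move=> oA; split.
  move=> Ax; have /nbhs_ballP[e /= e0 eA] := open_nbhs_nbhs (conj oA Ax).
  apply: (@lt_le_trans _ _ (Num.min e 1)); first by rewrite lt_min e0 ltr01.
  apply: depth_ge; first by rewrite le_min ltW// ler01 ge_min lexx orbT.
  move=> y; rewrite lt_min => /andP[xy _]; apply: eA.
  by rewrite -ball_normE.
move=> /sup_gt[|e [_ eA] e0]; first by have [] := depth_has_sup A x.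
by apply: eA; rewrite subrr normr0.
Qed.

End open_sets.

Section borel.
Context {R : realType} {d : nat}.
Local Notation T := 'rV[R]_d.
Local Notation B := (borelRV R d).
Implicit Types E : set T.

Lemma measurable_open E : open E -> measurable (E : set B).
Proof. exact: sub_sigma_algebra. Qed.

Lemma measurable_closed E : closed E -> measurable (E : set B).
Proof.
by move=> /closed_openC/measurable_open/measurableC; rewrite setCK.
Qed.

Lemma measurable_compact E : compact E -> measurable (E : set B).
Proof.
move=> /compact_closed; move=> h; apply: measurable_closed; apply: h.
exact: norm_hausdorff.
Qed.

Lemma measurable_within_continuous E (h : T -> R) : measurable (E : set B) ->
  {within E, continuous h} -> measurable_fun (E : set B) (h : B -> R).
Proof.
move=> mE /continuousP hc.
apply: (measurability _ (RGenOpens.measurableE R)) => _ [_ [a [b ->] <-]].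
have /open_subspaceP[U oU UE] : open (from_subspace E h @^-1` `]a, b[%classic).
  by apply: hc; exact: interval_open.
rewrite setIC (_ : _ `&` _ = U `&` E) //.
by apply: measurableI => //; exact: measurable_open.
Qed.

End borel.

Section representation.
Context {R : realType} {d : nat}.
Local Notation T := 'rV[R]_d.
Local Notation B := (borelRV R d).
Context (E : set T) (q w : T -> R).
Hypothesis mE : measurable (E : set B).
Hypothesis q_cont : {within E, continuous q}.
Hypothesis q_compact : forall e, 0 < e -> compact [set x | E x /\ e <= q x].
Hypothesis w_cont : {within E, continuous w}.
Hypothesis w_gt0 : forall x, E x -> 0 < w x.

(** The measure [f] on [E] satisfies [w f = Lam]. *)
Definition represents (f : {measure set B -> \bar R}) (Lam : (T -> R) -> R) :=
  f (~` E) = 0%E /\ forall h, Cb E h ->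
    (\int[f]_(x in E) (h x * w x)%:E = (Lam h)%:E)%E.

Lemma measurable_div_weight (f : T -> R) : Cb E (fun x => f x / w x) ->
  measurable_fun (E : set B) f.
Proof.
move=> [fc _].
suff : measurable_fun (E : set B) (fun x => f x / w x * w x).
  apply: eq_measurable_fun => x /set_mem Ex.
  by rewrite divfK// gt_eqF// w_gt0.
by apply: measurable_funM; exact: measurable_within_continuous.
Qed.

(** Tightness replaces local compactness in the continuity hypothesis of the
    Daniell-Stone theorem, which is applied to the functions [h * w] with [h]
    bounded and continuous. Dividing by [w] lets the measure have infinite mass
    where the weight degenerates. Open sets are positivity sets of lattice
    functions by [depth], so the measure is Borel. *)
Theorem tight_represents M Lam : tight E q M Lam -> exists f, represents f Lam.
Proof.
move=> tLam.
pose L : set (T -> R) := [set f | Cb E (fun x => f x / w x)].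
have w_ge0 x : E x -> 0 <= (w x)^-1 by move=> /w_gt0 w0; rewrite invr_ge0 ltW.
have [||||||||||f [fE fI]] := @daniell_stone R T E L
    (fun f => Lam (fun x => f x / w x)) _ _ _ _ _ _ _ (@open T).
- by rewrite /L/=; apply: Cb_eq (Cb_cst E 0) => x _; rewrite mul0r.
- move=> a f g Lf Lg; rewrite /L/=.
  by apply: Cb_eq (CbD (CbZ a Lf) Lg) => x _; rewrite mulrDl mulrA.
- move=> f Lf; rewrite /L/=.
  apply: Cb_eq (Cb_max Lf (Cb_cst E 0)) => x Ex.
  by rewrite maxr_pMl ?w_ge0// mul0r.
- move=> f [fc [N fN]]; split; last first.
    exists N => x Ex; apply: le_trans (fN x Ex); rewrite !normrM.
    rewrite ler_wpM2r// /Num.min; case: ifPn => // f1.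
    by rewrite normr1 real_ler_normr ?num_real//; apply/orP; left; lra.
  have : {within E, continuous (fun x => Num.min 1 (f x / w x * w x) * (w x)^-1)}.
    apply: within_continuousM.
      by apply/within_continuous_minl/within_continuousM.
    by apply: within_continuousV => // x /w_gt0; rewrite lt0r => /andP[].
  apply: within_continuous_eq => x Ex.
  by rewrite divfK 1?minC// gt_eqF// w_gt0.
- move=> a f g Lf Lg; rewrite -(tight_lin tLam)//.
  by congr Lam; apply/funext => x; rewrite mulrDl mulrA.
- move=> f Lf f0; apply: (tight_ge0 tLam) => // x Ex.
  by rewrite mulr_ge0 ?f0 ?w_ge0.
- move=> f Lf f_decr f_cvg.
  apply: (tight_daniell q_cont q_compact tLam) => //.
    move=> n x Ex; have /andP[f0 fd] := f_decr n x Ex.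
    by rewrite mulr_ge0 ?w_ge0//= ler_wpM2r// w_ge0.
  move=> x Ex; rewrite -[X in _ --> X](mul0r (w x)^-1).
  by apply: cvgM; [exact: f_cvg|exact: cvg_cst].
- move=> A oA; exists (fun x => depth A x * w x).
    rewrite /L/=; apply: (@Cb_eq _ _ _ (depth A)).
      by move=> x Ex; rewrite mulfK// gt_eqF// w_gt0.
    split; first by apply: continuous_subspaceT; exact: continuous_depth.
    by exists 1 => x _; have /andP[? ?] := depth_itv A x; rewrite ger0_norm.
  by move=> x Ex; rewrite (depth_gt0 x oA) pmulr_lgt0// w_gt0.
- exact: mE.
- by move=> f; exact: measurable_div_weight.
exists f; split => // h Ch.
have hK x : E x -> h x = h x * w x / w x by move=> Ex; rewrite mulfK// gt_eqF// w_gt0.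
rewrite fI; first by rewrite -(tight_eq tLam Ch hK).
exact: Cb_eq hK Ch.
Qed.

End representation.

(** * Double integrals and weak convergence *)

Section double_integral.
Context {R : realType} {T : topologicalType} (E : set T) (q : T -> R).
Hypothesis q_cont : {within E, continuous q}.
Hypothesis q_compact : forall e, 0 < e -> compact [set x | E x /\ e <= q x].

Definition Cb2 : set (T -> T -> R) :=
  [set H | {within E `*` E, continuous (fun p => H p.1 p.2)} /\
    exists N, forall x y, E x -> E y -> `|H x y| <= N].

Definition double (Lam : (T -> R) -> R) (H : T -> T -> R) : R :=
  Lam (fun x => Lam (H x)).

Lemma Cb2P H : Cb2 H ->
  exists N, 0 < N /\ forall x y, E x -> E y -> `|H x y| <= N.
Proof.
move=> [_ [N HN]]; exists (`|N| + 1); split; first by rewrite ltr_wpDl.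
by move=> x y Ex Ey; rewrite (le_trans (HN x y Ex Ey))// (le_trans (ler_norm _))// lerDl.
Qed.

Lemma Cb2_near H x y e : Cb2 H -> E x -> E y -> 0 < e ->
  exists U V, [/\ nbhs x U, nbhs y V & forall x' y', U x' -> V y' -> E x' -> E y' ->
    `|H x y - H x' y'| < e].
Proof.
move=> [Hc _] Ex Ey e0.
have := @within_continuous_near _ _ _ _ (x, y) e Hc (conj Ex Ey) e0.
move=> [[U V] /= [Ux Vy] UV]; exists U, V; split => // x' y' Ux' Vy' Ex' Ey'.
exact: (UV (x', y') (conj Ux' Vy') (conj Ex' Ey')).
Qed.

Lemma Cb2_slice H x : Cb2 H -> E x -> Cb E (H x).
Proof.
move=> CH Ex; have [N [_ HN]] := Cb2P CH; split; last by exists N => y; exact: HN.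
apply/within_continuousP => y Ey; apply/cvgrPdist_lt => e e0.
have [U [V [Ux Vy UV]]] := Cb2_near CH Ex Ey e0.
rewrite near_withinE; apply: filterS Vy => y' Vy' Ey'.
by apply: UV => //; exact: nbhs_singleton.
Qed.

(** By compactness of [e / 2 <= q], the slices of [H] at nearby points are
    uniformly close there. *)
Lemma tight_equicontinuous M H x0 eps : Cb2 H -> E x0 -> 0 < eps ->
  \forall x \near x0, E x ->
    forall Lam, tight E q M Lam -> `|Lam (H x) - Lam (H x0)| <= eps.
Proof.
move=> CH Ex0 eps0; have [N [N0 HN]] := Cb2P CH.
have [M0|M0] := ltP M 0.
  by apply: nearW => x Ex Lam /tight_mass_ge0; rewrite leNgt M0.
pose D := (1 + (N + N)) * (M + 1).
have D0 : 0 < D by apply: mulr_gt0; lra.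
pose a := eps / D; have a0 : 0 < a by rewrite divr_gt0.
have a20 : 0 < a / 2 by rewrite divr_gt0.
have /compact_near_coveringP/near_covering_withinP := q_compact a20.
move=> /(_ T (nbhs x0) (fun x y => E x -> `|H x y - H x0 y| <= a)) tube.
have {}tube : \forall x \near x0, [set y | E y /\ a / 2 <= q y] `<=`
    (fun y => E x -> `|H x y - H x0 y| <= a).
  apply: tube => y [Ey _].
  have [U [V [Ux Vy UV]]] := Cb2_near CH Ex0 Ey a20.
  exists (V, U) => //= -[y' x] [/= Vy' Ux'] [Ey' _] Ex.
  have := UV _ _ Ux' Vy' Ex Ey'; have := UV _ _ (nbhs_singleton Ux) Vy' Ex0 Ey'.
  rewrite !ltr_norml ler_norml; lra.
apply: filterS tube => x tube Ex Lam tLam.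
have Cx := Cb2_slice CH Ex; have Cx0 := Cb2_slice CH Ex0.
rewrite -(tightB tLam)//.
have : `|Lam (fun y => H x y - H x0 y)| <= (a + (N + N) * a) * M.
  apply: (tight_small q_cont tLam) => //; try exact: ltW; last 2 first.
  - by move=> y Ey qy; apply: tube.
  - move=> y Ey; rewrite (le_trans (ler_normB _ _))// lerD//; exact: HN.
  - by rewrite addr_ge0// ltW.
  - exact: CbB.
move=> /le_trans; apply.
rewrite (_ : a + (N + N) * a = a * (1 + (N + N))); last by ring.
apply: (@le_trans _ _ (a * D)).
  rewrite -mulrA ler_wpM2l//; first exact: ltW.
  by rewrite ler_wpM2l//; lra.
by rewrite /a mulrAC -mulrA divff ?mulr1// gt_eqF.
Qed.

Lemma tight_bound M Lam h N : tight E q M Lam -> Cb E h ->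
  (forall x, E x -> `|h x| <= N) -> `|Lam h| <= `|N| * M.
Proof.
move=> tLam Ch hN; apply: (@le_trans _ _ (Lam (fun=> `|N| * 1))).
  apply: (tight_norm_le tLam) => //; first exact: Cb_cst.
  by move=> x Ex; rewrite mulr1 (le_trans (hN x Ex))// ler_norm.
rewrite (tightZ tLam); last exact: Cb_cst.
by rewrite ler_wpM2l//; exact: tight_mass tLam.
Qed.

(** The continuity of the inner integral is the equicontinuity of the slices.
    *)
Lemma Cb_inner M Lam H : tight E q M Lam -> Cb2 H -> Cb E (fun x => Lam (H x)).
Proof.
move=> tLam CH; split; last first.
  have [N [N0 HN]] := Cb2P CH; exists (`|N| * M) => x Ex.
  by apply: (tight_bound tLam); [exact: Cb2_slice|move=> y; exact: HN].
apply/within_continuousP => x Ex; apply/cvgrPdist_le => e e0.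
rewrite near_withinE; have := tight_equicontinuous M CH Ex e0.
by apply: filterS => y /[swap] Ey /(_ Ey _ tLam); rewrite distrC.
Qed.

Lemma Cb2B H H' : Cb2 H -> Cb2 H' -> Cb2 (fun x y => H x y - H' x y).
Proof.
move=> [Hc [N HN]] [Hc' [N' HN']]; split.
  have : {within E `*` E, continuous (fun p => H p.1 p.2 + -1 * H' p.1 p.2)}.
    apply: within_continuousD => //; apply: within_continuousM => //.
    exact: within_continuous_cst.
  by apply: within_continuous_eq => p _; rewrite mulN1r.
exists (N + N') => x y Ex Ey; rewrite (le_trans (ler_normB _ _))// lerD//.
  exact: HN.
exact: HN'.
Qed.

Lemma double_bound M Lam H N : tight E q M Lam -> Cb2 H ->
  (forall x y, E x -> E y -> `|H x y| <= N) -> `|double Lam H| <= `|N| * M ^+ 2.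
Proof.
move=> tLam CH HN; have M0 := tight_mass_ge0 tLam.
rewrite expr2 mulrA -[`|N| * M](@ger0_norm _ (`|N| * M)) ?mulr_ge0//.
apply: (tight_bound tLam); first exact: Cb_inner tLam CH.
by move=> x Ex; apply: (tight_bound tLam); [exact: Cb2_slice|move=> y; exact: HN].
Qed.

Lemma doubleB M Lam H H' : tight E q M Lam -> Cb2 H -> Cb2 H' ->
  double Lam (fun x y => H x y - H' x y) = double Lam H - double Lam H'.
Proof.
move=> tLam CH CH'; rewrite /double -(tightB tLam); try exact: Cb_inner tLam _.
have CB := Cb2B CH CH'.
apply: (tight_eq tLam); first exact: (Cb_inner tLam CB).
by move=> x Ex; rewrite (tightB tLam)//; exact: Cb2_slice.
Qed.

(** Weak convergence of equitight measures passes to their squares. The inner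
    integrals converge pointwise and are equicontinuous, hence converge
    uniformly on the compacts [e / 2 <= q]. *)
Theorem double_cvg (J : Type) (F : set_system J) (FF : Filter F) M
    (Lam_ : J -> (T -> R) -> R) Lam H :
  (forall j, tight E q M (Lam_ j)) -> tight E q M Lam ->
  (forall h, Cb E h -> Lam_ j h @[j --> F] --> Lam h) -> Cb2 H ->
  double (Lam_ j) H @[j --> F] --> double Lam H.
Proof.
move=> tLam_ tLam Lam_cvg CH; have [N [N0 HN]] := Cb2P CH.
have M0 := tight_mass_ge0 tLam.
have NM0 : 0 <= N * M by rewrite mulr_ge0// ltW.
pose G_ j x := Lam_ j (H x); pose G x := Lam (H x).
have CG : Cb E G by exact: Cb_inner tLam CH.
have CG_ j : Cb E (G_ j) by exact: Cb_inner (tLam_ j) CH.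
have GN x : E x -> `|G x| <= N * M.
  move=> Ex; rewrite -[in leRHS](gtr0_norm N0); apply: (tight_bound tLam).
    exact: Cb2_slice.
  by move=> y; exact: HN.
have GN_ j x : E x -> `|G_ j x| <= N * M.
  move=> Ex; rewrite -[in leRHS](gtr0_norm N0); apply: (tight_bound (tLam_ j)).
    exact: Cb2_slice.
  by move=> y; exact: HN.
apply/cvgrPdist_le => eps eps0.
pose D := (1 + (N * M + N * M)) * (M + 1).
have D0 : 0 < D by apply: mulr_gt0; lra.
pose a := eps / 2 / D; have a0 : 0 < a by rewrite !divr_gt0.
have a20 : 0 < a / 2 by rewrite divr_gt0.
have a30 : 0 < a / 3 by rewrite divr_gt0.
have /compact_near_coveringP/near_covering_withinP := q_compact a20.
move=> /(_ J F (fun j x => `|G_ j x - G x| <= a) FF) unif.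
have {}unif : \forall j \near F, [set x | E x /\ a / 2 <= q x] `<=`
    (fun x => `|G_ j x - G x| <= a).
  apply: unif => x [Ex _].
  have near_x := tight_equicontinuous M CH Ex a30.
  have /cvgrPdist_le/(_ _ a30) near_j := Lam_cvg _ (Cb2_slice CH Ex).
  exists ([set x' | E x' -> forall Lam0, tight E q M Lam0 ->
       `|Lam0 (H x') - Lam0 (H x)| <= a / 3],
     [set j | `|Lam (H x) - Lam_ j (H x)| <= a / 3]) => //.
  move=> [x' j] [/= nx' nj] [Ex' _].
  move: nj (nx' Ex' _ tLam) (nx' Ex' _ (tLam_ j)); rewrite /G_ /G !ler_norml.
  by lra.
have /cvgrPdist_le/(_ (eps / 2)) := Lam_cvg _ CG.
rewrite divr_gt0// => /(_ isT) near_G.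
near=> j.
have step : `|Lam_ j (fun x => G_ j x - G x)| <= (a + (N * M + N * M) * a) * M.
  apply: (tight_small q_cont (tLam_ j)) => //; try exact: ltW; last 2 first.
  - move=> x Ex qx.
    have : [set x | E x /\ a / 2 <= q x] `<=` (fun x => `|G_ j x - G x| <= a).
      by near: j; exact: unif.
    by apply.
  - move=> x Ex; rewrite (le_trans (ler_normB _ _))// lerD//; [exact: GN_|exact: GN].
  - by rewrite addr_ge0.
  - exact: CbB.
have near_Gj : `|Lam G - Lam_ j G| <= eps / 2 by near: j.
have aD : (a + (N * M + N * M) * a) * M <= eps / 2.
  rewrite (_ : a + (N * M + N * M) * a = a * (1 + (N * M + N * M))); last by ring.
  apply: (@le_trans _ _ (a * D)).
    rewrite -mulrA ler_wpM2l//; first exact: ltW.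
    by rewrite ler_wpM2l//; lra.
  by rewrite /a mulrAC -mulrA divff ?mulr1// gt_eqF.
move: step near_Gj; rewrite (tightB (tLam_ j))// /double -/(G_ j) -/G !ler_norml.
move: aD; set b := (_ * M); lra.
Unshelve. all: by end_near. Qed.

End double_integral.

(** * Integrating a derivative that exists everywhere *)

Section everywhere_derivative.
Context {R : realType}.
Local Notation mu := (@lebesgue_measure R).

Lemma lipschitz_continuous (g : R -> R) (L : R) :
  (forall x y, `|g x - g y| <= L * `|x - y|) -> continuous g.
Proof.
move=> gL x; apply/cvgrPdist_lt => e e0.
have L1 : 0 < `|L| + 1 by rewrite ltr_wpDl.
near=> y; apply: le_lt_trans (gL x y) _.
have xy : `|x - y| < e / (`|L| + 1).
  by near: y; apply: cvgr_dist_lt => //; rewrite divr_gt0.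
apply: (@le_lt_trans _ _ ((`|L| + 1) * `|x - y|)).
  by rewrite ler_wpM2r// (le_trans (ler_norm _))// lerDl.
by rewrite mulrC -ltr_pdivlMr.
Unshelve. all: by end_near. Qed.

(** Translating the variable turns the integral of the difference quotient into
    a difference of means of [g] near the two end points. Integrals start at
    [-1] to have [0] and [t] in the interior. *)
Lemma integral_difference_quotient (g : R -> R) (t c : R) : 0 < t -> 0 < c ->
  continuous g ->
  (\int[mu]_(s in `[0%R, t]) (c^-1 * (g (s + c) - g s))%:E =
    (c^-1 * ((\int[mu]_(s in `[-1, (t + c)%R]) g s)%R -
             (\int[mu]_(s in `[-1, t]) g s)%R))%:E -
    (c^-1 * ((\int[mu]_(s in `[-1, c]) g s)%R -
             (\int[mu]_(s in `[-1, 0%R]) g s)%R))%:E)%E.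
Proof.
move=> t0 c0 gc.
pose Gam (x : R) : R := (\int[mu]_(s in `[-1, x]) g s)%R.
have dGam (x : R) : -1 < x -> is_derive x 1 Gam (g x).
  move=> x1; have x1' : x < x + 1 by rewrite ltrDl.
  have gi : mu.-integrable `[-1, x + 1] (EFin \o g).
    apply: continuous_compact_integrable; first exact: segment_compact.
    exact: continuous_subspaceT.
  have [? <-] := continuous_FTC1_closed x1' gi x1 (gc x).
  by apply: DeriveDef => //; rewrite derive1E.
pose P (s : R) : R := c^-1 * (Gam (s + c) - Gam s).
have dP (s : R) : -1 < s -> is_derive s 1 P (c^-1 * (g (s + c) - g s)).
  move=> s1; have sc1 : -1 < s + c by rewrite (lt_trans s1)// ltrDl.
  have d1 := dGam _ s1; have d2 := dGam _ sc1.
  have d3 : is_derive s 1 (fun s => Gam (s + c)) (g (s + c)).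
    have d4 : is_derive s 1 (fun s : R => s + c) 1.
      by rewrite -[X in is_derive _ _ _ X]addr0; apply: is_deriveD.
    have := @is_derive1_comp _ Gam (fun s : R => s + c) s _ _ d2 d4.
    by rewrite mulr1.
  exact: is_deriveZ.
have cP (s : R) : -1 < s -> {for s, continuous P}.
  move=> s1; apply: differentiable_continuous; apply/derivable1_diffP.
  by have [] := dP s s1.
rewrite (@continuous_FTC2 _ (fun s => c^-1 * (g (s + c) - g s)) P 0 t t0).
- by rewrite /P add0r.
- apply: continuous_subspaceT => s; apply: cvgM; first exact: cvg_cst.
  apply: cvgB; last exact: gc.
  apply: (cvg_comp (fun s => s + c) g); last exact: gc.
  by apply: cvgD; [exact: cvg_id|exact: cvg_cst].
- split.
  + move=> s; rewrite in_itv/= => /andP[s0 _]; have [] := dP s _ => //.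
    by rewrite (lt_trans _ s0).
  + by apply: cvg_at_right_filter; apply: cP.
  + by apply: cvg_at_left_filter; apply: cP; rewrite (lt_trans _ t0).
- move=> s; rewrite in_itv/= => /andP[s0 _]; rewrite derive1E.
  by have [] := dP s _ => //; rewrite (lt_trans _ s0).
Qed.

Lemma cvg_mean (g : R -> R) (x : R) : continuous g -> -1 < x ->
  n.+1%:R^-1^-1 * ((\int[mu]_(s in `[-1, x + n.+1%:R^-1]) g s)%R -
             (\int[mu]_(s in `[-1, x]) g s)%R) @[n --> \oo] --> g x.
Proof.
move=> gc x1.
have x1' : x < x + 1 by rewrite ltrDl.
have gi : mu.-integrable `[-1, x + 1] (EFin \o g).
  apply: continuous_compact_integrable; first exact: segment_compact.
  exact: continuous_subspaceT.
have [dG Gx] := continuous_FTC1_closed x1' gi x1 (gc x).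
rewrite -Gx derive1E; move: dG; rewrite /derivable => /cvg_ex[l dG].
rewrite [X in _ --> X](cvg_lim _ dG)//.
have c_cvg : n.+1%:R^-1 @[n --> \oo] --> (0 : R)^'.
  move=> A [e /= e0 eA]; suff : \forall n \near \oo, A n.+1%:R^-1 by [].
  near=> n; have n0 : n.+1%:R^-1 != 0 :> R by rewrite invr_eq0 pnatr_eq0.
  apply: eA => //; rewrite /ball_/= sub0r normrN ger0_norm ?invr_ge0//.
  by near: n; exact: (near_infty_natSinv_lt (PosNum e0)).
apply: cvg_trans; last exact: (cvg_comp _ _ c_cvg dG).
apply: near_eq_cvg; apply: nearW => n.
by rewrite /= /GRing.scale/= mulr1 (addrC x).
Unshelve. all: by end_near. Qed.

(** The difference quotients are bounded by the Lipschitz constant, so that the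
    integral passes to the limit, while the integrals of the quotients
    telescope to means of [g] near the end points. This covers derivatives that
    are merely measurable. *)
Theorem integral_everywhere_derivative (g D : R -> R) (L t : R) : 0 <= t ->
  (forall x y, 0 <= x <= t + 1 -> 0 <= y <= t + 1 ->
    `|g x - g y| <= L * `|x - y|) ->
  (forall s, 0 <= s <= t ->
    n.+1%:R * (g (s + n.+1%:R^-1) - g s) @[n --> \oo] --> D s) ->
  mu.-integrable `[0%R, t] (EFin \o D) /\
  (\int[mu]_(s in `[0%R, t]) (D s)%:E = (g t - g 0)%:E)%E.
Proof.
rewrite le_eqVlt => /predU1P[<- _ _|t0 gL gD].
  rewrite set_itv1 subrr; split; last by rewrite integral_set1.
  apply/integrableP; split; last by rewrite integral_set1.
  exact: measurable_fun_set1.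
pose c n : R := n.+1%:R^-1.
have c0 n : 0 < c n by rewrite invr_gt0.
have c1 n : c n <= 1 by rewrite invf_le1// ler1n.
have cV n : (c n)^-1 = n.+1%:R by rewrite invrK.
pose h (x : R) : R := Num.min (Num.max x 0) (t + 1).
have h_itv x : 0 <= h x <= t + 1.
  rewrite /h le_min ge_min lexx orbT andbT le_max lexx orbT/=; lra.
have h_lip x y : `|h x - h y| <= `|x - y|.
  suff hB u v : h u - h v <= `|u - v|.
    by rewrite ler_norml lerNl opprB {1}distrC !hB.
  have := ler_norm (u - v); have := normr_ge0 (u - v); rewrite /h.
  have [u0|u0] := leP u 0; have [v0|v0] := leP v 0;
    have [u1|u1] := leP u (t + 1); have [v1|v1] := leP v (t + 1);
    rewrite ?min_l; lra.
have h_id x : 0 <= x <= t + 1 -> h x = x.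
  by move=> /andP[x0 xt]; rewrite /h max_l// min_l.
pose G := g \o h.
have L0 : 0 <= L.
  have := le_trans (normr_ge0 _) (gL 0 (t + 1) _ _).
  by rewrite pmulr_lge0; [apply; lra|rewrite normr_gt0; lra].
have GL x y : `|G x - G y| <= L * `|x - y|.
  by rewrite (le_trans (gL _ _ (h_itv x) (h_itv y)))// ler_wpM2l.
have Gc : continuous G := lipschitz_continuous GL.
have G_id x : 0 <= x <= t + 1 -> G x = g x by move=> ?; rewrite /G/= h_id.
pose Dn n s := (c n)^-1 * (G (s + c n) - G s).
have DnD s : 0 <= s <= t -> Dn n s @[n --> \oo] --> D s.
  move=> st; have := gD s st; apply: cvg_trans; apply: near_eq_cvg; apply: nearW => n.
  rewrite /Dn cV -[n.+1%:R^-1]/(c n); move/andP: st => [s0 st].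
  have := c0 n; have := c1 n; move: (c n) => e e1 e0.
  by rewrite !G_id//; apply/andP; split; lra.
have Dn_le n s : `|Dn n s| <= L.
  have cn := c0 n; rewrite /Dn normrM gtr0_norm ?invr_gt0// ler_pdivrMl//.
  by rewrite mulrC (le_trans (GL _ _))// addrAC subrr add0r gtr0_norm.
have mDn n : measurable_fun [set: R] (Dn n).
  apply: continuous_measurable_fun => s; apply: cvgM; first exact: cvg_cst.
  apply: cvgB; last exact: Gc.
  apply: (cvg_comp (fun s => s + c n) G); last exact: Gc.
  by apply: cvgD; [exact: cvg_id|exact: cvg_cst].
have m0t : measurable `[0%R, t]%classic by exact: measurable_itv.
have mD : measurable_fun (`[0%R, t]%classic : set R) D.
  apply: (@measurable_fun_cvg _ _ _ _ Dn).
    by move=> n; exact: measurable_funTS.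
  by move=> s; rewrite /= in_itv/= => st; exact: DnD.
have iL : mu.-integrable `[0%R, t] (cst L%:E).
  apply: (@continuous_compact_integrable _ (fun=> L)); first exact: segment_compact.
  by apply: continuous_subspaceT => s; exact: cvg_cst.
have [|||||iD _ intD] := @dominated_convergence _ _ R mu `[0%R, t]%classic m0t
  (fun n => EFin \o Dn n) (EFin \o D) (cst L%:E) => //.
- by move=> n; apply/measurable_EFinP; apply: measurable_funTS; exact: mDn.
- exact/measurable_EFinP.
- apply: aeW => s; rewrite /= in_itv/= => st; apply: cvg_EFin; first exact: nearW.
  exact: DnD.
- by apply: aeW => s n _; rewrite lee_fin.
split => //.
have cvg1 : (\int[mu]_(s in `[0%R, t]) (Dn n s)%:E)%E @[n --> \oo] --> (G t - G 0)%:E.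
  have mean (x : R) : -1 < x -> (c n)^-1 * ((\int[mu]_(s in `[-1, x + c n]) G s)%R -
      (\int[mu]_(s in `[-1, x]) G s)%R) @[n --> \oo] --> G x by exact: cvg_mean.
  have m1 := mean t _; have := mean 0 (ltrN10 _).
  under eq_fun do rewrite add0r; move=> m0.
  have mB := cvgB (m1 (lt_trans (ltrN10 _) t0)) m0.
  move: mB; set u := (X in X x @[x --> _] --> _) => mB.
  rewrite (_ : (fun n => _) = EFin \o u); first by apply: cvg_EFin; [exact: nearW|exact: mB].
  apply/funext => n; rewrite /u [LHS]integral_difference_quotient//=.
have -> : (g t - g 0)%:E = (G t - G 0)%:E by rewrite !G_id//; lra.
by rewrite -(cvg_lim _ cvg1)// -(cvg_lim _ intD).
Qed.

End everywhere_derivative.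

(** * Finite sums of point masses *)

(** The integral of [h] against the finite sum of point masses [p.1] at [p.2]. *)
Definition atomic (R : realType) (T : Type) (s : seq (R * T)) (h : T -> R) : R :=
  \sum_(p <- s) p.1 * h p.2.

Section atomic.
Context {R : realType} {T : choiceType}.
Implicit Types (s : seq (R * T)) (h g : T -> R).

Lemma atomic_cat s1 s2 h : atomic (s1 ++ s2) h = atomic s1 h + atomic s2 h.
Proof. by rewrite /atomic big_cat. Qed.

Lemma atomicD s h g : atomic s (fun x => h x + g x) = atomic s h + atomic s g.
Proof. by rewrite /atomic -big_split; apply: eq_bigr => p _; rewrite mulrDr. Qed.

Lemma atomicZ s a h : atomic s (fun x => a * h x) = a * atomic s h.
Proof. by rewrite /atomic mulr_sumr; apply: eq_bigr => p _; rewrite mulrCA. Qed.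

Lemma atomic_ge0 s h : (forall p, p \in s -> 0 <= p.1 * h p.2) -> 0 <= atomic s h.
Proof. by move=> s0; rewrite /atomic big_seq sumr_ge0. Qed.

Definition atomic_on (E : set T) s := forall p, p \in s -> 0 <= p.1 /\ E p.2.

Lemma atomic_le E s h g : atomic_on E s -> (forall x, E x -> h x <= g x) ->
  atomic s h <= atomic s g.
Proof.
move=> sE hg; rewrite /atomic !big_seq; apply: ler_sum => p ps.
by have [p0 Ep] := sE p ps; rewrite ler_wpM2l// hg.
Qed.

Lemma atomic_eq E s h g : atomic_on E s -> (forall x, E x -> h x = g x) ->
  atomic s h = atomic s g.
Proof.
move=> sE hg; rewrite /atomic !big_seq; apply: eq_bigr => p ps.
by have [p0 Ep] := sE p ps; rewrite hg.
Qed.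

Lemma atomic_norm s E h : atomic_on E s -> `|atomic s h| <= atomic s (fun x => `|h x|).
Proof.
move=> sE; rewrite /atomic (le_trans (ler_norm_sum _ _ _))//.
rewrite !big_seq; apply: ler_sum => p ps; have [p0 _] := sE p ps.
by rewrite normrM ger0_norm.
Qed.

End atomic.

Section discretization.
Context {R : realType} {dd : measure_display} {T : measurableType dd}.
Context (mu : {measure set T -> \bar R}) (E : set T) (W : T -> R).
Hypothesis mE : measurable E.
Hypothesis W_ge0 : forall x, E x -> 0 <= W x.
Hypothesis W_int : mu.-integrable E (EFin \o W).

Definition atomic_approx (e : R) (hs : set (T -> R)) (S : set T) (s : seq (R * T)) :=
  [/\ atomic_on S s, atomic s (fun=> 1) = (\int[mu]_(x in S) W x)%R &
    forall h, hs h ->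
      `|atomic s h - (\int[mu]_(x in S) (h x * W x))%R| <=
        e * (\int[mu]_(x in S) W x)%R].

Let int_bounded (h : T -> R) (N : R) : measurable_fun E h -> (forall x, E x -> `|h x| <= N) ->
  mu.-integrable E (EFin \o (fun x => h x * W x)).
Proof.
move=> mh hN; have mW : measurable_fun E W by apply/measurable_EFinP; exact: measurable_int W_int.
have : mu.-integrable E (EFin \o (fun x => N * W x)).
  apply: (eq_integrable mE (fun x => (N%:E * (W x)%:E)%E)) => //.
  exact: integrableZl.
apply: le_integrable => //; first by apply/measurable_EFinP; exact: measurable_funM.
move=> x Ex /=; rewrite lee_fin !normrM ler_wpM2r//.
exact: le_trans (hN x Ex) (ler_norm _).
Qed.

(** Splitting a set into level sets of one more function keeps the points of the
    approximation in the level sets, so that the new function is approximated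
    to within the mesh of its levels. *)
Lemma atomic_approx_ex (e : R) (hs : seq (T -> R)) : 0 < e ->
  (forall h, h \in hs -> measurable_fun E h /\
    exists N : R, forall x, E x -> `|h x| <= N) ->
  forall S, measurable S -> S `<=` E ->
    exists s, atomic_approx e [set h | h \in hs] S s.
Proof.
move=> e0; elim: hs => [_ S mS SE|h hs IH hsP S mS SE].
  have [->|/set0P[x Sx]] := eqVneq S set0.
    by exists [::]; split => //; rewrite /atomic big_nil Rintegral_set0.
  exists [:: ((\int[mu]_(x in S) W x)%R, x)]; split => //.
    move=> p; rewrite inE => /eqP -> /=; split => //.
    by apply: Rintegral_ge0 => y /SE; exact: W_ge0.
  by rewrite /atomic big_seq1 mulr1.
have [mh [N hN]] := hsP h (mem_head _ _).
have hhW := int_bounded mh hN.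
have {}IH := IH (fun g ghs => hsP g (@mem_behead _ (h :: hs) g ghs)).
have setU_approx A B s1 s2 : measurable A -> measurable B -> A `<=` E -> B `<=` E ->
    [disjoint A & B] ->
    atomic_approx e [set g | g \in h :: hs] A s1 ->
    atomic_approx e [set g | g \in h :: hs] B s2 ->
    atomic_approx e [set g | g \in h :: hs] (A `|` B) (s1 ++ s2).
  move=> mA mB AE BE AB [s1A s1W s1h] [s2B s2W s2h].
  have mAB : measurable (A `|` B) by exact: measurableU.
  have ABE : A `|` B `<=` E by rewrite subUset.
  split.
  - move=> p; rewrite mem_cat => /orP[/s1A|/s2B] [p0 pA]; split => //;
      by [left|right].
  - rewrite atomic_cat s1W s2W Rintegral_setU//.
    exact: integrableS mE mAB ABE W_int.
  - move=> g gh; have [mg [N' gN]] := hsP g gh.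
    rewrite atomic_cat !Rintegral_setU//; last 2 first.
    + exact: integrableS mE mAB ABE W_int.
    + exact: integrableS mE mAB ABE (int_bounded mg gN).
    rewrite mulrDr opprD addrACA (le_trans (ler_normD _ _))// lerD//.
      exact: s1h.
    exact: s2h.
have cell b A : measurable A -> A `<=` E ->
    (forall x, A x -> b <= h x <= b + e) ->
    exists s, atomic_approx e [set g | g \in h :: hs] A s.
  move=> mA AE hb; have [s [sA sW sh]] := IH A mA AE; exists s; split => //.
  move=> g; rewrite /= inE => /orP[/eqP ->|]; last exact: sh.
  have AW := integrableS mE mA AE W_int.
  have AhW := integrableS mE mA AE hhW.
  have Aint c : mu.-integrable A (EFin \o (fun x => c * W x)).
    apply: (eq_integrable mA (fun x => (c%:E * (W x)%:E)%E)) => //.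
    exact: integrableZl.
  have lo1 : b * atomic s (fun=> 1) <= atomic s h.
    rewrite -atomicZ; apply: (atomic_le sA) => x /hb /andP[? _].
    by rewrite mulr1.
  have hi1 : atomic s h <= (b + e) * atomic s (fun=> 1).
    rewrite -atomicZ; apply: (atomic_le sA) => x /hb /andP[_ ?].
    by rewrite mulr1.
  have lo2 : b * (\int[mu]_(x in A) W x)%R <= (\int[mu]_(x in A) (h x * W x))%R.
    rewrite -RintegralZl//; apply: le_Rintegral => // x Ax.
    by rewrite ler_wpM2r ?W_ge0//; [exact: AE|have /andP[] := hb x Ax].
  have hi2 : (\int[mu]_(x in A) (h x * W x))%R <= (b + e) * (\int[mu]_(x in A) W x)%R.
    rewrite -RintegralZl//; apply: le_Rintegral => // x Ax.
    by rewrite ler_wpM2r ?W_ge0//; [exact: AE|have /andP[] := hb x Ax].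
  rewrite sW in lo1 hi1; rewrite ler_norml; move: lo1 hi1 lo2 hi2.
  by set i := (\int[mu]_(x in A) W x)%R; rewrite mulrDl; lra.
suff strip n A b : measurable A -> A `<=` E ->
    (forall x, A x -> b <= h x < b + n%:R * e) ->
    exists s, atomic_approx e [set g | g \in h :: hs] A s.
  have [n nN] : exists n, (2 * `|N| + 1) / e < n%:R.
    by exists (Num.truncn ((2 * `|N| + 1) / e)).+1; exact: truncnS_gt.
  apply: (strip n S (- `|N|)) => // x Sx.
  rewrite ltr_pdivrMr// in nN.
  have := hN x (SE x Sx); have := ler_norm N; rewrite ler_norml => Nn /andP[h1 h2].
  by apply/andP; split; lra.
elim: n A b => [|n IHn] A b mA AE hb.
  have -> : A = set0.
    by apply/seteqP; split => // x /hb; rewrite mul0r addr0 => /andP[/le_lt_trans h1 /h1]; rewrite ltxx.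
  by exists [::]; split => // [|g _]; rewrite /atomic big_nil !Rintegral_set0// subrr normr0 mulr0.
pose A1 := A `&` h @^-1` `]-oo, b + n%:R * e[.
pose A2 := A `&` h @^-1` `[b + n%:R * e, +oo[.
have mhA : measurable_fun A h by exact: measurable_funS mh.
have mA1 : measurable A1 by apply: mhA => //; exact: measurable_itv.
have mA2 : measurable A2 by apply: mhA => //; exact: measurable_itv.
have [||x [Ax]|s1 s1P] := IHn A1 b _ _ _ => //.
- by move=> x [/AE].
- by rewrite /= in_itv/= => ->; have /andP[->] := hb x Ax.
have [||x [Ax]|s2 s2P] := cell (b + n%:R * e) A2 _ _ _ => //.
- by move=> x [/AE].
- rewrite /= in_itv/= andbT => ->/=; have /andP[_ /ltW] := hb x Ax.
  by rewrite -natr1 mulrDl mul1r addrA.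
exists (s1 ++ s2).
have -> : A = A1 `|` A2.
  apply/seteqP; split => [x Ax|x [[]|[]]//].
  by have [xb|xb] := ltP (h x) (b + n%:R * e); [left|right]; split => //=;
    rewrite in_itv/= ?andbT.
apply: setU_approx => //; try by move=> x [/AE].
apply/disj_setPS => x [[_ /=]]; rewrite in_itv/= => xb [_ /=].
by rewrite in_itv/= andbT leNgt xb.
Qed.

End discretization.

(** * Discretized coagulation *)

Section discrete_coagulation.
Context {R : realType} {T : zmodType}.
Implicit Types (s : seq (R * T)) (K : T -> T -> R) (f : T -> R).

Definition gain f (x y : T) : R := f (x + y) - f x - f y.

Definition coag_rate K s f : R :=
  2^-1 * atomic s (fun x => atomic s (fun y => K x y * gain f x y)).

(** An explicit Euler step of length [tau]: each mass loses what it spends in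
    collisions, and each pair creates a mass at the sum. Pairs are ordered,
    whence the factor [1 / 2]. *)
Definition coag_step K (tau : R) s : seq (R * T) :=
  [seq (p.1 * (1 - tau * atomic s (K p.2)), p.2) | p <- s] ++
  [seq (tau / 2 * K p.2 r.2 * p.1 * r.1, p.2 + r.2) | p <- s, r <- s].

(** By symmetry of [K] the loss terms of the two partners of a collision are
    equal. *)
Lemma atomic_coag_step (E : set T) K tau s f : atomic_on E s ->
  (forall x y, E x -> E y -> K x y = K y x) ->
  atomic (coag_step K tau s) f = atomic s f + tau * coag_rate K s f.
Proof.
move=> sE Ksym.
rewrite atomic_cat /coag_rate [X in X + _ = _]/atomic [X in _ + X = _]/atomic.
rewrite big_map big_allpairs_dep/=.
have -> : \sum_(p <- s) p.1 * (1 - tau * atomic s (K p.2)) * f p.2 =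
    atomic s f - tau * atomic s (fun x => atomic s (fun y => K x y * f x)).
  rewrite /atomic mulr_sumr -sumrB; apply: eq_bigr => p _.
  rewrite mulrBr mulr1 mulrBl; congr (_ - _).
  have -> : \sum_(r <- s) r.1 * (K p.2 r.2 * f p.2) =
      (\sum_(r <- s) r.1 * K p.2 r.2) * f p.2.
    by rewrite mulr_suml; apply: eq_bigr => r _; rewrite mulrA.
  ring.
have -> : \sum_(p <- s) \sum_(r <- s) tau / 2 * K p.2 r.2 * p.1 * r.1 * f (p.2 + r.2)
    = tau * (2^-1 * atomic s (fun x => atomic s (fun y => K x y * f (x + y)))).
  rewrite /atomic !mulr_sumr; apply: eq_bigr => p _.
  by rewrite !mulr_sumr; apply: eq_bigr => r _; ring.
have sym : atomic s (fun x => atomic s (fun y => K x y * f y)) =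
    atomic s (fun x => atomic s (fun y => K x y * f x)).
  rewrite /atomic; under eq_bigr do rewrite mulr_sumr.
  under [RHS]eq_bigr do rewrite mulr_sumr.
  rewrite exchange_big/= !big_seq; apply: eq_bigr => p ps.
  rewrite !big_seq; apply: eq_bigr => r rs.
  have [_ Ep] := sE p ps; have [_ Er] := sE r rs.
  by rewrite (Ksym r.2 p.2)//; ring.
have -> : atomic s (fun x => atomic s (fun y => K x y * gain f x y)) =
    atomic s (fun x => atomic s (fun y => K x y * f (x + y))) -
    atomic s (fun x => atomic s (fun y => K x y * f x)) -
    atomic s (fun x => atomic s (fun y => K x y * f y)).
  rewrite /atomic -!sumrB; apply: eq_bigr => p _; rewrite -!mulrBr; congr (_ * _).
  by rewrite -!sumrB; apply: eq_bigr => r _; rewrite /gain; ring.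
by rewrite sym; field.
Qed.

Lemma atomic_on_coag_step (E : set T) K tau s : atomic_on E s -> 0 <= tau ->
  (forall x y, E x -> E y -> E (x + y)) ->
  (forall x y, E x -> E y -> 0 <= K x y) ->
  (forall x, E x -> tau * atomic s (K x) <= 1) ->
  atomic_on E (coag_step K tau s).
Proof.
move=> sE tau0 ED K0 Kle p; rewrite mem_cat => /orP[/mapP[r rs ->]|].
  have [r0 Er] := sE r rs; split => //=.
  by rewrite mulr_ge0// subr_ge0 Kle.
move=> /allpairsP[[r r'] /= [rs r's ->]] /=.
have [r0 Er] := sE r rs; have [r'0 Er'] := sE r' r's.
split; last exact: ED.
by rewrite !mulr_ge0// ?divr_ge0// K0.
Qed.

End discrete_coagulation.

(** The kernel is dominated by the product of the weight [w]; the moment of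
    order [W] dominates that of order [w] and does not increase under
    coagulation. *)
Record dominated_kernel (R : realType) (T : zmodType) (E : set T)
    (K : T -> T -> R) (c : R) (w W : T -> R) : Prop := {
  dom_add : forall x y, E x -> E y -> E (x + y) ;
  dom_ge0 : forall x y, E x -> E y -> 0 <= K x y ;
  dom_sym : forall x y, E x -> E y -> K x y = K y x ;
  dom_cst : 0 <= c ;
  dom_gt0 : forall x, E x -> 0 < w x ;
  dom_le : forall x y, E x -> E y -> K x y <= c * (w x * w y) ;
  dom_weight : forall x, E x -> w x <= W x ;
  dom_sub : forall x y, E x -> E y -> W (x + y) <= W x + W y }.

Section coagulation_weights.
Context {R : realType} {T : zmodType}.
Context (E : set T) (K : T -> T -> R) (c : R) (w W : T -> R).
Hypothesis dK : dominated_kernel E K c w W.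
Let ED := dom_add dK.
Let K_ge0 := dom_ge0 dK.
Let K_sym := dom_sym dK.
Let c_ge0 := dom_cst dK.
Let w_gt0 := dom_gt0 dK.
Let K_le := dom_le dK.
Let w_le := dom_weight dK.
Let W_sub := dom_sub dK.

Local Notation q := (fun x => w x / W x).

Lemma W_gt0 x : E x -> 0 < W x.
Proof. by move=> Ex; apply: lt_le_trans (w_le Ex); exact: w_gt0. Qed.

(** Without the particles in [q < e] the loss rates are bounded, so that a
    short Euler step keeps the masses nonnegative. *)
Definition cut_kernel (e : R) x y : R :=
  if (e <= q x) && (e <= q y) then K x y else 0.

Lemma cut_kernel_ge0 e x y : E x -> E y -> 0 <= cut_kernel e x y.
Proof. by move=> Ex Ey; rewrite /cut_kernel; case: ifP => // _; exact: K_ge0. Qed.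

Lemma cut_kernel_le e x y : E x -> E y -> cut_kernel e x y <= K x y.
Proof. by move=> Ex Ey; rewrite /cut_kernel; case: ifP => // _; exact: K_ge0. Qed.

Lemma cut_kernel_sym e x y : E x -> E y -> cut_kernel e x y = cut_kernel e y x.
Proof. by move=> Ex Ey; rewrite /cut_kernel andbC; case: ifP => // _; exact: K_sym. Qed.

(** The moment of order [W] is the only a priori bound: it controls the total
    weight and, as [w < e * W] outside the compact [e <= q], its escape. *)
Definition state (M : R) (s : seq (R * T)) := atomic_on E s /\ atomic s W <= M.

Definition weighted (s : seq (R * T)) (h : T -> R) : R :=
  atomic s (fun x => h x * w x).

Lemma weighted_mass M s : state M s -> atomic s w <= M.
Proof. by move=> [sE sW]; apply: le_trans sW; exact: (atomic_le sE). Qed.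

Lemma state_ge0 M s : state M s -> 0 <= M.
Proof.
move=> sS; apply: le_trans (weighted_mass sS); apply: atomic_ge0 => p ps.
by have [p0 Ep] := sS.1 p ps; rewrite mulr_ge0// ltW// w_gt0.
Qed.

(** There [w < e * W]. *)
Lemma weighted_escape M s e : state M s -> 0 <= e ->
  atomic s (fun x => if e <= q x then 0 else w x) <= e * M.
Proof.
move=> [sE sW] e0; apply: (@le_trans _ _ (e * atomic s W)); last by rewrite ler_wpM2l.
rewrite -atomicZ; apply: (atomic_le sE) => x Ex; have W0 := W_gt0 Ex.
case: ifPn => [_|]; first by rewrite mulr_ge0// ltW.
by rewrite -ltNge ltr_pdivrMr// => /ltW.
Qed.

Lemma gain_le (N : R) (f : T -> R) x y : (forall x, E x -> `|f x| <= N) -> E x -> E y ->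
  `|gain f x y| <= 3 * N.
Proof.
move=> fN Ex Ey; have := fN _ (ED Ex Ey); have := fN _ Ex; have := fN _ Ey.
by rewrite /gain !ler_norml; lra.
Qed.

Lemma coag_rate_le M s e N (f : T -> R) : state M s -> 0 <= N ->
  (forall x, E x -> `|f x| <= N) ->
  `|coag_rate (cut_kernel e) s f| <= 2 * N * c * M ^+ 2.
Proof.
move=> sS N0 fN; have [sE _] := sS; have sw := weighted_mass sS.
have M0 := state_ge0 sS.
have sw0 : 0 <= atomic s w.
  apply: atomic_ge0 => p ps.
  by have [p0 Ep] := sE p ps; rewrite mulr_ge0// ltW// w_gt0.
have inner x : E x -> `|atomic s (fun y => cut_kernel e x y * gain f x y)| <=
    3 * N * c * M * w x.
  move=> Ex; apply: le_trans (atomic_norm _ sE) _.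
  apply: (@le_trans _ _ (atomic s (fun y => 3 * N * c * w x * w y))).
    apply: (atomic_le sE) => y Ey; rewrite normrM mulrC.
    rewrite -!mulrA mulrA ler_pM//; first by rewrite [leRHS]mulrC mulrC gain_le.
    rewrite ger0_norm ?cut_kernel_ge0//.
    exact: le_trans (cut_kernel_le _ Ex Ey) (K_le Ex Ey).
  rewrite atomicZ -!mulrA !ler_wpM2l// mulrC ler_wpM2r//.
  by rewrite ltW// w_gt0.
rewrite /coag_rate normrM ger0_norm//.
have : `|atomic s (fun x => atomic s (fun y => cut_kernel e x y * gain f x y))|
    <= 3 * N * c * M ^+ 2.
  apply: le_trans (atomic_norm _ sE) _.
  apply: (@le_trans _ _ (atomic s (fun x => 3 * N * c * M * w x))).
    exact: (atomic_le sE).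
  rewrite atomicZ expr2 (mulrA _ M) ler_wpM2l//.
  by rewrite !mulr_ge0.
have : 0 <= N * c * M ^+ 2 by rewrite !mulr_ge0.
by rewrite -!mulrA; set z := N * _; lra.
Qed.

(** A suppressed collision has a partner in [q < e], and the total weight of
    these is at most [e * M], uniformly in the states. *)
Lemma coag_rate_cut M s e N (f : T -> R) : state M s -> 0 <= e -> 0 <= N ->
  (forall x, E x -> `|f x| <= N) ->
  `|coag_rate (cut_kernel e) s f - coag_rate K s f| <= 3 * N * c * e * M ^+ 2.
Proof.
move=> sS e0 N0 fN; have [sE _] := sS; have sw := weighted_mass sS.
have M0 := state_ge0 sS.
pose w' x := if e <= q x then 0 else w x.
have w'0 x : E x -> 0 <= w' x.
  by move=> Ex; rewrite /w'; case: ifP => // _; rewrite ltW// w_gt0.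
have sw' : atomic s w' <= e * M by exact: weighted_escape sS e0.
have sw0 : 0 <= atomic s w.
  apply: atomic_ge0 => p ps.
  by have [p0 Ep] := sE p ps; rewrite mulr_ge0// ltW// w_gt0.
have pointwise x y : E x -> E y ->
    `|(cut_kernel e x y - K x y) * gain f x y| <= 3 * N * c * (w x * w' y + w' x * w y).
  move=> Ex Ey; rewrite normrM.
  have wx := ltW (w_gt0 Ex); have wy := ltW (w_gt0 Ey).
  have cut : `|cut_kernel e x y - K x y| <= c * (w x * w' y + w' x * w y).
    rewrite /cut_kernel /w'; case: (e <= q x); case: (e <= q y) => /=.
    - by rewrite subrr normr0 !(mulr0, mul0r) addr0 mulr0.
    - by rewrite sub0r normrN mul0r addr0 ger0_norm ?K_ge0 ?K_le.
    - by rewrite sub0r normrN mulr0 add0r ger0_norm ?K_ge0 ?K_le.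
    - rewrite sub0r normrN ger0_norm ?K_ge0// (le_trans (K_le Ex Ey))//.
      by rewrite ler_wpM2l// lerDl mulr_ge0.
  rewrite -(mulrA (3 * N)) mulrC ler_pM//; exact: gain_le.
have inner x : E x ->
    `|atomic s (fun y => (cut_kernel e x y - K x y) * gain f x y)| <=
    3 * N * c * (e * M * w x + M * w' x).
  move=> Ex; have wx := ltW (w_gt0 Ex).
  apply: le_trans (atomic_norm _ sE) _.
  apply: (@le_trans _ _ (atomic s (fun y => 3 * N * c * (w x * w' y + w' x * w y)))).
    by apply: (atomic_le sE) => y Ey; exact: pointwise.
  rewrite atomicZ atomicD !atomicZ ler_wpM2l ?mulr_ge0//.
  by apply: lerD; rewrite mulrC ler_wpM2r// w'0.
have -> : coag_rate (cut_kernel e) s f - coag_rate K s f = 2^-1 *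
    atomic s (fun x => atomic s (fun y => (cut_kernel e x y - K x y) * gain f x y)).
  rewrite /coag_rate -mulrBr /atomic -sumrB; congr (_ * _); apply: eq_bigr => p _.
  rewrite -mulrBr -sumrB; congr (_ * _); apply: eq_bigr => r _.
  by rewrite -mulrBr mulrBl.
rewrite normrM ger0_norm// ler_pdivrMl//.
apply: le_trans (atomic_norm _ sE) _.
apply: (@le_trans _ _ (atomic s (fun x => 3 * N * c * (e * M * w x + M * w' x)))).
  exact: (atomic_le sE).
rewrite atomicZ atomicD !atomicZ.
have h1 : e * M * atomic s w <= e * M * M by rewrite ler_wpM2l// mulr_ge0.
have h2 : M * atomic s w' <= M * (e * M) by rewrite ler_wpM2l.
have h3 : 0 <= 3 * N * c by rewrite !mulr_ge0.
apply: (@le_trans _ _ (3 * N * c * (e * M * M + M * (e * M)))).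
  by rewrite ler_wpM2l// lerD.
by rewrite expr2 le_eqVlt; apply/orP; left; apply/eqP; ring.
Qed.

(** The step is small enough for the loss term of [coag_step] to leave the
    masses nonnegative. *)
Definition small_step (M e tau : R) := 0 <= tau /\
  forall x, E x -> e <= q x -> tau * (c * w x * M) <= 1.

(** The masses stay nonnegative because the step is small, and the moment of
    order [W] does not increase because [W] is subadditive. *)
Lemma state_coag_step M e tau s : small_step M e tau -> state M s ->
  state M (coag_step (cut_kernel e) tau s).
Proof.
move=> [tau0 tau_le] sS; have [sE sW] := sS; have M0 := state_ge0 sS.
have K0 x y : E x -> E y -> 0 <= cut_kernel e x y by exact: cut_kernel_ge0.
split.
  apply: atomic_on_coag_step => // x Ex.
  have [ex|ex] := boolP (e <= q x); last first.
    rewrite (_ : atomic s _ = 0) ?mulr0//; apply: big1 => p _.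
    by rewrite /cut_kernel (negbTE ex) mulr0.
  apply: le_trans (tau_le x Ex ex); rewrite ler_wpM2l//.
  apply: (@le_trans _ _ (atomic s (fun y => c * w x * w y))).
    apply: (atomic_le sE) => y Ey; rewrite -mulrA.
    exact: le_trans (cut_kernel_le _ Ex Ey) (K_le Ex Ey).
  by rewrite atomicZ ler_wpM2l ?(weighted_mass sS)// mulr_ge0// ltW// w_gt0.
rewrite (atomic_coag_step tau W sE); last exact: cut_kernel_sym.
rewrite (le_trans _ sW)// gerDl mulr_ge0_le0// /coag_rate mulr_ge0_le0//.
rewrite -oppr_ge0 -mulN1r -atomicZ; apply: atomic_ge0 => p ps.
have [p0 Ep] := sE p ps; rewrite mulr_ge0// -atomicZ; apply: atomic_ge0 => r rs.
have [r0 Er] := sE r rs; rewrite mulr_ge0// mulN1r oppr_ge0 mulr_ge0_le0 ?K0//.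
by rewrite /gain -addrA -opprD subr_le0 W_sub.
Qed.

Section iteration.
Context (M e tau : R) (s0 : seq (R * T)).
Hypothesis tau_small : small_step M e tau.
Hypothesis s0_state : state M s0.

Definition coag_iter k := iter k (coag_step (cut_kernel e) tau) s0.

Lemma state_coag_iter k : state M (coag_iter k).
Proof. by elim: k => [//|k IH]; rewrite /coag_iter iterS; exact: state_coag_step. Qed.

Lemma atomic_coag_iterS k (f : T -> R) :
  atomic (coag_iter k.+1) f =
  atomic (coag_iter k) f + tau * coag_rate (cut_kernel e) (coag_iter k) f.
Proof.
rewrite /coag_iter iterS (@atomic_coag_step _ _ E) //.
- by have [] := state_coag_iter k.
- exact: cut_kernel_sym.
Qed.

(** The gain of an additive quantity vanishes. *)
Lemma atomic_coag_iter_additive k (f : T -> R) :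
  (forall x y, f (x + y) = f x + f y) -> atomic (coag_iter k) f = atomic s0 f.
Proof.
move=> fD; elim: k => [//|k IH]; rewrite atomic_coag_iterS IH /coag_rate.
have -> : atomic (coag_iter k) (fun x => atomic (coag_iter k)
    (fun y => cut_kernel e x y * gain f x y)) = 0; last by rewrite !mulr0 addr0.
  rewrite /atomic big1// => p _; rewrite big1 ?mulr0// => r _.
  by rewrite /gain fD (_ : f p.2 + f r.2 - f p.2 - f r.2 = 0) ?mulr0//; ring.
Qed.

(** The increment is [tau] times the sum of the rates over the steps. *)
Lemma coag_iter_increment (f : T -> R) (j k : nat) (a b : R) : (j <= k)%N ->
  (forall i, (j <= i < k)%N ->
    `|coag_rate (cut_kernel e) (coag_iter i) f - b| <= a) ->
  `|atomic (coag_iter k) f - atomic (coag_iter j) f - tau * (k - j)%:R * b|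
    <= tau * (k - j)%:R * a.
Proof.
have [tau0 _] := tau_small.
elim: k => [|k IH].
  by rewrite leqn0 => /eqP -> _; rewrite subrr mulr0 !mul0r subrr normr0.
rewrite leq_eqVlt => /predU1P[-> _|]; first by rewrite !subnn mulr0 !mul0r !subrr normr0.
rewrite ltnS => jk rate.
rewrite subSn// -natr1 atomic_coag_iterS.
have := rate k; rewrite jk ltnSn => /(_ isT) ratek.
have {}IH : `|atomic (coag_iter k) f - atomic (coag_iter j) f - tau * (k - j)%:R * b|
    <= tau * (k - j)%:R * a.
  apply: IH => // i /andP[ji ik]; apply: rate; rewrite ji/=.
  exact: ltn_trans ik _.
have ratek' : `|tau * (coag_rate (cut_kernel e) (coag_iter k) f - b)| <= tau * a.
  by rewrite normrM ger0_norm// ler_wpM2l.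
rewrite (_ : _ - _ = (atomic (coag_iter k) f - atomic (coag_iter j) f -
  tau * (k - j)%:R * b) + tau * (coag_rate (cut_kernel e) (coag_iter k) f - b)).
  rewrite (le_trans (ler_normD _ _))//.
  rewrite [leRHS](_ : _ = tau * (k - j)%:R * a + tau * a); first exact: lerD.
  by ring.
by ring.
Qed.

Lemma coag_iter_lipschitz (f : T -> R) (N : R) (j k : nat) : 0 <= N ->
  (forall x, E x -> `|f x| <= N) ->
  `|atomic (coag_iter k) f - atomic (coag_iter j) f| <=
    tau * `|k%:R - j%:R| * (2 * N * c * M ^+ 2).
Proof.
move=> N0 fN; wlog jk : j k / (j <= k)%N => [th|].
  have [/th//|/ltnW/th] := leqP j k.
  by rewrite distrC (distrC j%:R).
rewrite -natrB// normr_nat.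
have := @coag_iter_increment f j k (2 * N * c * M ^+ 2) 0 jk.
rewrite mulr0 subr0; apply => i _; rewrite subr0.
exact: coag_rate_le (state_coag_iter i) N0 fN.
Qed.

End iteration.

End coagulation_weights.

(** * Ultrafilter limits and compactly supported functions *)

Lemma ler_cvg (R : realType) (I : Type) (F : set_system I) {FF : ProperFilter F}
    (f g : I -> R) (a b : R) : f i @[i --> F] --> a -> g i @[i --> F] --> b ->
  (\forall i \near F, f i <= g i) -> a <= b.
Proof.
move=> fa gb fg; have gfab : g i - f i @[i --> F] --> b - a by exact: cvgB.
rewrite -subr_ge0 -(cvg_lim _ gfab)//; apply: limr_ge.
  by apply/cvg_ex; eexists; exact: gfab.
by apply: filterS fg => i; rewrite subr_ge0.
Qed.

Section ultrafilter_limits.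
Context {R : realType} {I : Type} (U : set_system I) {UU : UltraFilter U}.

Lemma ultra_fmap (V : Type) (f : I -> V) : UltraFilter (f x @[x --> U]).
Proof.
apply: Build_UltraFilter => G GP UG; apply/seteqP; split => [A GA|]; last exact: UG.
have [//|UnA] := in_ultra_setVsetC (f @^-1` A) UU.
have /filterI/(_ GA) : G (~` A) by exact: UG.
by rewrite setICl => /filter_not_empty.
Qed.

(** The image ultrafilter contains a compact interval. *)
Lemma ultra_bounded_cvg (f : I -> R) (N : R) : (forall i, `|f i| <= N) ->
  cvg (f i @[i --> U]).
Proof.
move=> fN; have fU := ultra_fmap f.
have := @segment_compact R (- N) N; rewrite compact_ultra => /(_ _ fU)[|l [_ fl]].
  by apply: nearW => i; rewrite /= in_itv/= -ler_norml.
by apply/cvg_ex; exists l.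
Qed.

End ultrafilter_limits.

Section compactly_supported.
Context {R : realType} {T : topologicalType} (E : set T) (q : T -> R).
Hypothesis q_cont : {within E, continuous q}.
Hypothesis q_compact : forall e, 0 < e -> compact [set x | E x /\ e <= q x].

Lemma within_continuous_bounded (h : T -> R) e : 0 < e -> {within E, continuous h} ->
  exists2 N : R, 0 < N & forall x, E x -> e <= q x -> `|h x| <= N.
Proof.
move=> e0 hc; pose C := [set x | E x /\ e <= q x].
have : compact (h @` C).
  apply: continuous_compact; last exact: q_compact.
  by apply: continuous_subspaceW hc => x [].
move=> /compact_bounded[N [_ NP]]; exists (`|N| + 1); first by rewrite ltr_wpDl.
move=> x Ex qx; apply: (NP (`|N| + 1)); last by exists x.
by rewrite (le_lt_trans (ler_norm _))// ltrDl.
Qed.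

(** The counterpart of compactly supported functions: they may be divided by
    the weight. *)
Definition Cq : set (T -> R) := [set h | Cb E h /\
  exists2 e, 0 < e & forall x, E x -> q x < e -> h x = 0].

Lemma CqM (h g : T -> R) : Cq h -> {within E, continuous g} -> Cq (fun x => h x * g x).
Proof.
move=> [[hc [N hN]] [e e0 he]] gc; split; last first.
  by exists e => // x Ex qx; rewrite he// mul0r.
split; first exact: within_continuousM.
have [N' N'0 gN'] := within_continuous_bounded e0 gc.
exists (`|N| * N') => x Ex; have [qx|qx] := ltP (q x) e.
  by rewrite he// mul0r normr0 mulr_ge0// ltW.
by rewrite normrM ler_pM ?gN'// (le_trans (hN x Ex))// ler_norm.
Qed.

(** The part of [h] split off by [escape] has a small integral, uniformly in
    the family. *)
Lemma tight_cvg_Cq (J : Type) (F : set_system J) (FF : Filter F) M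
    (Lam_ : J -> (T -> R) -> R) Lam :
  (forall j, tight E q M (Lam_ j)) -> tight E q M Lam ->
  (forall h, Cq h -> Lam_ j h @[j --> F] --> Lam h) ->
  forall h, Cb E h -> Lam_ j h @[j --> F] --> Lam h.
Proof.
move=> tLam_ tLam cvgLam h Ch; have [N [N0 hN]] := CbP Ch.
have M0 := tight_mass_ge0 tLam.
apply/cvgrPdist_le => eps eps0.
pose D := N * (M + 1).
have D0 : 0 < D by apply: mulr_gt0 => //; lra.
pose e := eps / 3 / D; have e0 : 0 < e by rewrite !divr_gt0.
have small Lam0 : tight E q M Lam0 -> `|Lam0 (fun x => h x * escape q e x)| <= eps / 3.
  move=> tLam0; apply: (@le_trans _ _ (Lam0 (fun x => N * escape q e x))).
    apply: (tight_norm_le tLam0).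
    - by apply: CbM => //; exact: Cb_escape.
    - by apply: CbZ; exact: Cb_escape.
    - move=> x Ex; have /andP[z0 z1] := escape_itv q e x.
      by rewrite normrM (ger0_norm z0) ler_wpM2r// hN.
  rewrite (tightZ tLam0); last exact: Cb_escape.
  apply: (@le_trans _ _ (N * (e * M))).
    rewrite ler_wpM2l//; first exact: ltW.
    apply: (tight_escape tLam0) => //; first exact: Cb_escape.
      by move=> x _; exact: escape_itv.
    by move=> x _; exact: escape_eq0.
  apply: (@le_trans _ _ (e * D)).
    rewrite mulrCA ler_wpM2l ?(ltW e0)// ler_wpM2l ?(ltW N0)//; lra.
  by rewrite /e mulfVK// gt_eqF.
have Ce : Cb E (fun x => h x * escape q e x) by apply: CbM => //; exact: Cb_escape.
have Cc : Cb E (fun x => h x * (1 - escape q e x)).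
  by apply: CbM => //; apply: CbB; [exact: Cb_cst|exact: Cb_escape].
have dec Lam0 : tight E q M Lam0 -> Lam0 h =
    Lam0 (fun x => h x * escape q e x) + Lam0 (fun x => h x * (1 - escape q e x)).
  move=> tLam0; rewrite -(tightD tLam0)//; congr Lam0; apply/funext => x; ring.
have /cvgLam/cvgrPdist_le/(_ (eps / 3)) : Cq (fun x => h x * (1 - escape q e x)).
  split => //; exists (e / 2); first by rewrite divr_gt0.
  by move=> x Ex qx; rewrite escape_eq1 ?subrr ?mulr0// ltW.
rewrite divr_gt0// => /(_ isT); apply: filterS => j.
rewrite (dec _ tLam) (dec _ (tLam_ j)); have := small _ tLam.
have := small _ (tLam_ j); rewrite !ler_norml; lra.
Qed.

End compactly_supported.

(** * The coagulation rate as a double integral *)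

Section coagulation_topology.
Context {R : realType} {T : normedModType R}.
Context (E : set T) (K : T -> T -> R) (c : R) (w W : T -> R).
Hypothesis dK : dominated_kernel E K c w W.
Let ED := dom_add dK.
Let K_ge0 := dom_ge0 dK.
Let w_gt0 := dom_gt0 dK.
Let K_le := dom_le dK.
Hypothesis w_cont : {within E, continuous w}.
Hypothesis K_cont : {within E `*` E, continuous (fun p => K p.1 p.2)}.

Local Notation q := (fun x => w x / W x).

(** Where [q < e] the weight is less than [e * W], so the bound on the moment
    of order [W] is what makes the weighted measures tight. *)
Lemma tight_state M s : state E W M s -> tight E q M (weighted w s).
Proof.
move=> sS; have [sE sW] := sS; split.
- move=> a f g _ _; rewrite /weighted -atomicZ -atomicD; congr atomic.
  by apply/funext => x; ring.
- move=> f _ f0; apply: atomic_ge0 => p ps; have [p0 Ep] := sE p ps.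
  by rewrite !mulr_ge0 ?f0// ltW// w_gt0.
- rewrite (_ : weighted _ _ _ = atomic s w); first exact: (weighted_mass dK sS).
  by congr atomic; apply/funext => x; rewrite mul1r.
- move=> e f e0 Cf f01 fe.
  apply: le_trans (weighted_escape dK sS (ltW e0)).
  apply: (atomic_le sE) => x Ex; have /andP[f0 f1] := f01 x Ex.
  case: ifPn => [/fe ->//|_]; first by rewrite mul0r.
  by rewrite ler_piMl// ltW// w_gt0.
Qed.

(** The integrand of the coagulation rate, with respect to the weighted
    measure. *)
Definition rate_kernel (f : T -> R) x y : R :=
  K x y / (w x * w y) * gain f x y.

Lemma within_continuous_comp (X Y : topologicalType) (A : set X) (B : set Y)
    (g : X -> Y) (f : Y -> R) : continuous g -> (forall x, A x -> B (g x)) ->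
  {within B, continuous f} -> {within A, continuous (fun x => f (g x))}.
Proof.
move=> gc AB /within_continuousP fc; apply/within_continuousP => x Ax.
apply: (cvg_comp g f); last exact: (fc _ (AB x Ax)).
move=> V BV; have gV : nbhs x [set y | B (g y) -> V (g y)] by exact: (gc x _ BV).
by change (nbhs x [set y | A y -> V (g y)]); apply: filterS gV => y gV /AB.
Qed.

Lemma within_continuous_gain (f : T -> R) : {within E, continuous f} ->
  {within E `*` E, continuous (fun p => gain f p.1 p.2)}.
Proof.
move=> fc.
have f1 : {within E `*` E, continuous (fun p : T * T => f p.1)}.
  apply: (within_continuous_comp (B := E) _ _ fc) => [x|x []//]; exact: cvg_fst.
have f2 : {within E `*` E, continuous (fun p : T * T => f p.2)}.
  apply: (within_continuous_comp (B := E) _ _ fc) => [x|x []//]; exact: cvg_snd.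
have f3 : {within E `*` E, continuous (fun p : T * T => f (p.1 + p.2))}.
  apply: (within_continuous_comp (B := E) _ _ fc) => [x|x [Ex Ey]]; last exact: ED.
  by apply: cvgD; [exact: cvg_fst|exact: cvg_snd].
have fN (g : T * T -> R) : {within E `*` E, continuous g} ->
    {within E `*` E, continuous (fun p : T * T => - g p)}.
  move=> gc; have : {within E `*` E, continuous (fun p : T * T => -1 * g p)}.
    by apply: within_continuousM => //; exact: within_continuous_cst.
  by apply: within_continuous_eq => p _; rewrite mulN1r.
by apply: within_continuousD; [apply: within_continuousD => //|]; exact: fN.
Qed.

(** The domination of [K] by the product of the weights makes the integrand
    bounded. *)
Lemma Cb2_rate_kernel f : Cb E f -> Cb2 E (rate_kernel f).
Proof.
move=> [fc [N fN]]; split.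
  apply: within_continuousM; last exact: within_continuous_gain.
  apply: within_continuousM => //.
  have w1 : {within E `*` E, continuous (fun p : T * T => w p.1)}.
    apply: (within_continuous_comp (B := E) _ _ w_cont) => [x|x []//]; exact: cvg_fst.
  have w2 : {within E `*` E, continuous (fun p : T * T => w p.2)}.
    apply: (within_continuous_comp (B := E) _ _ w_cont) => [x|x []//]; exact: cvg_snd.
  apply: within_continuousV; first exact: within_continuousM.
  by move=> p [Ex Ey]; rewrite mulf_neq0// gt_eqF// w_gt0.
exists (c * (3 * N)) => x y Ex Ey.
have ww : 0 < w x * w y by rewrite mulr_gt0// w_gt0.
rewrite normrM ler_pM//; last exact: (gain_le dK).
by rewrite ger0_norm ?divr_ge0 ?K_ge0// ?(ltW ww)// ler_pdivrMr// K_le.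
Qed.

Lemma coag_rate_double M s (f : T -> R) : state E W M s ->
  coag_rate K s f = 2^-1 * double (weighted w s) (rate_kernel f).
Proof.
move=> [sE _]; congr (_ * _); rewrite /double /weighted.
apply: (atomic_eq sE) => x Ex.
rewrite mulrC -atomicZ; apply: (atomic_eq sE) => y Ey.
rewrite /rate_kernel invfM; have := w_gt0 Ex; have := w_gt0 Ey => wy wx.
by field; rewrite !gt_eqF.
Qed.

Lemma atomic_weighted M s (f : T -> R) : state E W M s ->
  atomic s f = weighted w s (fun x => f x / w x).
Proof.
move=> [sE _]; apply: (atomic_eq sE) => x Ex.
by rewrite divfK// gt_eqF// w_gt0.
Qed.

End coagulation_topology.

(** * The limit of the discretization *)

Section scheme.
Context {R : realType} {T : normedModType R}.
Context (E : set T) (K : T -> T -> R) (c : R) (w W : T -> R) (M : R).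
Hypothesis dK : dominated_kernel E K c w W.
Hypothesis w_cont : {within E, continuous w}.
Hypothesis W_cont : {within E, continuous W}.
Hypothesis K_cont : {within E `*` E, continuous (fun p => K p.1 p.2)}.
Local Notation q := (fun x => w x / W x).
Hypothesis q_compact : forall e, 0 < e -> compact [set x | E x /\ e <= q x].
Context (I : Type) (U : set_system I) (UU : UltraFilter U).
Context (s_ : I -> seq (R * T)) (e_ tau_ : I -> R).
Hypothesis s_state : forall i, state E W M (s_ i).
Hypothesis e_ge0 : forall i, 0 <= e_ i.
Hypothesis tau_gt0 : forall i, 0 < tau_ i.
Hypothesis tau_small : forall i, small_step E c w W M (e_ i) (tau_ i).
Hypothesis e_cvg : e_ i @[i --> U] --> 0.
Hypothesis tau_cvg : tau_ i @[i --> U] --> 0.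

Let w_gt0 := dom_gt0 dK.

Lemma within_continuous_ratio : {within E, continuous q}.
Proof.
apply: within_continuousM => //; apply: within_continuousV => // x Ex.
by rewrite gt_eqF// (W_gt0 dK).
Qed.
Let q_cont := within_continuous_ratio.

Let st i k := coag_iter K w W (e_ i) (tau_ i) (s_ i) k.

Let st_state i k : state E W M (st i k).
Proof. exact: state_coag_iter (tau_small i) (s_state i) k. Qed.

Let Lam_ (p : I * nat) := weighted w (st p.1 p.2).

Let Lam_tight p : tight E q M (Lam_ p).
Proof. exact: (tight_state dK (st_state _ _)). Qed.

Let steps i (t : R) := Num.truncn (t / tau_ i).

Let steps_itv i t : 0 <= t -> t - tau_ i < tau_ i * (steps i t)%:R <= t.
Proof.
move=> t0; have tau0 := tau_gt0 i.
have /andP[h1 h2] : (steps i t)%:R <= t / tau_ i < (steps i t).+1%:R.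
  by apply: truncn_itv; rewrite divr_ge0// ltW.
rewrite ler_pdivlMr// in h1; rewrite ltr_pdivrMr// -natr1 mulrDl mul1r in h2.
by rewrite mulrC h1 andbT ltrBlDr.
Qed.

(** Along an ultrafilter all bounded families converge, so the limit exists for
    all times and test functions at once, without extraction of subsequences.
    *)
Definition limit_functional (t : R) (h : T -> R) : R :=
  lim (Lam_ (i, steps i t) h @[i --> U]).
Local Notation Lam := limit_functional.

Let M_ge0 : 0 <= M.
Proof.
have UT : U setT by apply: filterT.
have [i _] := filter_ex UT.
exact: (state_ge0 dK (s_state i)).
Qed.

Lemma limit_functional_cvg t h : Cb E h -> Lam_ (i, steps i t) h @[i --> U] --> Lam t h.
Proof.
move=> Ch; have [N [N0 hN]] := CbP Ch.
apply: (@ultra_bounded_cvg _ _ _ _ _ (`|N| * M)) => i.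
exact: (tight_bound (Lam_tight _) Ch hN).
Qed.

Lemma tight_limit_functional t : tight E q M (Lam t).
Proof.
have cvgL h : Cb E h -> cvg (Lam_ (i, steps i t) h @[i --> U]).
  by move=> Ch; apply/cvg_ex; exists (Lam t h); exact: limit_functional_cvg.
have le_limit h a : Cb E h -> (forall i, Lam_ (i, steps i t) h <= a) -> Lam t h <= a.
  by move=> Ch ha; apply: limr_le; [exact: cvgL|exact: nearW].
split.
- move=> a f g Cf Cg; apply: cvg_lim => //.
  rewrite (_ : (fun i => _) = fun i => a * Lam_ (i, steps i t) f + Lam_ (i, steps i t) g).
    apply: cvgD; last exact: limit_functional_cvg.
    by apply: cvgM; [exact: cvg_cst|exact: limit_functional_cvg].
  by apply/funext => i; rewrite (tight_lin (Lam_tight _)).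
- move=> f Cf f0; apply: limr_ge; first exact: cvgL.
  by apply: nearW => i; exact: (tight_ge0 (Lam_tight _)).
- apply: le_limit; first exact: Cb_cst.
  by move=> i; exact: (tight_mass (Lam_tight _)).
- move=> e f e0 Cf f01 fe; apply: le_limit => // i.
  exact: (tight_escape (Lam_tight _)).
Qed.

(** Joint convergence along [U] in the discretization and towards [t] in
    time. *)
Definition near_time (t : R) : set_system (I * nat) :=
  [set S | exists2 dl, 0 < dl &
    \forall i \near U, forall k, `|tau_ i * k%:R - t| < dl -> S (i, k)].

Instance near_time_filter t : Filter (near_time t).
Proof.
split.
- by exists 1 => //; apply: nearW.
- move=> P Q [d1 d10 P1] [d2 d20 Q2]; exists (Num.min d1 d2).
    by rewrite lt_min d10.
  near=> i => k; rewrite lt_min => /andP[k1 k2]; split.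
    by have : forall k, `|tau_ i * k%:R - t| < d1 -> P (i, k); [near: i|apply].
  by have : forall k, `|tau_ i * k%:R - t| < d2 -> Q (i, k); [near: i|apply].
- move=> P Q PQ [dl dl0 Pd]; exists dl => //; apply: filterS Pd => i Pi k kt.
  exact/PQ/Pi.
Unshelve. all: by end_near. Qed.

Let Cq_over f : Cq E q f -> Cq E q (fun x => f x / w x).
Proof.
move=> Cf; apply: CqM => //.
by apply: within_continuousV => // x Ex; rewrite gt_eqF// w_gt0.
Qed.

Let Lam_over p f : Lam_ p (fun x => f x / w x) = atomic (st p.1 p.2) f.
Proof. by rewrite (atomic_weighted dK _ (st_state _ _)). Qed.

Let rate_bound N := 2 * N * c * M ^+ 2.

Let rate_bound_ge0 N : 0 <= N -> 0 <= rate_bound N.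
Proof. by move=> N0; rewrite !mulr_ge0// ?exprn_ge0//; exact: dom_cst dK. Qed.

Let Lam_lip i k j f N : 0 <= N -> (forall x, E x -> `|f x| <= N) ->
  `|atomic (st i k) f - atomic (st i j) f| <=
    rate_bound N * `|tau_ i * k%:R - tau_ i * j%:R|.
Proof.
move=> N0 fN; rewrite -mulrBr normrM (gtr0_norm (tau_gt0 i)) mulrC.
exact: (coag_iter_lipschitz dK (tau_small i) (s_state i)).
Qed.

(** The rates of the discretizations are bounded uniformly, and the number of
    steps times their length is the elapsed time up to one step. *)
Lemma limit_functional_lip f N s t : Cq E q f -> 0 <= N ->
  (forall x, E x -> `|f x| <= N) -> 0 <= s -> 0 <= t ->
  `|Lam t (fun x => f x / w x) - Lam s (fun x => f x / w x)| <=
    rate_bound N * `|t - s|.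
Proof.
move=> Cf N0 fN s0 t0; have [Cfw _] := Cq_over Cf.
have cvgt := limit_functional_cvg (t := t) Cfw.
have cvgs := limit_functional_cvg (t := s) Cfw.
have cvgn : `|Lam_ (i, steps i t) (fun x => f x / w x) -
    Lam_ (i, steps i s) (fun x => f x / w x)| @[i --> U] -->
    `|Lam t (fun x => f x / w x) - Lam s (fun x => f x / w x)|.
  by apply: cvg_norm; exact: cvgB.
have cvgr : rate_bound N * (`|t - s| + tau_ i) @[i --> U] --> rate_bound N * `|t - s|.
  have -> : rate_bound N * `|t - s| = rate_bound N * (`|t - s| + 0) by rewrite addr0.
  apply: cvgM; first exact: cvg_cst.
  by apply: cvgD => //; exact: cvg_cst.
apply: (ler_cvg cvgn cvgr); apply: nearW => i.
rewrite !Lam_over (le_trans (Lam_lip _ _ _ N0 fN))// ler_wpM2l ?rate_bound_ge0//.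
have := steps_itv i t0; have := steps_itv i s0.
have := ler_norm (t - s); have := ler_norm (s - t); rewrite (distrC s) ler_norml.
by move=> ? ? /andP[? ?] /andP[? ?]; apply/andP; split; lra.
Qed.

(** Test functions in [Cq] change at a bounded rate, so a small error in time
    costs little; equitightness extends this to [Cb]. *)
Lemma near_time_cvg t h : 0 <= t -> Cb E h -> Lam_ p h @[p --> near_time t] --> Lam t h.
Proof.
move=> t0; apply: (tight_cvg_Cq q_cont _ Lam_tight (tight_limit_functional t)) => {}h Ch.
have [N N0 fN] : exists2 N, 0 <= N & forall x, E x -> `|h x * w x| <= N.
  have [[_ [N fN]] _] := CqM q_compact Ch w_cont.
  exists `|N| => // x Ex; exact: le_trans (fN x Ex) (ler_norm _).
pose f x := h x * w x.
have hf x : E x -> f x / w x = h x by move=> Ex; rewrite mulfK// gt_eqF// w_gt0.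
have Lf p : Lam_ p h = atomic (st p.1 p.2) f.
  by [].
apply/cvgrPdist_le => e e0.
pose L := rate_bound N + 1.
have L0 : 0 < L by rewrite ltr_wpDl// rate_bound_ge0.
have e40 : 0 < e / 4 / L by rewrite !divr_gt0.
exists (e / 4 / L) => //.
have /cvgrPdist_le/(_ (e / 2)) := limit_functional_cvg (t := t) Ch.1.
rewrite divr_gt0// => /(_ isT) near1.
have /cvgrPdist_lt/(_ _ e40) near2 := tau_cvg.
near=> i => k kt.
have c1 : `|Lam t h - Lam_ (i, steps i t) h| <= e / 2 by near: i.
have c2 : tau_ i < e / 4 / L.
  have : `|0 - tau_ i| < e / 4 / L by near: i.
  by rewrite sub0r normrN gtr0_norm.
have c3 : `|Lam_ (i, k) h - Lam_ (i, steps i t) h| <= e / 2.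
  rewrite !Lf/=; apply: le_trans (Lam_lip _ _ _ N0 fN) _.
  have /andP[s1 s2] := steps_itv i t0.
  apply: (@le_trans _ _ (L * (e / 4 / L + e / 4 / L))).
    apply: ler_pM => //; first exact: rate_bound_ge0.
      by rewrite lerDl.
    by move: kt; rewrite ltr_norml ler_norml => /andP[? ?]; apply/andP; split; lra.
  have -> // : L * (e / 4 / L + e / 4 / L) = e / 2.
  by field; rewrite gt_eqF.
rewrite (_ : _ - _ = (Lam t h - Lam_ (i, steps i t) h) -
  (Lam_ (i, k) h - Lam_ (i, steps i t) h)); last by rewrite opprB addrA subrK.
by rewrite (le_trans (ler_normB _ _))// (splitr e) lerD.
Unshelve. all: by end_near. Qed.

Definition limit_rate t f : R := 2^-1 * double (Lam t) (rate_kernel K w f).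

(** Weak convergence passes to double integrals, and the suppressed collisions
    have vanishing rate. *)
Lemma near_time_rate t f : 0 <= t -> Cb E f ->
  coag_rate (cut_kernel K w W (e_ p.1)) (st p.1 p.2) f @[p --> near_time t] -->
    limit_rate t f.
Proof.
move=> t0 Cf; have [N [N0 fN]] := CbP Cf.
have CH := Cb2_rate_kernel dK w_cont K_cont Cf.
have dbl := double_cvg q_cont q_compact (near_time_filter t) Lam_tight
  (tight_limit_functional t) (fun h Ch => near_time_cvg t0 Ch) CH.
have full : coag_rate K (st p.1 p.2) f @[p --> near_time t] --> limit_rate t f.
  rewrite (_ : (fun p => _) = fun p => 2^-1 * double (Lam_ p) (rate_kernel K w f)).
    by apply: cvgM => //; exact: cvg_cst.
  by apply/funext => p; rewrite (coag_rate_double dK _ (st_state _ _)).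
have cut : coag_rate (cut_kernel K w W (e_ p.1)) (st p.1 p.2) f -
    coag_rate K (st p.1 p.2) f @[p --> near_time t] --> (0 : R).
  apply/cvgrPdist_le => e e0; exists 1 => //.
  pose L := 3 * N * c * M ^+ 2 + 1.
  have L1 : 0 <= L - 1.
    by rewrite /L addrK !mulr_ge0 ?exprn_ge0 ?(ltW N0)//; exact: dom_cst dK.
  have L0 : 0 < L by lra.
  have eL : 0 < e / L by rewrite divr_gt0.
  have /cvgrPdist_lt/(_ _ eL) := e_cvg; apply: filterS => i ei k _ /=.
  rewrite sub0r normrN; apply: le_trans (coag_rate_cut dK (st_state _ _) (e_ge0 _) (ltW N0) fN) _.
  rewrite sub0r normrN ger0_norm// in ei.
  rewrite (_ : _ * _ = e_ i * (L - 1)); last by rewrite /L; ring.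
  apply: (@le_trans _ _ (e / L * L)); last by rewrite divfK// gt_eqF.
  by apply: ler_pM => //; [exact: ltW|rewrite gerBl].
have -> : limit_rate t f = limit_rate t f + 0 by rewrite addr0.
rewrite (_ : (fun p => _) = fun p => coag_rate K (st p.1 p.2) f +
  (coag_rate (cut_kernel K w W (e_ p.1)) (st p.1 p.2) f -
   coag_rate K (st p.1 p.2) f)); first by apply: cvgD.
by apply/funext => p /=; rewrite addrC subrK.
Qed.

(** Close to time [t] all the rates of the discretizations are within [e] of
    the limit rate at [t], hence so are their increments per unit of time, and
    the bound survives the limit. *)
Lemma limit_functional_right_derivative t f e : 0 <= t -> Cq E q f -> 0 < e ->
  exists2 dl, 0 < dl & forall h, 0 <= h < dl ->
    `|Lam (t + h) (fun x => f x / w x) - Lam t (fun x => f x / w x) -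
      h * limit_rate t f| <= e * h.
Proof.
move=> t0 Cf e0; have [Cfw _] := Cq_over Cf.
have /cvgrPdist_le/(_ e e0)[dl dl0 near_rate] := near_time_rate t0 Cf.1.
exists (dl / 2); first by rewrite divr_gt0.
move=> h /andP[h0 hdl].
have th0 : 0 <= t + h by rewrite addr_ge0.
set b := limit_rate t f in near_rate *.
have cvg1 := limit_functional_cvg (t := t + h) Cfw.
have cvg2 := limit_functional_cvg (t := t) Cfw.
pose incr i := Lam_ (i, steps i (t + h)) (fun x => f x / w x) -
  Lam_ (i, steps i t) (fun x => f x / w x) - h * b.
have cvgn : `|incr i| @[i --> U] --> `|Lam (t + h) (fun x => f x / w x) -
    Lam t (fun x => f x / w x) - h * b|.
  apply: cvg_norm; apply: cvgB; last exact: cvg_cst.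
  by apply: cvgB; [exact: cvg1|exact: cvg2].
have cvgr : e * h + tau_ i * (e + `|b|) @[i --> U] --> e * h.
  rewrite [X in _ --> X](_ : _ = e * h + 0 * (e + `|b|)); last by rewrite mul0r addr0.
  by apply: cvgD; [exact: cvg_cst|apply: cvgM => //; exact: cvg_cst].
apply: (ler_cvg cvgn cvgr).
have dl20 : 0 < dl / 2 by rewrite divr_gt0.
have /cvgrPdist_lt/(_ _ dl20) near_tau := tau_cvg.
near=> i.
have tau_dl : tau_ i < dl / 2.
  have : `|0 - tau_ i| < dl / 2 by near: i.
  by rewrite sub0r normrN gtr0_norm.
have rate k : `|tau_ i * k%:R - t| < dl ->
    `|coag_rate (cut_kernel K w W (e_ i)) (st i k) f - b| <= e.
  have : forall k, `|tau_ i * k%:R - t| < dl ->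
    `|b - coag_rate (cut_kernel K w W (e_ i)) (st i k) f| <= e by near: i.
  by move=> H /H; rewrite distrC.
have /andP[s1 s2] := steps_itv i t0; have /andP[s3 s4] := steps_itv i th0.
have tau0 := tau_gt0 i.
have jk : (steps i t <= steps i (t + h))%N.
  by apply: le_truncn; rewrite ler_pM2r ?invr_gt0// lerDl.
have := coag_iter_increment dK (tau_small i) (s_state i) (f := f) (a := e) (b := b) jk.
rewrite -/(st i _) -/(st i _) => incr_le.
have {}incr_le : `|atomic (st i (steps i (t + h))) f - atomic (st i (steps i t)) f -
    tau_ i * (steps i (t + h) - steps i t)%:R * b| <=
    tau_ i * (steps i (t + h) - steps i t)%:R * e.
  apply: incr_le => k /andP[jk1 jk2]; apply: rate.
  have k1 : tau_ i * (steps i t)%:R <= tau_ i * k%:R by rewrite ler_pM2l// ler_nat.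
  have k2 : tau_ i * k%:R <= tau_ i * (steps i (t + h))%:R.
    by rewrite ler_pM2l// ler_nat ltnW.
  by rewrite ltr_norml; apply/andP; split; lra.
have hB : `|tau_ i * (steps i (t + h))%:R - tau_ i * (steps i t)%:R - h| <= tau_ i.
  move: s1 s2 s3 s4; set B1 := tau_ i * _; set B2 := tau_ i * _; rewrite ler_norml.
  by move=> ? ? ? ?; apply/andP; split; lra.
rewrite /incr !Lam_over /=; move: hB incr_le; rewrite natrB// mulrBr.
set A := atomic _ _ - atomic _ _; set B1 := tau_ i * _; set B2 := tau_ i * _.
move=> hB incr_le.
rewrite (_ : A - h * b = (A - (B1 - B2) * b) + (B1 - B2 - h) * b); last by ring.
rewrite (le_trans (ler_normD _ _))// mulrDr addrA lerD//.
  apply: le_trans incr_le _; rewrite mulrC (mulrC (tau_ i)) -mulrDr ler_wpM2l ?(ltW e0)//.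
  by move: hB; rewrite ler_norml => /andP[_]; lra.
by rewrite normrM ler_wpM2r.
Unshelve. all: by end_near. Qed.

(** The discretization conserves additive quantities; the cutoff [h] discards
    the part that the limit may lose at infinity. *)
Lemma limit_functional_additive t (h f : T -> R) (a : R) : Cq E q h ->
  (forall x, E x -> 0 <= h x <= 1) -> {within E, continuous f} ->
  (forall x y, f (x + y) = f x + f y) -> (forall x, E x -> 0 <= f x) ->
  atomic (s_ i) f @[i --> U] --> a -> Lam t (fun x => h x * f x / w x) <= a.
Proof.
move=> Ch h01 fc fD f0 cvga.
have [Chfw _] := Cq_over (CqM q_compact Ch fc).
have cvgt := limit_functional_cvg (t := t) Chfw.
apply: (ler_cvg cvgt cvga); apply: nearW => i; rewrite Lam_over/=.
rewrite -(atomic_coag_iter_additive dK (tau_small i) (s_state i) (steps i t) fD).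
have [sE _] := st_state i (steps i t); apply: (atomic_le sE) => x Ex.
by have /andP[? ?] := h01 x Ex; rewrite ler_piMl// f0.
Qed.

Lemma limit_functional_initial h a : Cb E h -> weighted w (s_ i) h @[i --> U] --> a ->
  Lam 0 h = a.
Proof.
move=> Ch cvga; apply: cvg_lim => //.
rewrite (_ : (fun i => _) = fun i => weighted w (s_ i) h)//.
by apply/funext => i; rewrite /steps mul0r truncn0.
Qed.

End scheme.

(** * Discretizing the initial measure *)

Section existence.
Context {R : realType} {d : nat}.
Local Notation T := 'rV[R]_d.
Local Notation B := (borelRV R d).
Context (E : set T) (K : T -> T -> R) (c : R) (w W : T -> R).
Hypothesis dK : dominated_kernel E K c w W.
Hypothesis w_cont : {within E, continuous w}.
Hypothesis W_cont : {within E, continuous W}.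
Hypothesis K_cont : {within E `*` E, continuous (fun p => K p.1 p.2)}.
Local Notation q := (fun x => w x / W x).
Hypothesis q_compact : forall e, 0 < e -> compact [set x | E x /\ e <= q x].
Hypothesis mE : measurable (E : set B).
Context (f0 : {measure set B -> \bar R}).
Hypothesis W_int : f0.-integrable (E : set B) (EFin \o W).

Local Notation M := (\int[f0]_(x in E) W x)%R.

Let w_gt0 := dom_gt0 dK.
Let q_cont := within_continuous_ratio dK w_cont W_cont.

Let good (h : T -> R) := measurable_fun (E : set B) h /\
  exists N : R, forall x, E x -> `|h x| <= N.

Let M_ge0 : 0 <= M.
Proof. by apply: Rintegral_ge0 => x Ex; rewrite ltW// (W_gt0 dK). Qed.

(** The points approximate the measure [W f0], which is finite; dividing the
    masses by [W] then approximates [f0] against functions of size [W]. *)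
Let initial_state (L : seq (T -> R)) n : exists s : seq (R * T),
  state E W M s /\ forall h : T -> R, h \in L -> good h ->
    `|atomic s (fun x => h x * W x) - (\int[f0]_(x in E) (h x * W x))%R| <=
      n.+1%:R^-1 * M.
Proof.
have n0 : 0 < n.+1%:R^-1 :> R by rewrite invr_gt0.
have [] := @atomic_approx_ex R _ B f0 E W mE _ W_int _
    [seq h <- L | `[< good h >]] n0 _ E mE (@subset_refl _ E).
- by move=> x Ex; rewrite ltW// (W_gt0 dK).
- by move=> h; rewrite mem_filter => /andP[/asboolP].
move=> s [sE sW sh].
have atomicE g : atomic [seq (p.1 / W p.2, p.2) | p <- s] g = atomic s (fun x => g x / W x).
  by rewrite /atomic big_map; apply: eq_bigr => p _; rewrite mulrAC mulrA.
have W0 x : E x -> W x != 0 by move=> Ex; rewrite gt_eqF// (W_gt0 dK).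
exists [seq (p.1 / W p.2, p.2) | p <- s]; split.
  split.
    move=> p /mapP[r rs ->]/=; have [r0 Er] := sE r rs; split => //.
    by rewrite divr_ge0// ltW// (W_gt0 dK).
  rewrite atomicE le_eqVlt -sW; apply/orP; left; apply/eqP.
  by apply: (atomic_eq sE) => x Ex; rewrite divff// W0.
move=> h hL gh; rewrite atomicE (atomic_eq sE (g := h)); last first.
  by move=> x Ex; rewrite mulfK// W0.
by apply: sh; rewrite /= mem_filter hL andbT; apply/asboolP.
Qed.

Let initial_step n : exists tau : R, [/\ 0 < tau, tau <= n.+1%:R^-1 &
  small_step E c w W M n.+1%:R^-1 tau].
Proof.
have n0 : 0 < n.+1%:R^-1 :> R by rewrite invr_gt0.
have [S S0 wS] := within_continuous_bounded q_compact n0 w_cont.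
have c0 := dom_cst dK.
have D1 : 0 < 1 + c * S * M by rewrite ltr_wpDr// !mulr_ge0// ltW.
exists (n.+1%:R^-1 / (1 + c * S * M)); split.
- exact: divr_gt0.
- by rewrite ler_pdivrMr// ler_peMr ?(ltW n0)// lerDl !mulr_ge0// ltW.
split; first by rewrite divr_ge0// ltW.
move=> x Ex qx; rewrite mulrAC ler_pdivrMr// mul1r.
apply: (@le_trans _ _ (1 * (c * S * M))); last by rewrite mul1r lerDr.
rewrite ler_pM// ?(ltW n0)//.
- by rewrite !mulr_ge0// ltW// w_gt0.
- by rewrite invf_le1// ler1n.
- rewrite ler_wpM2r// ler_wpM2l//; apply: le_trans (wS x Ex qx); exact: ler_norm.
Qed.

(** The discretizations are indexed by a finite list of test functions and a
    precision, and the ultrafilter refines the filter of increasing lists and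
    precisions: every test function is eventually in the list, so the initial
    data converge on all of them. *)
Theorem coagulation_functional : exists Lam : R -> (T -> R) -> R,
  [/\ forall t, tight E q M (Lam t),
      forall h, Cb E h -> Lam 0 h = (\int[f0]_(x in E) (h x * w x))%R,
      forall f N s t, Cq E q f -> 0 <= N -> (forall x, E x -> `|f x| <= N) ->
        0 <= s -> 0 <= t ->
        `|Lam t (fun x => f x / w x) - Lam s (fun x => f x / w x)| <=
          2 * N * c * M ^+ 2 * `|t - s|,
      forall t f e, 0 <= t -> Cq E q f -> 0 < e ->
        exists2 dl, 0 < dl & forall h, 0 <= h < dl ->
          `|Lam (t + h) (fun x => f x / w x) - Lam t (fun x => f x / w x) -
            h * (2^-1 * double (Lam t) (rate_kernel K w f))| <= e * h &
      forall t (h f : T -> R), Cq E q h -> (forall x, E x -> 0 <= h x <= 1) ->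
        {within E, continuous f} -> (forall x y, f (x + y) = f x + f y) ->
        (forall x, E x -> 0 <= f x <= W x) ->
        Lam t (fun x => h x * f x / w x) <= (\int[f0]_(x in E) f x)%R].
Proof.
pose I := (seq (T -> R) * nat)%type.
have /choice[s_ s_P] : forall i : I, exists s, state E W M s /\
    forall h : T -> R, h \in i.1 -> good h ->
      `|atomic s (fun x => h x * W x) - (\int[f0]_(x in E) (h x * W x))%R| <=
        i.2.+1%:R^-1 * M by move=> [L n]; exact: initial_state.
have /choice[tau_ tau_P] := initial_step.
pose F : set_system I := filter_from [set: I]
  (fun i => [set j : I | {subset i.1 <= j.1} /\ (i.2 <= j.2)%N]).
have FF : ProperFilter F.
  apply: filter_from_proper; last by move=> i _; exists i; split.
  apply: filter_from_filter; first by exists ([::], 0%N).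
  move=> [L1 n1] [L2 n2] _ _; exists (L1 ++ L2, maxn n1 n2) => //.
  move=> [L n] /= [LL]; rewrite geq_max => /andP[n1n n2n].
  by split; split => // h hL; apply: LL; rewrite mem_cat hL ?orbT.
have [U [UU FU]] := ultraFilterLemma FF.
have near_n n : \forall i \near U, (n <= i.2)%N.
  by apply: FU; exists ([::], n) => // i [].
have near_h (h : T -> R) : \forall i \near U, h \in i.1.
  by apply: FU; exists ([:: h], 0%N) => // i [+ _]; apply; rewrite mem_head.
have e_cvg : (i.2.+1%:R^-1 : R) @[i --> U] --> (0 : R).
  apply/cvgrPdist_lt => e e0.
  have [n _ ne] : \forall n \near \oo, n.+1%:R^-1 < e.
    exact: (near_infty_natSinv_lt (PosNum e0)).
  apply: filterS (near_n n) => i ni; rewrite sub0r normrN gtr0_norm ?invr_gt0//.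
  exact: ne.
have tau_cvg : tau_ i.2 @[i --> U] --> (0 : R).
  apply/cvgrPdist_lt => e e0; have /cvgrPdist_lt/(_ e e0) := e_cvg.
  apply: filterS => i; rewrite !sub0r !normrN; have [t0 te _] := tau_P i.2.
  by rewrite !gtr0_norm ?invr_gt0//; exact: le_lt_trans.
have good_cvg (h : T -> R) : good h ->
    atomic (s_ i) (fun x => h x * W x) @[i --> U] --> (\int[f0]_(x in E) (h x * W x))%R.
  move=> gh; apply/cvgrPdist_le => e e0.
  have eM : 0 < e / (M + 1) by rewrite divr_gt0// ltr_wpDl.
  have /cvgrPdist_lt/(_ _ eM) near_e := e_cvg.
  near=> i; rewrite distrC.
  have hi : h \in i.1 by near: i; exact: near_h.
  apply: le_trans ((s_P i).2 h hi gh) _.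
  have : `|0 - i.2.+1%:R^-1| < e / (M + 1) by near: i.
  rewrite sub0r normrN gtr0_norm ?invr_gt0// => ie.
  apply: (@le_trans _ _ (e / (M + 1) * (M + 1))); last first.
    by rewrite divfK// gt_eqF// ltr_wpDl.
  by rewrite ler_pM// ?lerDl// ?(ltW ie)// invr_ge0.
exists (limit_functional K w W U s_ (fun i => i.2.+1%:R^-1) (fun i => tau_ i.2)).
have sS i := (s_P i).1.
have tau_gt0 i : 0 < tau_ (i : I).2 by have [] := tau_P i.2.
have tau_small i : small_step E c w W M (i : I).2.+1%:R^-1 (tau_ i.2).
  by have [] := tau_P i.2.
have e_ge0 i : 0 <= (i : I).2.+1%:R^-1 :> R by rewrite invr_ge0.
split.
- by move=> t; apply: (tight_limit_functional dK).
- move=> h Ch; apply: (limit_functional_initial (E := E)) => //.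
  have gq : good (fun x => h x * (w x / W x)).
    split.
      apply: measurable_within_continuous => //.
      exact: within_continuousM Ch.1 q_cont.
    have [N [N0 hN]] := CbP Ch; exists N => x Ex.
    rewrite normrM -[leRHS]mulr1 ler_pM// ?hN//.
    have W0 := W_gt0 dK Ex; have w0 := w_gt0 Ex.
    by rewrite ger0_norm ?divr_ge0 ?(ltW W0) ?(ltW w0)// ler_pdivrMr// mul1r; exact: (dom_weight dK Ex).
  have := good_cvg _ gq.
  rewrite (_ : (\int[f0]_(x in E) (h x * (w x / W x) * W x))%R =
    (\int[f0]_(x in E) (h x * w x))%R); last first.
    apply: eq_Rintegral => x /set_mem Ex.
    by rewrite -mulrA divfK// gt_eqF// (W_gt0 dK).
  apply: cvg_trans; apply: near_eq_cvg; apply: nearW => i.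
  rewrite /weighted; apply: (atomic_eq (sS i).1) => x Ex.
  by rewrite -mulrA divfK// gt_eqF// (W_gt0 dK).
- by move=> f N s t Cf N0 fN s0 t0; apply: (limit_functional_lip dK).
- by move=> t f e t0 Cf e0; apply: (limit_functional_right_derivative dK).
- move=> t h f Ch h01 fc fD fW.
  apply: (limit_functional_additive dK) => //.
    by move=> x Ex; have /andP[] := fW x Ex.
  have gq : good (fun x => f x / W x).
    split.
      apply: measurable_within_continuous => //.
      apply: within_continuousM => //; apply: within_continuousV => // x Ex.
      by rewrite gt_eqF// (W_gt0 dK).
    exists 1 => x Ex; have /andP[fx0 fxW] := fW x Ex; have W0 := W_gt0 dK Ex.
    by rewrite ger0_norm ?divr_ge0 ?(ltW W0)// ler_pdivrMr// mul1r.
  have := good_cvg _ gq.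
  rewrite (_ : (\int[f0]_(x in E) (f x / W x * W x))%R = (\int[f0]_(x in E) f x)%R).
    apply: cvg_trans; apply: near_eq_cvg; apply: nearW => i.
    apply: (atomic_eq (sS i).1) => x Ex.
    by rewrite divfK// gt_eqF// (W_gt0 dK).
  apply: eq_Rintegral => x /set_mem Ex.
  by rewrite divfK// gt_eqF// (W_gt0 dK).
Unshelve. all: by end_near. Qed.

End existence.

(** * Differentiable functions of time *)

Section halfline.
Context {R : realType}.
Implicit Types (g dg : R -> R).

Lemma C1_halfline_quotient g dg (s : R) : C1_halfline g dg -> 0 <= s ->
  n.+1%:R * (g (s + n.+1%:R^-1) - g s) @[n --> \oo] --> dg s.
Proof.
move=> [_ gd] s0.
have c_cvg : n.+1%:R^-1 @[n --> \oo] --> within [set h : R | 0 <= s + h] (0 : R)^'.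
  move=> A [e /= e0 eA]; suff : \forall n \near \oo, A n.+1%:R^-1 by [].
  near=> n; have n0 : n.+1%:R^-1 != 0 :> R by rewrite invr_eq0 pnatr_eq0.
  apply: eA => //; last by rewrite /= addr_ge0// invr_ge0.
  rewrite /ball_/= sub0r normrN ger0_norm ?invr_ge0//.
  by near: n; exact: (near_infty_natSinv_lt (PosNum e0)).
apply: cvg_trans; last exact: (cvg_comp _ _ c_cvg (gd s s0)).
by apply: near_eq_cvg; apply: nearW => n /=; rewrite invrK.
Unshelve. all: by end_near. Qed.

Lemma C1_halfline_derive g dg (s : R) : C1_halfline g dg -> 0 < s -> is_derive s 1 g (dg s).
Proof.
move=> [_ gd] s0.
have gs : h^-1 *: (g (h *: 1 + s) - g s) @[h --> 0^'] --> dg s.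
  apply: cvg_trans (gd s (ltW s0)); move=> A; rewrite /within/= => sA.
  have : \forall h \near (0 : R)^', 0 <= s + h.
    near=> h; have : `|h| < s by near: h; exact: dnbhs0_lt.
    by rewrite ltr_norml => /andP[? ?]; lra.
  move=> near0; change (\forall h \near (0 : R)^', A (h^-1 *: (g (h *: 1 + s) - g s))).
  apply: filterS2 near0 sA => h h0 sA; rewrite /GRing.scale/= mulr1 (addrC h).
  exact: sA.
apply: DeriveDef; last exact: cvg_lim gs.
by apply/cvg_ex; exists (dg s).
Unshelve. all: by end_near. Qed.

Lemma C1_halfline_continuous g dg : C1_halfline g dg ->
  {within `[0, +oo[, continuous g}.
Proof.
move=> gdg; apply/within_continuousP => s; rewrite /= in_itv/= andbT.
rewrite le_eqVlt => /predU1P[<-{s}|s0]; last first.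
  apply: cvg_within_filter; apply: differentiable_continuous.
  by apply/derivable1_diffP; have [] := C1_halfline_derive gdg s0.
have [_ gd] := gdg; apply/cvgrPdist_lt => e e0; rewrite near_withinE.
have /cvgrPdist_lt/(_ 1 ltr01) := gd 0 (lexx _).
rewrite near_withinE => near_q.
have {}near_q : \forall h \near (0 : R), h != 0 -> 0 <= 0 + h ->
  `|dg 0 - h^-1 * (g (0 + h) - g 0)| < 1 by exact: near_q.
pose L := `|dg 0| + 1.
have L0 : 0 < L by rewrite ltr_wpDl.
near=> h; rewrite /= in_itv/= andbT le_eqVlt => /predU1P[<-|h0].
  by rewrite subrr normr0.
have he : h < e / L.
  have : `|0 - h| < e / L by near: h; apply: cvgr_dist_lt => //; rewrite divr_gt0.
  by rewrite sub0r normrN gtr0_norm.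
have : h != 0 -> 0 <= 0 + h -> `|dg 0 - h^-1 * (g (0 + h) - g 0)| < 1 by near: h.
rewrite gt_eqF// add0r => /(_ isT (ltW h0)) hq.
have hL : `|h^-1 * (g h - g 0)| < L.
  rewrite /L; move: hq; rewrite distrC => hq.
  have := ler_normD (h^-1 * (g h - g 0) - dg 0) (dg 0).
  by rewrite subrK; lra.
rewrite distrC; apply: (@lt_trans _ _ (h * L)).
  move: hL; rewrite normrM gtr0_norm ?invr_gt0// ltr_pdivrMl//.
by rewrite -ltr_pdivlMr.
Unshelve. all: by end_near. Qed.

(** The mean value theorem; the one-sided derivative at [0] enters only through
    continuity. *)
Lemma C1_halfline_lip g dg N t : C1_halfline g dg ->
  (forall s, 0 <= s <= t -> `|dg s| <= N) ->
  forall s s', 0 <= s <= t -> 0 <= s' <= t -> `|g s' - g s| <= N * `|s' - s|.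
Proof.
move=> gdg dgN.
have main s s' : 0 <= s -> s < s' -> s' <= t -> `|g s' - g s| <= N * `|s' - s|.
  move=> s0 ss' s't.
  have [||x xss' ->] := @MVT _ g dg s s' ss'.
  - move=> x; rewrite in_itv/= => /andP[sx _].
    by apply: C1_halfline_derive gdg _; exact: le_lt_trans sx.
  - apply: continuous_subspaceW (C1_halfline_continuous gdg) => x.
    by rewrite /= !in_itv/= andbT => /andP[sx _]; exact: le_trans sx.
  - rewrite normrM ler_wpM2r//; apply: dgN.
    by move: xss'; rewrite in_itv/= => /andP[? ?]; apply/andP; split; lra.
move=> s s' /andP[s0 st] /andP[s'0 s't].
have [ss'|ss'|->] := ltgtP s s'; first exact: main.
  by rewrite distrC (distrC s'); exact: main.
by rewrite !subrr normr0 mulr0.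
Qed.

End halfline.

(** * Measures with tight weighted versions *)

Section represented.
Context {R : realType} {d : nat}.
Local Notation T := 'rV[R]_d.
Local Notation B := (borelRV R d).
Context (E : set T) (q w : T -> R) (M : R).
Hypothesis mE : measurable (E : set B).
Hypothesis q_cont : {within E, continuous q}.
Hypothesis q_gt0 : forall x, E x -> 0 < q x.
Hypothesis q_compact : forall e, 0 < e -> compact [set x | E x /\ e <= q x].
Hypothesis w_cont : {within E, continuous w}.
Hypothesis w_gt0 : forall x, E x -> 0 < w x.

Lemma Cq_div f : Cq E q f -> Cq E q (fun x => f x / w x).
Proof.
move=> Cf; apply: (CqM q_compact) => //.
by apply: within_continuousV => // x Ex; rewrite gt_eqF// w_gt0.
Qed.

Lemma compact_positive_bounded (h : T -> R) C : compact C -> C `<=` E ->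
  {within E, continuous h} -> (forall x, E x -> 0 < h x) ->
  exists2 k : R, 0 < k & forall x, C x -> (h x)^-1 <= k.
Proof.
move=> cC CE hc h0.
have : compact ((fun x => (h x)^-1) @` C).
  apply: continuous_compact => //; apply: continuous_subspaceW CE _.
  by apply: within_continuousV => // x /h0; rewrite lt0r => /andP[].
move=> /compact_bounded[N [_ NP]]; exists (`|N| + 1); first by rewrite ltr_wpDl.
move=> x Cx; apply: le_trans (ler_norm _) (NP (`|N| + 1) _ _ _); last by exists x.
by rewrite (le_lt_trans (ler_norm _))// ltrDl.
Qed.

(** On the compact support [q] is bounded below by a positive constant. *)
Lemma compact_support_Cq (f : T -> R) C : compact C -> C `<=` E ->
  {within E, continuous f} -> (forall x, E x -> ~ C x -> f x = 0) -> Cq E q f.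
Proof.
move=> cC CE fc fC.
have [k k0 qk] := compact_positive_bounded cC CE q_cont q_gt0.
have k0' : 0 < k^-1 by rewrite invr_gt0.
have f0 x : E x -> q x < k^-1 -> f x = 0.
  move=> Ex qx; apply: fC => // /qk; rewrite leNgt => /negP; apply.
  by rewrite -(invrK k) ltf_pV2// posrE q_gt0.
split; last by exists k^-1.
split => //; have [N N0 fN] := within_continuous_bounded q_compact k0' fc.
exists N => x Ex; have [qx|qx] := ltP (q x) k^-1; last exact: fN.
by rewrite f0// normr0 ltW.
Qed.

Context (f : {measure set B -> \bar R}) (Lam : (T -> R) -> R).
Hypothesis tLam : tight E q M Lam.
Hypothesis fLam : represents E w f Lam.

Lemma represents_integrable h : Cb E h ->
  f.-integrable (E : set B) (EFin \o (fun x => h x * w x)).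
Proof.
move=> Ch; apply/integrableP; split.
  apply/measurable_EFinP; apply: measurable_within_continuous => //.
  by apply: within_continuousM => //; exact: Ch.1.
rewrite (eq_integral (fun x : B => (`|h x| * w x)%:E)).
  by rewrite fLam.2 ?ltry//; exact: Cb_norm.
by move=> x /set_mem Ex; rewrite /= normrM (gtr0_norm (w_gt0 Ex)).
Qed.

Lemma represents_Cq g : Cq E q g ->
  (\int[f]_(x in E) (g x)%:E = (Lam (fun x => (g x / w x)%R))%:E)%E.
Proof.
move=> Cg; rewrite -fLam.2; last by have [] := Cq_div Cg.
by apply: eq_integral => x /set_mem Ex; rewrite divfK// gt_eqF// w_gt0.
Qed.

Lemma represents_compact C : compact C -> C `<=` E -> (f C < +oo)%E.
Proof.
move=> cC CE; have [k k0 wk] := compact_positive_bounded cC CE w_cont w_gt0.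
have mC : measurable (C : set B) by exact: measurable_compact.
have -> : f C = (\int[f]_(x in E) (\1_(C : set B) x)%:E)%E.
  by rewrite integral_indic// setIidl.
have Ck : Cb E (fun=> k) by exact: Cb_cst.
apply: (@le_lt_trans _ _ (\int[f]_(x in E) (k * w x)%:E)%E); last by rewrite fLam.2 ?ltry.
apply: ge0_le_integral => //.
- by apply/measurable_EFinP; exact: measurable_indic.
- by have /integrableP[] := represents_integrable Ck.
- move=> x Ex; rewrite lee_fin indicE; have w0 := w_gt0 Ex.
  have [/set_mem Cx|_] := boolP (x \in _); last by rewrite mulr_ge0// ltW.
  by have := wk x Cx; rewrite -ler_pdivrMr// div1r.
Qed.

(** Each of the two integrations carries a factor [w], and the two factors
    cancel the denominator of [rate_kernel]. *)
Lemma represents_double (K : T -> T -> R) g : Cb2 E (rate_kernel K w g) ->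
  (\int[f]_(x in E) \int[f]_(y in E) (K x y * gain g x y)%:E =
    (double Lam (rate_kernel K w g))%:E)%E.
Proof.
move=> CH; rewrite -fLam.2; last exact: (Cb_inner q_cont q_compact tLam CH).
apply: eq_integral => x /set_mem Ex; have wx := w_gt0 Ex.
have Cx := Cb2_slice CH Ex.
rewrite mulrC -(tightZ tLam)// -fLam.2; last exact: CbZ.
apply: eq_integral => y /set_mem Ey; have wy := w_gt0 Ey.
by congr (_%:E); rewrite /rate_kernel; field; rewrite !gt_eqF.
Qed.

End represented.

Section uniform_limits.
Context {R : realType} {T : topologicalType} (E : set T).

Lemma Cb_uniform_limit (f : T -> R) :
  (forall e, 0 < e -> exists2 g, Cb E g & forall x, E x -> `|f x - g x| <= e) ->
  Cb E f.
Proof.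
move=> fg; split; last first.
  have [g [_ [N gN]] fg1] := fg 1 ltr01; exists (1 + N) => x Ex.
  by rewrite -(subrK (g x) (f x)) (le_trans (ler_normD _ _))// lerD ?fg1 ?gN.
apply/within_continuousP => x Ex; apply/cvgrPdist_lt => e e0.
have e30 : 0 < e / 3 by rewrite divr_gt0.
have [g [gc _] fge] := fg _ e30.
have := within_continuous_near gc Ex e30.
rewrite near_withinE; apply: filterS => y /[swap] Ey /(_ Ey).
have := fge x Ex; have := fge y Ey; rewrite !ler_norml !ltr_norml; lra.
Qed.

End uniform_limits.

Section time_continuity.
Context {R : realType} {T : topologicalType}.
Context (E : set T) (q w : T -> R) (M L : R).
Hypothesis q_cont : {within E, continuous q}.
Hypothesis q_compact : forall e, 0 < e -> compact [set x | E x /\ e <= q x].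
Hypothesis w_cont : {within E, continuous w}.
Hypothesis w_gt0 : forall x, E x -> 0 < w x.
Context (Lam : R -> (T -> R) -> R).
Hypothesis tLam : forall t, tight E q M (Lam t).
Hypothesis Lam_lip : forall f (N s t : R), Cq E q f -> 0 <= N ->
  (forall x, E x -> `|f x| <= N) -> 0 <= s -> 0 <= t ->
  `|Lam t (fun x => f x / w x) - Lam s (fun x => f x / w x)| <=
    2 * N * L * M ^+ 2 * `|t - s|.

(** The Lipschitz estimate gives continuity on [Cq], and tightness extends it
    to [Cb]. *)
Lemma tight_family_continuous (h : T -> R) (t : R) : Cb E h -> 0 <= t ->
  Lam s h @[s --> within `[0, +oo[ (nbhs t)] --> Lam t h.
Proof.
move=> + t0; move: h; apply: (tight_cvg_Cq q_cont _ tLam (tLam t)) => h Ch.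
have Chw := CqM q_compact Ch w_cont.
have [[_ [N hN]] _] := Chw.
have Lh s : Lam s (fun x => h x * w x / w x) = Lam s h.
  apply: esym; apply: (tight_eq (tLam s) Ch.1) => x Ex.
  by rewrite mulfK// gt_eqF// w_gt0.
pose A := `|2 * `|N| * L * M ^+ 2| + 1.
have A0 : 0 < A by rewrite ltr_wpDl.
apply/cvgrPdist_le => e e0; rewrite near_withinE.
near=> s; rewrite /= in_itv/= andbT => s0.
rewrite -!Lh; apply: le_trans (Lam_lip Chw (normr_ge0 N) _ s0 t0) _.
  by move=> x Ex; exact: le_trans (hN x Ex) (ler_norm _).
apply: (@le_trans _ _ (A * `|t - s|)).
  by rewrite ler_wpM2r// (le_trans (ler_norm _))// lerDl.
rewrite mulrC -ler_pdivlMr//; apply: ltW.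
by near: s; apply: cvgr_dist_lt => //; rewrite divr_gt0.
Unshelve. all: by end_near. Qed.

End time_continuity.

(** * The weak formulation *)

Section weak_formulation.
Context {R : realType} {d : nat}.
Local Notation T := 'rV[R]_d.
Local Notation B := (borelRV R d).
Local Notation E := (@Rstar R d).
Context (K : T -> T -> R) (c : R) (w W : T -> R) (M : R).
Hypothesis dK : dominated_kernel E K c w W.
Hypothesis w_cont : {within E, continuous w}.
Hypothesis W_cont : {within E, continuous W}.
Hypothesis K_cont : {within E `*` E, continuous (fun p => K p.1 p.2)}.
Local Notation q := (fun x => w x / W x).
Hypothesis q_compact : forall e, 0 < e -> compact [set x | E x /\ e <= q x].
Hypothesis mE : measurable (E : set B).
Context (Lam : R -> (T -> R) -> R).
Hypothesis tLam : forall t, tight E q M (Lam t).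
Hypothesis Lam_lip : forall f (N s t : R), Cq E q f -> 0 <= N ->
  (forall x, E x -> `|f x| <= N) -> 0 <= s -> 0 <= t ->
  `|Lam t (fun x => f x / w x) - Lam s (fun x => f x / w x)| <=
    2 * N * c * M ^+ 2 * `|t - s|.
Hypothesis Lam_derivative : forall (t : R) f e, 0 <= t -> Cq E q f -> 0 < e ->
  exists2 dl, 0 < dl & forall h, 0 <= h < dl ->
    `|Lam (t + h) (fun x => f x / w x) - Lam t (fun x => f x / w x) -
      h * (2^-1 * double (Lam t) (rate_kernel K w f))| <= e * h.
Context (f : R -> {measure set B -> \bar R}).
Hypothesis fLam : forall t, 0 <= t -> represents E w (f t) (Lam t).

Let w_gt0 := dom_gt0 dK.
Let q_cont := within_continuous_ratio dK w_cont W_cont.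
Let q_gt0 x : E x -> 0 < q x.
Proof. by move=> Ex; rewrite divr_gt0// ?w_gt0// (W_gt0 dK). Qed.
Let M_ge0 : 0 <= M := tight_mass_ge0 (tLam 0).
Let c_ge0 : 0 <= c := dom_cst dK.

Section test.
Context (phi dphi : T -> R -> R) (t : R).
Hypothesis t_ge0 : 0 <= t.
Hypothesis phi_C1 : forall x, E x -> C1_halfline (phi x) (dphi x).
Hypothesis phi_cont : forall s, 0 <= s -> {within E, continuous (phi ^~ s)}.
Context (C : set T) (N1 : R).
Hypothesis cC : compact C.
Hypothesis CE : C `<=` E.
Hypothesis phi_supp : forall x s, E x -> ~ C x -> 0 <= s <= t + 1 -> phi x s = 0.
Hypothesis N1_ge0 : 0 <= N1.
Hypothesis dphi_le : forall x (s : R), E x -> 0 <= s <= t + 1 -> `|dphi x s| <= N1.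

Let phi_Cq (s : R) : 0 <= s <= t + 1 -> Cq E q (phi ^~ s).
Proof.
move=> st; apply: (compact_support_Cq q_cont q_gt0 q_compact cC CE).
  by apply: phi_cont; case/andP: st.
by move=> x Ex nCx; exact: phi_supp.
Qed.

Let phi_lip x (s s' : R) : E x -> 0 <= s <= t + 1 -> 0 <= s' <= t + 1 ->
  `|phi x s' - phi x s| <= N1 * `|s' - s|.
Proof.
move=> Ex; apply: (C1_halfline_lip (phi_C1 Ex)) => u ut.
exact: dphi_le.
Qed.

Let increment (s s' : R) : 0 <= s <= t + 1 -> 0 <= s' <= t + 1 ->
  Cq E q (fun x => phi x s' - phi x s).
Proof.
move=> st s't; apply: (compact_support_Cq q_cont q_gt0 q_compact cC CE).
  have : Cb E (fun x => phi x s' - phi x s).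
    by apply: CbB; [exact: (phi_Cq s't).1|exact: (phi_Cq st).1].
  by case.
by move=> x Ex nCx; rewrite !phi_supp// subrr.
Qed.

Let phi_bounded : exists2 N : R, 0 <= N &
  forall x (s : R), E x -> 0 <= s <= t + 1 -> `|phi x s| <= N.
Proof.
have t0 : 0 <= (0 : R) <= t + 1 by rewrite lexx addr_ge0.
have [N [N0 phiN]] := CbP (phi_Cq t0).1.
exists (N + N1 * (t + 1)); first by apply: addr_ge0; [exact: ltW|rewrite mulr_ge0// addr_ge0].
move=> x s Ex st; rewrite -(subrK (phi x 0) (phi x s)).
rewrite (le_trans (ler_normD _ _))// addrC lerD ?phiN//.
apply: le_trans (phi_lip Ex t0 st) _; rewrite ler_wpM2l//.
by move: st => /andP[? ?]; rewrite subr0 ger0_norm.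
Qed.

Let G (s : R) : R := Lam s (fun x => phi x s / w x).

Let GE (s : R) : 0 <= s <= t + 1 -> (\int[f s]_(x in E) (phi x s)%:E = (G s)%:E)%E.
Proof.
move=> st; apply: (represents_Cq q_compact w_cont w_gt0 (fLam _)) => //.
  by case/andP: st.
exact: phi_Cq.
Qed.

Let over f0 : Cq E q f0 -> Cb E (fun x => f0 x / w x).
Proof. by move=> Cf; have [] := Cq_div q_compact w_cont w_gt0 Cf. Qed.

Let G_lip : exists L : R, forall s s', 0 <= s <= t + 1 -> 0 <= s' <= t + 1 ->
  `|G s - G s'| <= L * `|s - s'|.
Proof.
have [N N0 phiN] := phi_bounded.
have [k k0 wk] := compact_positive_bounded cC CE w_cont w_gt0.
exists (k * N1 * M + 2 * N * c * M ^+ 2) => s' s s't st.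
have Ci := increment st s't.
have -> : G s' - G s = Lam s' (fun x => (phi x s' - phi x s) / w x) +
    (Lam s' (fun x => phi x s / w x) - Lam s (fun x => phi x s / w x)).
  rewrite (_ : (fun x => _) = fun x => phi x s' / w x - phi x s / w x); last first.
    by apply/funext => x; rewrite mulrBl.
  by rewrite (tightB (tLam s'))//; [rewrite /G; ring|exact/over/phi_Cq|exact/over/phi_Cq].
rewrite (le_trans (ler_normD _ _))// [leRHS]mulrDl lerD//.
  have := @tight_bound _ _ _ _ M (Lam s') (fun x => (phi x s' - phi x s) / w x)
    (k * (N1 * `|s' - s|)) (tLam s') (over Ci).
  have kN : 0 <= k * (N1 * `|s' - s|) by rewrite !mulr_ge0// ltW.
  rewrite (ger0_norm kN) => bnd.
  rewrite [leRHS](_ : _ = k * (N1 * `|s' - s|) * M); last by ring.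
  apply: bnd => x Ex; have [Cx|nCx] := pselect (C x); last first.
    by rewrite !phi_supp// subrr mul0r normr0 !mulr_ge0// ltW.
  have w0 := w_gt0 Ex; rewrite normrM mulrC ler_pM//; last exact: phi_lip.
  by rewrite gtr0_norm ?invr_gt0// wk.
apply: Lam_lip => //; first exact: phi_Cq.
- by move=> x Ex; exact: phiN.
- by case/andP: st.
- by case/andP: s't.
Qed.

Let P (s : R) : R := fine (\int[f s]_(x in E) (dphi x s)%:E)%E.
Let Q (s : R) : R := 2^-1 * double (Lam s) (rate_kernel K w (phi ^~ s)).

Let steps (s : R) : 0 <= s <= t ->
  forall n, 0 <= s + n.+1%:R^-1 <= t + 1.
Proof.
move=> /andP[s0 st] n; have h0 : 0 <= n.+1%:R^-1 :> R by rewrite invr_ge0.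
by rewrite addr_ge0//= lerD// invf_le1// ler1n.
Qed.

Let sub_itv (s : R) : 0 <= s <= t -> 0 <= s <= t + 1.
Proof. by move=> /andP[-> st] /=; rewrite (le_trans st)// lerDl. Qed.

(** The measure at time [s] does not depend on the step, and the difference
    quotients of the test function are bounded with support in [C]. *)
Let time_quotient (s : R) : 0 <= s <= t ->
  (\int[f s]_(x in E) (dphi x s)%:E = (P s)%:E)%E /\
  n.+1%:R * Lam s (fun x => (phi x (s + n.+1%:R^-1) - phi x s) / w x)
    @[n --> \oo] --> P s.
Proof.
move=> st; have s0 : 0 <= s by case/andP: st.
pose dq n x := n.+1%:R * (phi x (s + n.+1%:R^-1) - phi x s).
have Cdq n : Cq E q (dq n).
  have Ci := increment (sub_itv st) (steps st n).
  have [_ [e e0 ie]] := Ci; split; first exact: CbZ Ci.1.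
  by exists e => // x Ex qx; rewrite /dq ie// mulr0.
have mdq n : measurable_fun (E : set B) (dq n).
  by apply: measurable_within_continuous => //; have [[]] := Cdq n.
have dq_cvg x : E x -> dq n x @[n --> \oo] --> dphi x s.
  by move=> Ex; exact: C1_halfline_quotient (phi_C1 Ex) s0.
have mdphi : measurable_fun (E : set B) (fun x => dphi x s).
  by apply: (@measurable_fun_cvg _ B R E (dq : nat -> B -> R)) => //.
have mC : measurable (C : set B) by exact: measurable_compact.
pose g (x : B) : R := N1 * \1_(C : set B) x.
have mg : measurable_fun (E : set B) g.
  by apply: measurable_funM => //; exact: measurable_indic.
have ig : (f s).-integrable (E : set B) (EFin \o g).
  apply/integrableP; split; first exact/measurable_EFinP.
  rewrite (eq_integral (fun x => (N1 * \1_(C : set B) x)%:E)); last first.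
    by move=> x _; rewrite /= ger0_norm// mulr_ge0.
  rewrite (@integralZl_indic _ B R (f s) E mE (fun=> C))//; last first.
    by move=> N1n; have := le_lt_trans N1_ge0 N1n; rewrite ltxx.
  rewrite integral_indic// setIidl// lte_mul_pinfty// ?lee_fin//.
  exact: (represents_compact mE w_cont w_gt0 (fLam s0)).
have [|||||idphi _ cvg_int] := @dominated_convergence _ B R (f s) E mE
    (fun n => EFin \o dq n) (fun x => (dphi x s)%:E) (EFin \o g).
- by move=> n; apply/measurable_EFinP.
- exact/measurable_EFinP.
- apply: aeW => x Ex; apply: cvg_EFin; first exact: nearW.
  exact: dq_cvg.
- exact: ig.
- apply: aeW => x n Ex; rewrite /= lee_fin /dq /g indicE.
  have [Cx|nCx] := boolP (x \in _); last first.
    have nC : ~ C x by move=> Cx; move/negP: nCx; apply; rewrite inE.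
    rewrite (phi_supp Ex nC (sub_itv st)) (phi_supp Ex nC (steps st n)).
    by rewrite subrr mulr0 normr0 mulr0.
  rewrite mulr1 normrM ger0_norm// mulrC -ler_pdivlMr//.
  have := phi_lip Ex (sub_itv st) (steps st n).
  have n1 : 0 <= n.+1%:R^-1 :> R by rewrite invr_ge0.
  by rewrite (addrC s) addrK (ger0_norm n1).
have PE : (\int[f s]_(x in E) (dphi x s)%:E = (P s)%:E)%E.
  by rewrite /P fineK//; exact: integrable_fin_num.
split => //.
have : (\int[f s]_(x in E) (dq n x)%:E)%E @[n --> \oo] --> (P s)%:E by rewrite -PE.
move=> /fine_cvg; apply: cvg_trans; apply: near_eq_cvg; apply: nearW => n /=.
rewrite (represents_Cq q_compact w_cont w_gt0 (fLam s0))//= -(tightZ (tLam s)).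
  by congr (Lam s _); apply/funext => x; rewrite /dq mulrA.
exact/over/(increment (sub_itv st) (steps st n)).
Qed.

(** The right derivative of the functional along a fixed test function. *)
Let rate_quotient (s : R) : 0 <= s <= t ->
  n.+1%:R * (Lam (s + n.+1%:R^-1) (fun x => phi x s / w x) -
    Lam s (fun x => phi x s / w x)) @[n --> \oo] --> Q s.
Proof.
move=> st; have s0 : 0 <= s by case/andP: st.
apply/cvgrPdist_le => e e0.
have [dl dl0 der] := Lam_derivative s0 (phi_Cq (sub_itv st)) e0.
near=> n; have n0 : 0 < n.+1%:R^-1 :> R by rewrite invr_gt0.
have ndl : n.+1%:R^-1 < dl by near: n; exact: (near_infty_natSinv_lt (PosNum dl0)).
have := der n.+1%:R^-1; rewrite (ltW n0) ndl => /(_ isT).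
set A := Lam _ _ - Lam _ _; rewrite -/(Q s) => AQ.
rewrite distrC (_ : _ - _ = n.+1%:R * (A - n.+1%:R^-1 * Q s)); last first.
  by rewrite [RHS]mulrBr mulVKf// pnatr_eq0.
by rewrite normrM ger0_norm// mulrC -ler_pdivlMr.
Unshelve. all: by end_near. Qed.

(** A change of the test function of order of the step, times a change of the
    measure of the same order. *)
Let cross_quotient (s : R) : 0 <= s <= t ->
  n.+1%:R * (Lam (s + n.+1%:R^-1) (fun x => (phi x (s + n.+1%:R^-1) - phi x s) / w x) -
    Lam s (fun x => (phi x (s + n.+1%:R^-1) - phi x s) / w x)) @[n --> \oo] --> (0 : R).
Proof.
move=> st; have s0 : 0 <= s by case/andP: st.
pose A := 2 * N1 * c * M ^+ 2 + 1.
have A1 : 0 <= A - 1 by rewrite /A addrK !mulr_ge0 ?exprn_ge0.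
have A0 : 0 < A by lra.
apply/cvgrPdist_le => e e0; have eA : 0 < e / A by rewrite divr_gt0.
near=> n; have n0 : 0 < n.+1%:R^-1 :> R by rewrite invr_gt0.
have ne : n.+1%:R^-1 < e / A by near: n; exact: (near_infty_natSinv_lt (PosNum eA)).
rewrite sub0r normrN normrM ger0_norm// mulrC -ler_pdivlMr//.
have n1 : 0 <= N1 * n.+1%:R^-1 by rewrite mulr_ge0// ltW.
have sn0 : 0 <= s + n.+1%:R^-1 by rewrite addr_ge0// ltW.
apply: le_trans (Lam_lip (increment (sub_itv st) (steps st n)) n1 _ s0 sn0) _.
  move=> x Ex; apply: le_trans (phi_lip Ex (sub_itv st) (steps st n)) _.
  by rewrite (addrC s) addrK gtr0_norm.
rewrite (addrC s) addrK gtr0_norm// ler_wpM2r ?(ltW n0)//.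
rewrite [leLHS](_ : _ = n.+1%:R^-1 * (A - 1)); last by rewrite /A; ring.
apply: (@le_trans _ _ (e / A * A)); last by rewrite divfK// gt_eqF.
by apply: ler_pM => //; first [exact: ltW|rewrite gerBl ler01].
Unshelve. all: by end_near. Qed.

(** The product rule: the increment of the pairing is the sum of the increments
    in the test function, in the measure, and in both. *)
Let G_quotient (s : R) : 0 <= s <= t ->
  n.+1%:R * (G (s + n.+1%:R^-1) - G s) @[n --> \oo] --> P s + Q s.
Proof.
move=> st.
rewrite -[P s]addr0.
suff -> : (fun n => n.+1%:R * (G (s + n.+1%:R^-1) - G s)) = (fun n =>
    (n.+1%:R * Lam s (fun x => (phi x (s + n.+1%:R^-1) - phi x s) / w x) +
    n.+1%:R * (Lam (s + n.+1%:R^-1) (fun x => (phi x (s + n.+1%:R^-1) - phi x s) / w x) -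
      Lam s (fun x => (phi x (s + n.+1%:R^-1) - phi x s) / w x))) +
    n.+1%:R * (Lam (s + n.+1%:R^-1) (fun x => phi x s / w x) -
      Lam s (fun x => phi x s / w x))).
  apply: cvgD; last exact: rate_quotient.
  by apply: cvgD; [have [] := time_quotient st|exact: cross_quotient].
apply/funext => n.
have Cs : Cb E (fun x => phi x s / w x) by exact/over/phi_Cq/sub_itv.
have Csn : Cb E (fun x => phi x (s + n.+1%:R^-1) / w x) by exact/over/phi_Cq/steps.
have split_incr u : Lam u (fun x => (phi x (s + n.+1%:R^-1) - phi x s) / w x) =
    Lam u (fun x => phi x (s + n.+1%:R^-1) / w x) - Lam u (fun x => phi x s / w x).
  by rewrite -(tightB (tLam u))//; congr (Lam u _); apply/funext => x; rewrite mulrBl.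
by rewrite !split_incr /G; ring.
Qed.

(** The limit rate is continuous in the measure by [double_cvg] and Lipschitz
    in the test function. *)
Let Q_continuous : {within `[0, t], continuous Q}.
Proof.
apply/within_continuousP => s; rewrite /= in_itv/= => st.
have s0 : 0 <= s by case/andP: st.
apply: cvgM; first exact: cvg_cst.
have CH u : 0 <= u <= t -> Cb2 E (rate_kernel K w (phi ^~ u)).
  move=> ut; apply: (Cb2_rate_kernel dK w_cont K_cont).
  by have [] := phi_Cq (sub_itv ut).
have conv : double (Lam u) (rate_kernel K w (phi ^~ s)) @[u --> within `[0, t] (nbhs s)]
    --> double (Lam s) (rate_kernel K w (phi ^~ s)).
  apply: (double_cvg q_cont q_compact _ tLam (tLam s)); last exact: CH.
  move=> h Ch; have := tight_family_continuous q_cont q_compact w_cont w_gt0 tLam Lam_lip Ch s0.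
  apply: cvg_trans; apply: cvg_app => A; rewrite /within/=.
  apply: (@filterS _ (nbhs s) _) => u Au; rewrite /= in_itv/= => /andP[u0 _].
  by apply: Au; rewrite /= in_itv/= u0.
pose A := c * (3 * N1) * M ^+ 2 + 1.
have A1 : 0 <= A - 1 by rewrite /A addrK !mulr_ge0 ?exprn_ge0.
have A0 : 0 < A by lra.
apply/cvgrPdist_le => e e0.
have e20 : 0 < e / 2 by rewrite divr_gt0.
have /cvgrPdist_le/(_ _ e20) := conv; rewrite !near_withinE => near1.
near=> u => ut.
have h1 : `|double (Lam s) (rate_kernel K w (phi ^~ s)) -
   double (Lam u) (rate_kernel K w (phi ^~ s))| <= e / 2.
  by move: ut; near: u.
move: ut; rewrite /= in_itv/= => ut.
have su : `|s - u| < e / 2 / A by near: u; apply: cvgr_dist_lt => //; rewrite divr_gt0.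
have h2 : `|double (Lam u) (rate_kernel K w (phi ^~ s)) -
   double (Lam u) (rate_kernel K w (phi ^~ u))| <= e / 2.
  rewrite -(doubleB q_cont q_compact (tLam u))//; try exact: CH.
  apply: le_trans (double_bound q_cont q_compact (tLam u) (N := c * (3 * (N1 * `|s - u|))) _ _) _.
  - by apply: Cb2B; exact: CH.
  - move=> x y Ex Ey; rewrite /rate_kernel -mulrBr normrM.
    have ww : 0 < w x * w y by rewrite mulr_gt0// w_gt0.
    apply: ler_pM => //.
      by rewrite ger0_norm ?divr_ge0 ?(dom_ge0 dK)// ?(ltW ww)// ler_pdivrMr// (dom_le dK).
    rewrite (_ : _ - _ = gain (fun x => phi x s - phi x u) x y); last by rewrite /gain; ring.
    apply: (gain_le dK) => // z Ez; apply: phi_lip => //; exact: sub_itv.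
  rewrite ger0_norm ?mulr_ge0// [leLHS](_ : _ = (A - 1) * `|s - u|); last by rewrite /A; ring.
  apply: (@le_trans _ _ (A * (e / 2 / A))); last by rewrite mulrC divfK// gt_eqF.
  by apply: ler_pM => //; first [exact: ltW|rewrite gerBl ler01].
rewrite -(subrK (double (Lam u) (rate_kernel K w (phi ^~ s))) (double (Lam s) _)).
by rewrite -addrA (le_trans (ler_normD _ _))// (splitr e) lerD.
Unshelve. all: by end_near. Qed.

(** The pairing [G] of the measure with the test function is Lipschitz in time
    and has a right derivative everywhere, hence it is the integral of this
    derivative. The two terms may be integrated separately because the second
    one is continuous. *)
Lemma test_weak_formulation :
  (\int[f t]_(x in E) (phi x t)%:E - \int[f 0%R]_(x in E) (phi x 0%R)%:E
    = \int[lebesgue_measure]_(s in `[0%R, t])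
        \int[f s]_(x in E) (dphi x s)%:E
      + (2^-1)%:E * \int[lebesgue_measure]_(s in `[0%R, t])
        \int[f s]_(x in E) \int[f s]_(y in E)
          (K x y * (phi (x + y) s - phi x s - phi y s))%:E)%E.
Proof.
have t0 : 0 <= (0 : R) <= t + 1 by rewrite lexx addr_ge0.
have tt : 0 <= t <= t + 1 by rewrite t_ge0 lerDl ler01.
rewrite (GE t0) (GE tt) -EFinB.
have [L GL] := G_lip.
have [iPQ <-] := integral_everywhere_derivative t_ge0 GL G_quotient.
have m0t : measurable (`[0%R, t]%classic : set (measurableTypeR R)) by exact: measurable_itv.
have iQ : lebesgue_measure.-integrable `[0%R, t] (EFin \o Q).
  by apply: continuous_compact_integrable => //; exact: segment_compact.
have iD : lebesgue_measure.-integrable `[0%R, t]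
    (EFin \o (fun s => double (Lam s) (rate_kernel K w (phi ^~ s)))).
  have := integrableZl m0t 2 iQ; apply: eq_integrable => // s _ /=.
  by rewrite /Q -EFinM mulrA divff ?mul1r.
have iP : lebesgue_measure.-integrable `[0%R, t] (EFin \o P).
  have := integrableB m0t iPQ iQ; apply: eq_integrable => // s _ /=.
  by rewrite -EFinB addrK.
transitivity (\int[lebesgue_measure]_(s in `[0%R, t]) (P s)%:E +
    \int[lebesgue_measure]_(s in `[0%R, t]) (Q s)%:E)%E.
  by rewrite -integralD_EFin//.
congr (_ + _)%E.
  apply: eq_integral => s /set_mem; rewrite /= in_itv/= => st.
  by rewrite (time_quotient st).1.
rewrite (eq_integral (fun s : measurableTypeR R => (2^-1)%:E *
    (double (Lam s) (rate_kernel K w (phi ^~ s)))%:E)%E); last first.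
  by move=> s _; rewrite /Q EFinM.
rewrite integralZl//; congr (_ * _)%E.
apply: eq_integral => s /set_mem; rewrite /= in_itv/= => st.
have s0 : 0 <= s by case/andP: st.
have CH : Cb2 E (rate_kernel K w (phi ^~ s)).
  apply: (Cb2_rate_kernel dK w_cont K_cont).
  by have [] := phi_Cq (sub_itv st).
have := represents_double q_cont q_compact w_gt0 (tLam s) (fLam s0) CH.
by move=> <-.
Qed.

End test.
End weak_formulation.

(** * The weights of the kernel *)

Section power.
Context {R : realType}.
Implicit Types (s u a : R).

Lemma powR_base_continuous a s : 0 < s -> {for s, continuous (fun u => u `^ a)}.
Proof.
move=> s0; apply: differentiable_continuous; apply/derivable1_diffP.
by have [] := is_derive1_powR a s0.
Qed.

Lemma powR_decreasing a s u : a <= 0 -> 0 < s -> s <= u -> u `^ a <= s `^ a.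
Proof.
move=> a0 s0 su; have u0 := lt_le_trans s0 su.
rewrite -[a]opprK !(powRN _ (- a)) lef_pV2 ?posrE ?powR_gt0//.
by apply: ge0_ler_powR; rewrite ?oppr_ge0 ?nnegrE ?(ltW s0) ?(ltW u0).
Qed.

(** Writing [x `^ a = x * x `^ (a - 1)], the second factor is nonincreasing. *)
Lemma powR_subadditive a s u : a <= 1 -> 0 < s -> 0 < u ->
  (s + u) `^ a <= s `^ a + u `^ a.
Proof.
move=> a1 s0 u0.
have powE (x : R) : 0 < x -> x `^ a = x * x `^ (a - 1).
  move=> x0; rewrite -[X in X * _](powRr1 (ltW x0)) -powRD.
    by congr (_ `^ _); ring.
  by rewrite (gt_eqF x0) implybT.
rewrite !powE ?addr_gt0// mulrDl.
by rewrite lerD// ler_pM2l// powR_decreasing ?subr_le0// (lerDl, lerDr) ltW.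
Qed.

End power.

Section norm1.
Context {R : realType} {d : nat}.
Implicit Types x y : 'rV[R]_d.
Local Notation E := (@Rstar R d).

Lemma norm1_continuous : continuous (@norm1 R d).
Proof.
apply: continuous_big => [|j _ x]; first exact: add_continuous.
apply: (@continuous_comp _ _ _ (fun x : 'rV[R]_d => x ord0 j) (fun u : R => `|u|)).
  exact: coord_continuous.
exact: norm_continuous.
Qed.

Lemma norm1_ge0 x : 0 <= norm1 x.
Proof. exact: sumr_ge0. Qed.

Lemma norm1_gt0 x : E x -> 0 < norm1 x.
Proof.
move=> [x_ge0 x_neq0]; rewrite lt_neqAle norm1_ge0 andbT eq_sym.
apply/eqP => /eqP; rewrite psumr_eq0// => /allP x0; apply: x_neq0.
apply/funext => i; apply/funext => j; rewrite (ord1 i); apply/eqP; rewrite -normr_eq0.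
by apply: x0; rewrite mem_index_enum.
Qed.

Lemma norm1D x y : E x -> E y -> norm1 (x + y) = norm1 x + norm1 y.
Proof.
move=> [x_ge0 _] [y_ge0 _]; rewrite -big_split; apply: eq_bigr => j _ /=.
by rewrite mxE !ger0_norm ?addr_ge0.
Qed.

Lemma Rstar_add x y : E x -> E y -> E (x + y).
Proof.
move=> Ex Ey; split=> [j|xy0]; first by rewrite mxE addr_ge0//; [have [] := Ex|have [] := Ey].
have := norm1D Ex Ey; rewrite {1}/norm1 xy0 big1; last by move=> j _; rewrite normr0.
by apply/eqP; rewrite lt_eqF// addr_gt0// norm1_gt0.
Qed.

Lemma coord_le_norm1 x j : E x -> 0 <= x ord0 j <= norm1 x.
Proof.
move=> [x_ge0 _]; rewrite x_ge0/= /norm1 (bigD1 j)//= (le_trans (ler_norm _))//.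
by rewrite lerDl sumr_ge0.
Qed.

Lemma closed_orthant : closed [set x : 'rV[R]_d | forall j, 0 <= x ord0 j].
Proof.
rewrite (_ : mkset _ = \bigcap_j [set x : 'rV[R]_d | 0 <= x ord0 j]); last first.
  by apply/seteqP; split=> x /= x0 j; [move=> _; exact: x0|exact: x0].
apply: closed_bigI => j _.
apply: (@closed_comp _ _ (fun x : 'rV[R]_d => x ord0 j) [set u | 0 <= u]).
  by move=> x _; exact: coord_continuous.
exact: closed_ge.
Qed.

Lemma compact_norm1 (A : set 'rV[R]_d) (D : R) : closed A ->
  (forall x, A x -> norm1 x <= D) -> compact A.
Proof.
move=> clA AD; apply: bounded_closed_compact => //.
exists (Num.max 0 D); split; first exact: num_real.
move=> N; rewrite gt_max => /andP[N0 DN] x Ax /=.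
rewrite [leLHS](_ : _ = mx_norm x)// mx_normrE; apply: bigmax_le; first exact: ltW.
move=> [i j] _ /=; rewrite (ord1 i).
apply: (le_trans _ (ltW DN)); apply: le_trans (AD x Ax).
by rewrite /norm1 (bigD1 j)//= lerDl sumr_ge0.
Qed.

End norm1.

Section mass_weights.
Context {R : realType}.
Context (a b r : R).
Hypothesis a_lt1 : a < 1.
Hypothesis b_lt1 : b < 1.
Hypothesis r_gt0 : 0 < r.
Implicit Types s u : R.

(** Weight and moment as functions of the total mass [s = |x|]. *)
Definition mass_weight s : R := if s <= 1 then s `^ a else s `^ b.
Definition mass_moment s : R := s `^ (a - r) + s.

Lemma mass_weight_gt0 s : 0 < s -> 0 < mass_weight s.
Proof. by move=> s0; rewrite /mass_weight; case: ifP => _; rewrite powR_gt0. Qed.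

Lemma mass_moment_gt0 s : 0 < s -> 0 < mass_moment s.
Proof. by move=> s0; rewrite addr_gt0// powR_gt0. Qed.

Lemma mass_weight_continuous s : 0 < s -> {for s, continuous mass_weight}.
Proof.
move=> s0.
(* Both branches equal 1 at [s = 1], so they can be glued multiplicatively. *)
have -> : mass_weight = fun s => (Num.min s 1) `^ a * (Num.max s 1) `^ b.
  apply/funext => u; rewrite /mass_weight; case: (leP u 1) => u1.
    by rewrite powR1 mulr1.
  by rewrite powR1 mul1r.
have minc : {for s, continuous (fun u : R => Num.min u 1)}.
  by apply: continuous_min; [exact: cvg_id|exact: cvg_cst].
have maxc : {for s, continuous (fun u : R => Num.max u 1)}.
  by apply: continuous_max; [exact: cvg_id|exact: cvg_cst].
apply: cvgM.
  apply: (continuous_comp (f := fun u : R => Num.min u 1) (g := fun u => u `^ a)) => //.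
  by apply: powR_base_continuous; rewrite lt_min s0 ltr01.
apply: (continuous_comp (f := fun u : R => Num.max u 1) (g := fun u => u `^ b)) => //.
by apply: powR_base_continuous; rewrite lt_max s0.
Qed.

Lemma mass_moment_continuous s : 0 < s -> {for s, continuous mass_moment}.
Proof. by move=> s0; apply: cvgD; [exact: powR_base_continuous|exact: cvg_id]. Qed.

Lemma mass_weight_le_moment s : 0 < s -> mass_weight s <= mass_moment s.
Proof.
move=> s0; rewrite /mass_weight /mass_moment; case: (leP s 1) => s1.
  apply: (@le_trans _ _ (s `^ (a - r))); last by rewrite lerDl ltW.
  by apply: ger_powR; [rewrite s0 s1|rewrite lerBlDr lerDl ltW].
by rewrite (le_trans (ler1_powR (ltW s1) (ltW b_lt1)))// lerDr powR_ge0.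
Qed.

Lemma mass_moment_subadditive s u : 0 < s -> 0 < u ->
  mass_moment (s + u) <= mass_moment s + mass_moment u.
Proof.
move=> s0 u0; rewrite /mass_moment addrACA lerD2r powR_subadditive//.
by rewrite lerBlDr; apply: ltW; rewrite (lt_le_trans a_lt1)// lerDl ltW.
Qed.

(** The quotient of the weights is at most [s `^ r] near [0] and at most
    [s `^ (b - 1)] near infinity. *)
Lemma weight_ratio_support (e : R) : 0 < e -> exists2 dl, 0 < dl &
  exists D, forall s, 0 < s -> e <= mass_weight s / mass_moment s -> dl <= s <= D.
Proof.
move=> e0; have b1 : 0 < 1 - b by rewrite subr_gt0.
have cancelP (k p s : R) : 0 < p -> 0 <= s -> 0 <= k -> k <= s `^ p -> k `^ p^-1 <= s.
  move=> p0 s0 k0 ks; rewrite -[leRHS](@powRr1 _ s)// -(mulfV (lt0r_neq0 p0)) powRrM.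
  by apply: ge0_ler_powR; rewrite ?invr_ge0 ?nnegrE ?powR_ge0 ?(ltW p0).
have cancelP' (k p s : R) : 0 < p -> 0 <= s -> s `^ p <= k -> s <= k `^ p^-1.
  move=> p0 s0 sk; rewrite -[leLHS](@powRr1 _ s)// -(mulfV (lt0r_neq0 p0)) powRrM.
  apply: ge0_ler_powR; rewrite ?invr_ge0 ?nnegrE ?powR_ge0 ?(ltW p0)//.
  exact: le_trans (powR_ge0 _ _) sk.
have powM (k p s : R) : 0 < s -> s `^ k * s `^ p = s `^ (k + p).
  by move=> s0; rewrite powRD// (gt_eqF s0) implybT.
have dl0 : 0 < e `^ r^-1 by rewrite powR_gt0.
exists (Num.min 1 (e `^ r^-1)); first by rewrite lt_min ltr01.
exists (Num.max 1 (e^-1 `^ (1 - b)^-1)) => s s0.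
rewrite ler_pdivlMr ?mass_moment_gt0// /mass_weight /mass_moment => es.
rewrite ge_min le_max; have [s1|s1] := leP s 1.
  rewrite cancelP ?orbT ?(ltW s0) ?(ltW e0)//.
  have : e * s `^ (a - r) <= s `^ r * s `^ (a - r).
    move: es; rewrite s1 powM// (addrC r) subrK; apply: le_trans.
    by rewrite ler_pM2l// lerDl ltW.
  by rewrite ler_pM2r// powR_gt0.
rewrite (ltW s1) orTb/=.
have sb : s `^ b * s `^ (1 - b) = s.
  by rewrite powM// addrC subrK powRr1// ltW.
have : e * s `^ (1 - b) <= 1.
  have : e * s <= s `^ b.
    move: es; rewrite (leNgt s 1) s1/=; apply: le_trans.
    by rewrite ler_pM2l// lerDr powR_ge0.
  by rewrite -{1}sb mulrCA ger_pMr// powR_gt0.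
move=> se; apply: cancelP' => //; first exact: ltW.
by rewrite -[leRHS]mul1r ler_pdivlMr// mulrC.
Qed.

End mass_weights.

Section kernel_weights.
Context {R : realType} {d : nat} (beta : R) (gamma lambda : R * R) (r : R).
Local Notation T := 'rV[R]_d.
Local Notation B := (borelRV R d).
Local Notation E := (@Rstar R d).
Hypothesis exponents1 : - lambda.1 <= gamma.1 + lambda.1 /\ gamma.1 + lambda.1 < 1.
Hypothesis exponents2 : - lambda.2 <= gamma.2 + lambda.2 /\ gamma.2 + lambda.2 < 1.
Hypothesis r_gt0 : 0 < r.
Local Notation a := (Num.min (- beta) (- lambda.1)).
Local Notation b := (Num.max (gamma.1 + lambda.1) (gamma.2 + lambda.2)).
Local Notation w := (@omega R d beta gamma lambda).
Local Notation W := (fun x : T => mass_moment a r (norm1 x)).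

Lemma low_exponent_lt1 : a < 1.
Proof. by case: exponents1 => le1 lt1; rewrite gt_min (le_lt_trans le1 lt1) orbT. Qed.

Lemma high_exponent_lt1 : b < 1.
Proof. by rewrite gt_max exponents1.2 exponents2.2. Qed.

Lemma measurable_Rstar : measurable (E : set B).
Proof.
have -> : E = [set x : T | forall j, 0 <= x ord0 j] `&` ~` [set 0].
  apply/seteqP; split=> x [x0 xn0]; split=> // x_0; apply: xn0.
    by rewrite /= x_0; apply/funext => i; apply/funext => j; rewrite mxE.
  by apply/matrixP => i j; rewrite x_0 mxE.
apply: measurableI; first by apply: measurable_closed; exact: closed_orthant.
apply: measurableC; apply: measurable_closed; apply: accessible_closed_set1.
exact: hausdorff_accessible (@norm_hausdorff _ _).
Qed.

Lemma within_continuous_mass (g : R -> R) :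
  (forall s, 0 < s -> {for s, continuous g}) ->
  {within E, continuous (fun x => g (norm1 x))}.
Proof.
move=> gc; apply/within_continuousP => x Ex.
apply: cvg_within_filter.
apply: (@continuous_comp _ _ _ (@norm1 R d) g); first exact: norm1_continuous.
exact: gc (norm1_gt0 Ex).
Qed.

Lemma omega_continuous : {within E, continuous w}.
Proof. exact: within_continuous_mass (@mass_weight_continuous R a b). Qed.

Lemma moment_continuous : {within E, continuous W}.
Proof. exact: within_continuous_mass (@mass_moment_continuous R a r). Qed.

(** The extra power [r] in the moment controls the particles close to [0], and
    the moment of order 1 > b controls the large ones. *)
Lemma compact_weight_ratio (e : R) : 0 < e -> compact [set x | E x /\ e <= w x / W x].
Proof.
move=> e0.
have [dl dl0 [D DP]] := weight_ratio_support a high_exponent_lt1 r_gt0 e0.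
apply: (@compact_norm1 _ _ _ D); last first.
  by move=> x [Ex /(DP _ (norm1_gt0 Ex))/andP[]].
(* On the set the mass is at least [dl], so the quotient may be replaced by a
   function that is continuous on the whole space. *)
pose g (x : T) := mass_weight a b (Num.max dl (norm1 x)) /
  mass_moment a r (Num.max dl (norm1 x)).
have -> : [set x | E x /\ e <= w x / W x] =
    [set x : T | forall j, 0 <= x ord0 j] `&` [set x : T | dl <= norm1 x] `&`
    [set x : T | e <= g x].
  apply/seteqP; split=> x /=.
    move=> [Ex ex]; have /andP[dlx _] := DP _ (norm1_gt0 Ex) ex.
    split; first by split; first exact: Ex.1.
    by rewrite /g (max_r dlx).
  move=> [[x0 dlx]]; rewrite /g (max_r dlx) => ex; split => //; split=> // xz.
  move: dlx; rewrite /norm1 xz big1; first by rewrite leNgt dl0.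
  by move=> j _; rewrite normr0.
have gc : continuous g.
  move=> x; have m0 : 0 < Num.max dl (norm1 x) by rewrite lt_max dl0.
  have mc : {for x, continuous (fun x => Num.max dl (norm1 x))}.
    by apply: (@continuous_max _ _ (fun=> dl) (@norm1 R d));
      [exact: cst_continuous|exact: norm1_continuous].
  have wc : mass_weight a b (Num.max dl (norm1 y)) @[y --> x] -->
      mass_weight a b (Num.max dl (norm1 x)).
    exact: (@continuous_comp _ _ _ _ (mass_weight a b) _ mc (mass_weight_continuous m0)).
  have Wc : mass_moment a r (Num.max dl (norm1 y)) @[y --> x] -->
      mass_moment a r (Num.max dl (norm1 x)).
    exact: (@continuous_comp _ _ _ _ (mass_moment a r) _ mc (mass_moment_continuous m0)).
  apply: (@cvgM _ _ (nbhs x) _ _ _ _ _ wc); apply: cvgV => //.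
  by rewrite gt_eqF// mass_moment_gt0.
apply: closedI; first (apply: closedI; first exact: closed_orthant).
  apply: (@closed_comp _ _ (@norm1 R d) [set u | dl <= u]); last exact: closed_ge.
  by move=> x _; exact: norm1_continuous.
apply: (@closed_comp _ _ g [set u | e <= u]); last exact: closed_ge.
by move=> x _; exact: gc.
Qed.

Context (K : T -> T -> R) (c2 : R).
Hypothesis K_ge0 : forall x y, Rstar x -> Rstar y -> 0 <= K x y.
Hypothesis K_sym : forall x y, Rstar x -> Rstar y -> K x y = K y x.
Hypothesis c2_gt0 : 0 < c2.
Hypothesis K_le : kernel_bound c2 beta gamma lambda K.

(** Case by case [omega] dominates the powers in the bound on the kernel: its
    exponent is the smallest one near [0] and the largest one near infinity.
    For two large particles, the negative power of the smaller one is dominated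
    thanks to [- lambda.2 <= gamma.2 + lambda.2]. *)
Lemma kernel_le_omega x y : E x -> E y -> K x y <= c2 * (w x * w y).
Proof.
suff half u v : E u -> E v -> norm1 v <= norm1 u -> K u v <= c2 * (w u * w v).
  move=> Ex Ey; have [xy|xy] := leP (norm1 y) (norm1 x); first exact: half.
  by rewrite K_sym// [w x * _]mulrC half// ltW.
move=> Eu Ev vu; have [K1 K2 K3] := K_le Eu Ev vu.
have u0 := norm1_gt0 Eu; have v0 := norm1_gt0 Ev.
have [u1|u1] := leP (norm1 u) 1; last have [v1|v1] := leP (norm1 v) 1.
- have v1 := le_trans vu u1; apply: le_trans (K1 u1 v1) _.
  rewrite ler_pM2l// /omega u1 v1 ler_pM ?powR_ge0// ger_powR ?u0 ?v0 ?u1 ?v1//.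
    by rewrite ge_min lexx.
  by rewrite ge_min lexx.
- apply: le_trans (K2 (ltW u1) v1) _.
  rewrite ler_pM2l// /omega v1 (leNgt _ 1) u1/= ler_pM ?powR_ge0//.
    by rewrite ler_powR ?(ltW u1)// le_max lexx.
  by rewrite ger_powR ?v0 ?v1// ge_min lexx orbT.
- apply: le_trans (K3 (ltW u1) (ltW v1)) _.
  rewrite ler_pM2l// /omega (leNgt (norm1 u) 1) u1 (leNgt (norm1 v) 1) v1/=.
  rewrite ler_pM ?powR_ge0// ler_powR ?(ltW u1) ?(ltW v1)// le_max ?lexx ?orbT//.
  by rewrite exponents2.1 orbT.
Qed.

(** All the powers in the moment have an exponent at most 1, whence its
    subadditivity. *)
Lemma kernel_dominated : dominated_kernel E K c2 w W.
Proof.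
split => //.
- exact: Rstar_add.
- exact: ltW.
- by move=> x /norm1_gt0; exact: mass_weight_gt0.
- exact: kernel_le_omega.
- move=> x /norm1_gt0 x0; apply: mass_weight_le_moment => //.
  exact: high_exponent_lt1.
- move=> x y Ex Ey; rewrite norm1D//; apply: mass_moment_subadditive => //.
  + exact: low_exponent_lt1.
  + exact: norm1_gt0.
  + exact: norm1_gt0.
Qed.

End kernel_weights.

(** * Moments of the solution, and existence *)

Section represented_moments.
Context {R : realType} {d : nat}.
Local Notation T := 'rV[R]_d.
Local Notation B := (borelRV R d).
Context (E : set T) (q w : T -> R).
Hypothesis mE : measurable (E : set B).
Hypothesis q_cont : {within E, continuous q}.
Hypothesis q_compact : forall e, 0 < e -> compact [set x | E x /\ e <= q x].
Hypothesis q_gt0 : forall x, E x -> 0 < q x.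
Hypothesis w_cont : {within E, continuous w}.
Hypothesis w_gt0 : forall x, E x -> 0 < w x.

(** The moment [g] itself need not be in the domain of the functional, so it is
    reached by monotone convergence along cutoffs. *)
Lemma represents_moment_le (f : {measure set B -> \bar R}) Lam (g : T -> R) (A : R) :
  represents E w f Lam -> {within E, continuous g} ->
  (forall x, E x -> 0 <= g x) ->
  (forall h, Cq E q h -> (forall x, E x -> 0 <= h x <= 1) ->
    Lam (fun x => h x * g x / w x) <= A) ->
  (\int[f]_(x in E) (g x)%:E <= A%:E)%E.
Proof.
move=> fLam gc g0 gA.
pose h n x := 1 - escape q (n.+1%:R^-1) x.
have h01 n x : 0 <= h n x <= 1.
  by have /andP[e0 e1] := escape_itv q n.+1%:R^-1 x; rewrite subr_ge0 e1 gerBl.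
have n0 n : 0 < n.+1%:R^-1 :> R by rewrite invr_gt0.
have hC n : Cq E q (h n).
  split; first by apply: CbB; [exact: Cb_cst|exact: Cb_escape].
  exists (n.+1%:R^-1 / 2); first by rewrite divr_gt0.
  by move=> x Ex qx; rewrite /h escape_eq1 ?subrr// ltW.
have hgC n : Cq E q (fun x => h n x * g x) by exact: CqM.
have hg_int n : (\int[f]_(x in E) (h n x * g x)%:E <= A%:E)%E.
  rewrite (represents_Cq q_compact w_cont w_gt0 fLam (hgC n)) lee_fin.
  by apply: gA.
have h_nd x : E x -> {homo h^~ x : n m / (n <= m)%N >-> n <= m}.
  move=> Ex n m nm; rewrite /h lerD2l lerN2 /escape.
  have inv : 2 / n.+1%:R^-1 * q x <= 2 / m.+1%:R^-1 * q x.
    by rewrite !invrK ler_wpM2r ?(ltW (q_gt0 Ex))// ler_pM2l// ler_nat.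
  rewrite le_min ge_min lexx/= ge_min; apply/orP; right.
  rewrite ge_max le_max lexx/= le_max; apply/orP; right.
  by rewrite lerD2l lerN2.
have limE x : E x -> limn (fun n => (h n x * g x)%:E) = (g x)%:E.
  move=> Ex; apply/cvg_lim => //; apply: cvg_near_cst.
  near=> n; rewrite /h escape_eq0 ?subr0 ?mul1r//.
  by apply: ltW; near: n; exact: (near_infty_natSinv_lt (PosNum (q_gt0 Ex))).
have conv : (\int[f]_(x in E) (h n x * g x)%:E)%E @[n --> \oo] -->
    (\int[f]_(x in E) (g x)%:E)%E.
  rewrite (eq_integral (fun x : B => limn (fun n => (h n x * g x)%:E))); last first.
    by move=> x /set_mem /limE.
  apply: (@cvg_monotone_convergence _ B R f E mE (fun n x => (h n x * g x)%:E)).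
  - move=> n; apply/measurable_EFinP; apply: measurable_within_continuous => //.
    by have [[]] := hgC n.
  - by move=> n x Ex; rewrite lee_fin mulr_ge0 ?g0//; case/andP: (h01 n x).
  - by move=> x Ex n m nm; rewrite lee_fin ler_wpM2r ?g0// h_nd.
by apply: (cvge_to_le conv); exact: nearW.
Unshelve. all: by end_near. Qed.

Lemma integrable_represents (f : {measure set B -> \bar R}) (W : T -> R) Lam :
  f (~` E) = 0%E -> f.-integrable (E : set B) (EFin \o W) ->
  (forall x, E x -> w x <= W x) ->
  (forall h, Cb E h -> Lam h = (\int[f]_(x in E) (h x * w x))%R) ->
  represents E w f Lam.
Proof.
move=> fE W_int wW LamE; split => // h Ch; rewrite LamE// /Rintegral fineK//.
apply: integrable_fin_num => //.
have [N [N0 hN]] := CbP Ch.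
apply: (@le_integrable _ B R f E mE _ (fun x => (N * W x)%:E)).
- apply/measurable_EFinP; apply: measurable_within_continuous => //.
  by apply: within_continuousM => //; exact: Ch.1.
- move=> x Ex /=; have w0 := ltW (w_gt0 Ex).
  have W0 := le_trans w0 (wW x Ex).
  rewrite lee_fin normrM (ger0_norm w0) [leRHS]ger0_norm ?mulr_ge0 ?(ltW N0)//.
  by rewrite ler_pM// ?hN// wW.
- exact: (integrableZl mE N W_int).
Qed.

End represented_moments.

Theorem theorem1p1 (R : realType) (d : nat) (d_ge1 : (1 <= d)%N)
  (K : 'rV[R]_d -> 'rV[R]_d -> R)
  (K_ge0 : forall x y, Rstar x -> Rstar y -> 0 <= K x y)
  (K_cont : {within @Rstar R d `*` @Rstar R d,
    continuous (fun p : 'rV[R]_d * 'rV[R]_d => K p.1 p.2)})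
  (K_sym : forall x y, Rstar x -> Rstar y -> K x y = K y x)
  (c2 beta : R) (gamma lambda : R * R) (c2_gt0 : 0 < c2)
  (exponents1 : - lambda.1 <= gamma.1 + lambda.1 /\ gamma.1 + lambda.1 < 1)
  (exponents2 : - lambda.2 <= gamma.2 + lambda.2 /\ gamma.2 + lambda.2 < 1)
  (K_le : kernel_bound c2 beta gamma lambda K)
  (f0 : {measure set (borelRV R d) -> \bar R}) (f0_radon : radon_pos f0)
  (r : R) (r_gt0 : 0 < r)
  (f0_moment : (\int[f0]_(x in @Rstar R d)
     (norm1 x `^ (Num.min (- beta) (- lambda.1) - r) + norm1 x)%:E < +oo)%E) :
  exists f : R -> {measure set (borelRV R d) -> \bar R},
    is_weak_solution K beta gamma lambda f0 f.
Proof.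
pose E := @Rstar R d; pose B := borelRV R d.
pose w := @omega R d beta gamma lambda.
pose W := fun x : 'rV[R]_d => mass_moment (Num.min (- beta) (- lambda.1)) r (norm1 x).
pose q := fun x => w x / W x.
have mE : measurable (E : set B) := @measurable_Rstar R d.
have w_cont : {within E, continuous w} := @omega_continuous R d beta gamma lambda.
have W_cont : {within E, continuous W} := @moment_continuous R d beta lambda r.
have dK : dominated_kernel E K c2 w W by exact: (kernel_dominated exponents1 exponents2 r_gt0).
have q_compact e : 0 < e -> compact [set x | E x /\ e <= q x].
  exact: (compact_weight_ratio exponents1 exponents2 r_gt0).
have w_gt0 := dom_gt0 dK; have W_gt0 := W_gt0 dK.
have q_cont : {within E, continuous q} := within_continuous_ratio dK w_cont W_cont.
have q_gt0 x : E x -> 0 < q x by move=> Ex; rewrite divr_gt0 ?w_gt0 ?W_gt0.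
have W_int : f0.-integrable (E : set B) (EFin \o W).
  apply/integrableP; split.
    by apply/measurable_EFinP; exact: measurable_within_continuous.
  apply: le_lt_trans f0_moment; rewrite le_eqVlt; apply/orP; left; apply/eqP.
  by apply: eq_integral => x /set_mem Ex /=; rewrite gtr0_norm// W_gt0.
have W_dominates (g : 'rV[R]_d -> R) : {within E, continuous g} ->
    (forall x, E x -> 0 <= g x <= W x) -> (\int[f0]_(x in E) (g x)%:E < +oo)%E.
  move=> gc gW; apply: le_lt_trans f0_moment; apply: ge0_le_integral => //.
  - by move=> x /gW/andP[].
  - by apply/measurable_EFinP; exact: measurable_within_continuous.
  - by apply/measurable_EFinP; exact: (measurable_within_continuous mE W_cont).
  - by move=> x /gW/andP[].
have [Lam [tLam Lam0 Lam_lip Lam_der Lam_add]] :=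
  coagulation_functional dK w_cont W_cont K_cont q_compact mE W_int.
set M := (\int[f0]_(x in E) W x)%R in tLam Lam_lip.
(* At time 0 the given measure itself is taken as representative, so that the
   initial condition holds as an equality of measures. *)
have f0Lam : represents E w f0 (Lam 0).
  by apply: (integrable_represents mE w_cont w_gt0 f0_radon.1 W_int (dom_weight dK)).
have /choice[f fP] : forall t, exists ft : {measure set B -> \bar R},
    represents E w ft (Lam t) /\ (t = 0 -> ft = f0).
  move=> t; have [->|t0] := eqVneq t 0; first by exists f0.
  have [ft ftLam] := tight_represents mE q_cont q_compact w_cont w_gt0 (tLam t).
  by exists ft; split => // te; rewrite te eqxx in t0.
have fLam t : represents E w (f t) (Lam t) := (fP t).1.
have f0E : f 0 = f0 := (fP 0).2 erefl.
have mass_f t : (\int[f t]_(x in E) (w x)%:E = (Lam t (fun=> 1))%:E)%E.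
  rewrite -(fLam t).2; last exact: Cb_cst.
  by apply: eq_integral => x _; rewrite mul1r.
have Cc_Cb psi : @Cc R d psi -> Cb E psi.
  move=> [psic [C [cC CE psi0]]].
  by have [] := compact_support_Cq q_cont q_gt0 q_compact cC CE psic psi0.
exists f; split; last (split; last split).
- split=> //.
  + apply: W_dominates => [|x Ex].
      by apply: continuous_subspaceT => x; exact: norm1_continuous.
    by rewrite norm1_ge0 lerDr powR_ge0.
  + apply: W_dominates => // x Ex.
    by rewrite (ltW (w_gt0 _ Ex)) (dom_weight dK).
- move=> t _; split; first exact: (fLam t).1.
  by move=> C; exact: (represents_compact mE w_cont w_gt0 (fLam t)).
- by move=> A _; rewrite f0E.
- split=> [t _|psi psi0]; first by rewrite mass_f ltry.
  have Cpsi : Cb E psi.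
    apply: Cb_uniform_limit => e /psi0[chi Cchi psichi].
    by exists chi => //; exact: Cc_Cb.
  rewrite (_ : (fun t => _) = fun t => (Lam t psi)%:E); last first.
    by apply/funext => t; rewrite -(fLam t).2.
  apply/subspace_continuousP => t; rewrite /= in_itv/= andbT => t0.
  apply: cvg_EFin; first exact: nearW.
  exact: (tight_family_continuous q_cont q_compact w_cont w_gt0 tLam Lam_lip Cpsi t0).
- move=> t _; apply: (@le_lt_trans _ _ M%:E); last exact: ltry.
  apply: ub_ereal_sup => _ [s _ <-]; rewrite mass_f lee_fin.
  exact: tight_mass (tLam s).
- move=> t _ j.
  have cj : continuous (fun x : 'rV[R]_d => x ord0 j) by exact: coord_continuous.
  have cEj : {within E, continuous (fun x : 'rV[R]_d => x ord0 j)}.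
    exact: continuous_subspaceT.
  have jW x : E x -> 0 <= x ord0 j <= W x.
    move=> Ex; have /andP[-> xj] := coord_le_norm1 j Ex.
    by rewrite (le_trans xj)// lerDr powR_ge0.
  have j_int : (\int[f0]_(x in E) (x ord0 j)%:E \is a fin_num)%E.
    by rewrite ge0_fin_numE ?W_dominates// integral_ge0// => x /jW/andP[].
  rewrite -[leRHS]fineK//.
  apply: (represents_moment_le mE q_cont q_compact q_gt0 w_cont w_gt0 (fLam t) cEj).
    by move=> x /jW/andP[].
  move=> h Ch h01; apply: Lam_add => // x y.
  by rewrite mxE.
- move=> t phi dphi t0 [phi_C1 phi_Cc phi_unif].
  have [C [N [cC CE phi0 dphiN]]] := phi_unif (t + 1) (addr_ge0 t0 ler01).
  rewrite -f0E.
  apply: (test_weak_formulation dK w_cont W_cont K_cont q_compact mE tLam Lam_lip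
    Lam_der (fun t _ => fLam t) t0 phi_C1 _ cC CE phi0 (normr_ge0 N)).
    by move=> s s0; have [] := phi_Cc s s0.
  by move=> x s Ex st; apply: le_trans (ler_norm _); exact: dphiN.
Qed.
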